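(* Let $n\ge2$, $d\ge1$ be integers, $d_1=\lceil(d+1)/2\rceil$, let $\mathcal{A}\in\mathtt{S}^d(\mathbb{R}^n)$ be completely positive, $y=\phi(\mathcal{A})$, and let $R\in\Sigma[\bar x]_{2d_1}$ be a generic SOS polynomial. If the optimization problem $$\max\ \langle\rho,\varpi^{-T}(y)\rangle\quad\text{s.t.}\quad R-\rho\in\mathcal{P}_{2d_1}(\overline{\Delta}),\ \ \rho\in\mathbb{R}[\bar x]_d$$ has a maximizer $\rho^*$ such that $R-\rho^*\in \mathrm{QM}[\overline{\Delta}]$, then the membership algorithm described in the context, applied to $\mathcal{A}$ with this $R$, terminates within finitely many steps and outputs a CP decomposition for $\mathcal{A}$.
   Context: Write $x=(x_1,\dots,x_n)$, $\bar n=n-1$, $\bar x=(x_1,\dots,x_{n-1})$; $e$ is the all-ones vector of appropriate length. For $\alpha\in\mathbb{N}^m$ let $|\alpha|=\alpha_1+\cdots+\alpha_m$; $\mathbb{N}_d^m=\{\alpha\in\mathbb{N}^m:|\alpha|\le d\}$, $\overline{\mathbb{N}}_d^n=\{\alpha\in\mathbb{N}^n:|\alpha|=d\}$. Vectors labelled by multi-indices act on polynomials by $\langle\sum_\alpha p_\alpha x^\alpha,y\rangle=\sum_\alpha p_\alpha y_\alpha$ (likewise in $\bar x$). $\mathbb{R}[\bar x]_m$ is the set of polynomials of degree at most $m$. $\mathtt{S}^d(\mathbb{R}^n)$ is the space of real symmetric tensors of order $d$ over $\mathbb{R}^n$. $\mathcal{A}\in\mathtt{S}^d(\mathbb{R}^n)$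 is completely positive (CP) if $\mathcal{A}=\sum_{i=1}^r (v_i)^{\otimes d}$ for some $v_i\in\mathbb{R}_+^n$ (a CP decomposition; nonnegative coefficients may be absorbed in the $v_i$), where $(v^{\otimes d})_{i_1\ldots i_d}=v_{i_1}\cdots v_{i_d}$. $\phi:\mathtt{S}^d(\mathbb{R}^n)\to\mathbb{R}^{\overline{\mathbb{N}}_d^n}$ is $\phi(\mathcal{A})_\alpha=\mathcal{A}_{i_1\ldots i_d}$ whenever $x^\alpha=x_{i_1}\cdots x_{i_d}$. $\varpi^{-T}:\mathbb{R}^{\overline{\mathbb{N}}_d^n}\to\mathbb{R}^{\mathbb{N}_d^{\bar n}}$ is $(\varpi^{-T}(y))_\alpha=\langle\bar x^\alpha(e^Tx)^{d-|\alpha|},y\rangle$. $\overline{\Delta}=\{\bar x\in\mathbb{R}^{\bar n}:\bar x\ge0,\ 1-e^T\bar x\ge0\}$. $\mathcal{P}_{m}(\overline{\Delta})$ is the cone of polynomials in $\mathbb{R}[\bar x]_m$ nonnegative on $\overline{\Delta}$. $\Sigma[\bar x]$ is the cone of sums of squares in $\mathbb{R}[\bar x]$, $\Sigma[\bar x]_{m}=\Sigma[\bar x]\cap\mathbb{R}[\bar x]_m$, and $$\mathrm{QM}[\overline{\Delta}]=\Sigma[\bar x]+\sum_{i=1}^{n-1}x_i\Sigma[\bar x]+(1-e^T\bar x)\Sigma[\bar x]+(1-\|\bar x\|^2)\Sigma[\bar x].$$ ''Generic $R$'' means: for all $R\in\Sigma[\bar x]_{2d_1}$ outside a subset of Lebesgue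 measure zero. For $z\in\mathbb{R}^{\mathbb{N}_{2k}^{\bar n}}$ and $q\in\mathbb{R}[\bar x]_{2k}$, $L_q^{(k)}[z]$ is the symmetric matrix, indexed by monomials of degree at most $k-\lceil\deg(q)/2\rceil$, with $\langle qa^2,z\rangle=\mathrm{vec}(a)^TL_q^{(k)}[z]\mathrm{vec}(a)$ for all $a$ with $\deg(qa^2)\le2k$ ($\mathrm{vec}(a)$ the coefficient vector); $M_k[z]=L_1^{(k)}[z]$. $\mathcal{S}[\overline{\Delta}]_{2k}$ is the set of $z\in\mathbb{R}^{\mathbb{N}_{2k}^{\bar n}}$ with $M_k[z]$, $L_{x_i}^{(k)}[z]$ ($1\le i\le n-1$), $L_{1-e^T\bar x}^{(k)}[z]$, $L_{1-\|\bar x\|^2}^{(k)}[z]$ all positive semidefinite. $z|_{2t}$ is the subvector of $z$ labelled by $\mathbb{N}_{2t}^{\bar n}$; $M_t[z]$ for $t\le k$ is formed from $z|_{2t}$. Membership algorithm. Input $\mathcal{A}$; $d_0=\lceil d/2\rceil$, $d_1=\lceil(d+1)/2\rceil$, $y=\phi(\mathcal{A})$. Step 0: set $k=d_1$ and take a generic $R\in\Sigma[\bar x]_{2d_1}$. Step 1: solve $$\min\ \langle R,z\rangle\quad\text{s.t.}\quad z_\alpha=\langle\bar x^\alpha(e^Tx)^{d-|\alpha|},y\rangle\ (\alpha\in\mathbb{N}_d^{\bar n}),\quad z\in\mathcal{S}[\overline{\Delta}]_{2k}.$$ If it is infeasible, output that $\mathcal{A}$ is not CP and stop; otherwise compute a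 minimizer $z^*$ and let $t=d_0$. Step 2: check whether $\operatorname{rank}M_t[z^*]=\operatorname{rank}M_{t-1}[z^*]$. If not, go to Step 3; if so, go to Step 4. Step 3: if $t<k$, set $t:=t+1$ and go to Step 2; otherwise set $k:=k+1$ and go to Step 1. Step 4: let $r=\operatorname{rank}M_t[z^*]$, compute the $r$-atomic measure $\lambda_1\delta_{v_1}+\cdots+\lambda_r\delta_{v_r}$ ($\delta_v$ is the Dirac measure at $v$) representing the truncation $z^*|_{2t}$, and output the decomposition $\mathcal{A}=\sum_{i=1}^r\lambda_i\begin{pmatrix}v_i\\1-e^Tv_i\end{pmatrix}^{\otimes d}$. *)

(* Defs.v *)
From HB Require Import structures.
From mathcomp Require Import all_boot all_order all_algebra all_fingroup.
From mathcomp Require Import reals.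
From mathcomp Require Import mpoly.

Set Implicit Arguments.
Unset Strict Implicit.
Unset Printing Implicit Defensive.

Import Order.TTheory GRing.Theory Num.Theory.
Local Open Scope ring_scope.

(* An abbreviation, so that client files need not import [mpoly] (whose
   notations conflict with those of mathcomp-analysis).                       *)
Notation mvpoly R m := {mpoly R[m]}.

(* Multi-indices of degree at most D, resp. of degree exactly d.              *)
Notation monom_le m D := 'X_{1..m < D.+1}.
Notation monom_eq n d := {a : monom_le n d | mdeg (bmnm a) == d}.

(* R^{N_D^m}, truncated multi-sequences.                                      *)
Notation tms R m D := {ffun monom_le m D -> R}.

Notation tensor R n d := {ffun {ffun 'I_d -> 'I_n} -> R}.

Definition symmetric_tensor (R : realType) (n d : nat) (A : tensor R n d) :=
  forall (s : 'S_d) (i : {ffun 'I_d -> 'I_n}), A [ffun j : 'I_d => i (s j)] = A i.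

Definition tpow (R : realType) (n d : nat) (v : 'rV[R]_n) : tensor R n d :=
  [ffun i : {ffun 'I_d -> 'I_n} => \prod_(j < d) v 0 (i j)].

Definition completely_positive (R : realType) (n d : nat) (A : tensor R n d) :=
  exists (r : nat) (v : 'I_r -> 'rV[R]_n),
    (forall i j, 0 <= v i 0 j) /\ A = \sum_(i < r) tpow d (v i).

Definition mon_of_idx (n d : nat) (i : {ffun 'I_d -> 'I_n}) : 'X_{1..n} :=
  (\sum_(j < d) U_(i j))%MM.

(* The value does not depend on the index picked when A is symmetric, see
   [phiE] below; some index always exists since |a| = d.                      *)
Definition phi (R : realType) (n d : nat) (A : tensor R n d) :
    {ffun monom_eq n d -> R} :=
  [ffun a : monom_eq n d =>
     if [pick i | mon_of_idx i == bmnm (val a)] is Some i then A i else 0 : R].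

Lemma phiE (R : realType) (n d : nat) (A : tensor R n d)
    (i : {ffun 'I_d -> 'I_n}) (a : monom_eq n d) :
  symmetric_tensor A -> mon_of_idx i = bmnm (val a) -> phi A a = A i.
Proof.
move=> symA ia; rewrite ffunE; case: pickP => [i' /eqP i'a | /(_ i)]; last first.
  by rewrite ia eqxx.
have cnt (f : {ffun 'I_d -> 'I_n}) x :
    count_mem x [tuple f j | j < d] = mon_of_idx f x.
  rewrite /mon_of_idx mnm_sumE -sum1_count big_map big_mkcond /= big_enum /=.
  by apply: eq_bigr => j _; rewrite mnm1E; case: eqP.
have /tuple_permP[s Es] : perm_eq [tuple i' j | j < d] [tuple i j | j < d].
  by apply/allP => x _ /=; rewrite !cnt i'a ia.
rewrite -(symA s i); congr (A _); apply/ffunP => j.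
by have /val_inj/(congr1 (fun u => tnth u j)) := Es; rewrite !tnth_mktuple ffunE.
Qed.

Definition pairing (R : realType) (m D : nat) (p : {mpoly R[m]})
    (z : tms R m D) : R :=
  \sum_(a : monom_le m D) p@_(bmnm a) * z a.

Definition hpairing (R : realType) (n d : nat) (p : {mpoly R[n]})
    (y : {ffun monom_eq n d -> R}) : R :=
  \sum_(a : monom_eq n d) p@_(bmnm (val a)) * y a.

(* xbar^a as a monomial in all the variables x_1, ..., x_n.                   *)
Definition xbar_mon (R : realType) (n : nat) (a : 'X_{1..n.-1}) : {mpoly R[n]} :=
  \prod_(i < n.-1) 'X_(widen_ord (leq_pred n) i) ^+ a i.

Definition varpi_invT (R : realType) (n d : nat)
    (y : {ffun monom_eq n d -> R}) : tms R n.-1 d :=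
  [ffun a : monom_le n.-1 d =>
     hpairing (xbar_mon R (bmnm a) * (\sum_(i < n) 'X_i) ^+ (d - mdeg (bmnm a)))
              y].

Definition deg_le (R : realType) (m D : nat) (p : {mpoly R[m]}) : Prop :=
  (msize p <= D.+1)%N.

Definition in_simplex (R : realType) (m : nat) (u : 'rV[R]_m) : Prop :=
  (forall i, 0 <= u 0 i) /\ 0 <= 1 - \sum_i u 0 i.

Definition nonneg_simplex (R : realType) (m D : nat) (p : {mpoly R[m]}) : Prop :=
  deg_le D p /\ forall u : 'rV[R]_m, in_simplex u -> 0 <= p.@[u 0].

Definition sos (R : realType) (m : nat) (p : {mpoly R[m]}) : Prop :=
  exists s : seq {mpoly R[m]}, p = \sum_(q <- s) q ^+ 2.

Definition sos_le (R : realType) (m D : nat) (p : {mpoly R[m]}) : Prop :=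
  sos p /\ deg_le D p.

Definition simplex_cstr (R : realType) (m : nat) : {mpoly R[m]} :=
  1 - \sum_(i < m) 'X_i.

Definition ball_cstr (R : realType) (m : nat) : {mpoly R[m]} :=
  1 - \sum_(i < m) 'X_i ^+ 2.

Definition quad_module (R : realType) (m : nat) (p : {mpoly R[m]}) : Prop :=
  exists (s0 : {mpoly R[m]}) (s : 'I_m -> {mpoly R[m]}) (s1 s2 : {mpoly R[m]}),
    [/\ sos s0, forall i, sos (s i), sos s1 & sos s2] /\
    p = s0 + \sum_(i < m) 'X_i * s i + simplex_cstr R m * s1
        + ball_cstr R m * s2.

Definition dual_feasible (R : realType) (m d D : nat) (F rho : {mpoly R[m]}) :=
  nonneg_simplex D (F - rho) /\ deg_le d rho.

Definition dual_maximizer (R : realType) (m d D : nat) (F : {mpoly R[m]})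
    (w : tms R m d) (rho : {mpoly R[m]}) : Prop :=
  dual_feasible d D F rho /\
  forall rho', dual_feasible d D F rho' -> pairing rho' w <= pairing rho w.

Definition psd (R : realType) (N : nat) (M : 'M[R]_N) : Prop :=
  M^T = M /\ forall u : 'cV[R]_N, 0 <= (u^T *m M *m u) 0 0.

(* ceil(deg q / 2)                                                            *)
Definition half_deg (R : realType) (m : nat) (q : {mpoly R[m]}) : nat :=
  uphalf (msize q).-1.

Definition coef_vec (R : realType) (m D : nat) (p : {mpoly R[m]}) :
    'cV[R]_#|{: monom_le m D}| :=
  \col_i p@_(bmnm (enum_val i)).

Definition loc_mx (R : realType) (m k : nat) (q : {mpoly R[m]})
    (z : tms R m (2 * k)) : 'M[R]_#|{: monom_le m (k - half_deg q)}| :=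
  \matrix_(i, j) pairing (q * 'X_[bmnm (enum_val i)] * 'X_[bmnm (enum_val j)]) z.

Lemma loc_mx_sym (R : realType) (m k : nat) (q : {mpoly R[m]})
    (z : tms R m (2 * k)) : (loc_mx q z)^T = loc_mx q z.
Proof. by apply/matrixP => i j; rewrite !mxE -!mulrA [X in q * X]mulrC. Qed.

(* The defining property of the localizing matrix; a is subject to
   deg a <= k - ceil(deg q / 2), i.e. deg (q a^2) <= 2k.                      *)
Lemma loc_mxP (R : realType) (m k : nat) (q a : {mpoly R[m]})
    (z : tms R m (2 * k)) :
  deg_le (k - half_deg q) a ->
  pairing (q * a ^+ 2) z
  = ((coef_vec (k - half_deg q) a)^T *m loc_mx q z
       *m coef_vec (k - half_deg q) a) 0 0.
Proof.
set D := (k - half_deg q)%N => dega.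
have aE : a = \sum_(i < #|{: monom_le m D}|)
               coef_vec D a i 0 *: 'X_[bmnm (enum_val i)].
  rewrite [LHS](mpolywE dega); rewrite [RHS](reindex_onto enum_rank enum_val);
    last by move=> i _; rewrite enum_valK.
  rewrite /= [RHS](eq_bigl xpredT); last by move=> b; rewrite enum_rankK eqxx.
  by apply: eq_bigr => b _; rewrite mxE enum_rankK.
have pairingD p1 p2 : pairing (p1 + p2) z = pairing p1 z + pairing p2 z.
  rewrite /pairing -big_split; apply: eq_bigr => b _.
  by rewrite mcoeffD mulrDl.
have pairing0 : pairing 0 z = 0.
  by rewrite /pairing big1 // => b _; rewrite mcoeff0 mul0r.
have pairingZ c p : pairing (c *: p) z = c * pairing p z.
  rewrite /pairing mulr_sumr; apply: eq_bigr => b _.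
  by rewrite mcoeffZ mulrA.
have pairing_sum (I : finType) (f : I -> {mpoly R[m]}) :
    pairing (\sum_i f i) z = \sum_i pairing (f i) z.
  exact: (big_morph (fun p => pairing p z) pairingD pairing0).
rewrite [in LHS]aE expr2 mulr_sumr mulr_sumr pairing_sum mxE.
apply: eq_bigr => j _; rewrite [in RHS]mxE mulr_suml.
rewrite mulr_suml mulr_sumr pairing_sum; apply: eq_bigr => i _.
rewrite !mxE -scalerAl -!scalerAr !pairingZ -[RHS]mulrA.
by congr (_ * _); rewrite mulrC mulrA.
Qed.

(* [mom_mx] is M_k[z]; it is [loc_mx 1 z] up to the index bound
   k - half_deg 1 = k.                                                        *)
Definition mom_mx (R : realType) (m k : nat) (z : tms R m (2 * k)) :=
  loc_mx 1 z.

Definition moment_cone (R : realType) (m k : nat) (z : tms R m (2 * k)) : Prop :=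
  [/\ psd (mom_mx z),
      forall i : 'I_m, psd (loc_mx 'X_i z),
      psd (loc_mx (simplex_cstr R m) z)
    & psd (loc_mx (ball_cstr R m) z)].

(* The subvector labelled by the multi-indices of degree at most D'; it is
   only used with D' <= D.                                                    *)
Definition trunc (R : realType) (m D D' : nat) (z : tms R m D) : tms R m D' :=
  [ffun a : monom_le m D' => oapp z 0 (insub (bmnm a))].

(* rank M_t[z]                                                                *)
Definition mom_rank (R : realType) (m D t : nat) (z : tms R m D) : nat :=
  \rank (mom_mx (trunc (2 * t) z)).

Definition d0 (d : nat) : nat := uphalf d.
Definition d1 (d : nat) : nat := uphalf d.+1.

Definition relax_feasible (R : realType) (m d k : nat) (w : tms R m d)
    (z : tms R m (2 * k)) : Prop :=
  trunc d z = w /\ moment_cone z.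

Definition relax_minimizer (R : realType) (m d k : nat) (F : {mpoly R[m]})
    (w : tms R m d) (z : tms R m (2 * k)) : Prop :=
  relax_feasible w z /\
  forall z' : tms R m (2 * k), relax_feasible w z' -> pairing F z <= pairing F z'.

(* The measure \sum_i lam_i \delta_{v_i}, with r distinct atoms, represents the
   multi-sequence z: z_a is the integral of xbar^a.                           *)
Definition atomic_repr (R : realType) (m D r : nat) (lam : 'I_r -> R)
    (v : 'I_r -> 'rV[R]_m) (z : tms R m D) : Prop :=
  [/\ forall i, 0 < lam i,
      injective v
    & forall a : monom_le m D,
        z a = \sum_(i < r) lam i * ('X_[bmnm a] : {mpoly R[m]}).@[v i 0]].

(* The membership algorithm.  In [Check], [Advance] and [Extract], k is the
   order of the relaxation, followed by the order t of the moment matrix and a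
   minimizer z of the relaxation; they stand for the rank test, the update of
   t or k when it fails, and the extraction of atoms when it succeeds.        *)
Inductive state (R : realType) (m : nat) : Type :=
| Solve of nat
| Check (k : nat) of nat & tms R m (2 * k)
| Advance (k : nat) of nat & tms R m (2 * k)
| Extract (k : nat) of nat & tms R m (2 * k)
| OutputNotCP
| OutputDecomposition (r : nat) of 'I_r -> R & 'I_r -> 'rV[R]_m.
Arguments Solve {R m}.
Arguments OutputNotCP {R m}.

(* The minimizer and the atomic measure may be any ones meeting the
   specification, hence a relation.                                           *)
Inductive step (R : realType) (m d : nat) (F : {mpoly R[m]}) (w : tms R m d) :
    state R m -> state R m -> Prop :=
| StepInfeasible k :
    (forall z : tms R m (2 * k), ~ relax_feasible w z) ->
    step F w (Solve k) OutputNotCP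
| StepMinimize k (z : tms R m (2 * k)) :
    relax_minimizer F w z -> step F w (Solve k) (Check (d0 d) z)
| StepNotFlat k t (z : tms R m (2 * k)) :
    mom_rank t z <> mom_rank t.-1 z -> step F w (Check t z) (Advance t z)
| StepFlat k t (z : tms R m (2 * k)) :
    mom_rank t z = mom_rank t.-1 z -> step F w (Check t z) (Extract t z)
| StepIncrT k t (z : tms R m (2 * k)) :
    (t < k)%N -> step F w (Advance t z) (Check t.+1 z)
| StepIncrK k t (z : tms R m (2 * k)) :
    (k <= t)%N -> step F w (Advance t z) (Solve k.+1)
| StepExtract k t (z : tms R m (2 * k)) (lam : 'I_(mom_rank t z) -> R)
    (v : 'I_(mom_rank t z) -> 'rV[R]_m) :
    atomic_repr lam v (trunc (2 * t) z) ->
    step F w (Extract t z) (OutputDecomposition lam v).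

(* Total correctness: every run from the given state is finite, no run gets
   stuck before satisfying [post], and every final state satisfies [post].    *)
Inductive terminates_in (T : Type) (next : T -> T -> Prop) (post : T -> Prop) :
    T -> Prop :=
| Halted s : (forall s', ~ next s s') -> post s -> terminates_in next post s
| Running s : (exists s', next s s') ->
    (forall s', next s s' -> terminates_in next post s') ->
    terminates_in next post s.

(* (v, 1 - e^T v)                                                             *)
Definition lift_point (R : realType) (n : nat) (v : 'rV[R]_n.-1) : 'rV[R]_n :=
  \row_(j < n) oapp (fun i : 'I_n.-1 => v 0 i) (1 - \sum_i v 0 i) (insub (val j)).

(* The state is an output A = \sum_i lam_i (v_i, 1 - e^T v_i)^{\otimes d} which
   is a CP decomposition, with nonnegative coefficients kept explicit.        *)
Definition outputs_cp_decomposition (R : realType) (n d : nat)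
    (A : tensor R n d) (s : state R n.-1) : Prop :=
  if s is OutputDecomposition r lam v then
    [/\ forall i, 0 <= lam i,
        forall i j, 0 <= lift_point (v i) 0 j
      & forall idx, A idx = \sum_(i < r) lam i * tpow d (lift_point (v i)) idx]
  else False.

(* N has Lebesgue outer measure zero in R^I: it is covered by countably many
   closed boxes of arbitrarily small total volume.                            *)
Definition lebesgue_null (R : realType) (I : finType)
    (N : {ffun I -> R} -> Prop) : Prop :=
  forall eps : R, 0 < eps ->
  exists lo hi : nat -> {ffun I -> R},
    [/\ forall j i, lo j i <= hi j i,
        forall x, N x -> exists j, forall i, lo j i <= x i <= hi j i
      & forall J : nat, \sum_(j < J) \prod_i (hi j i - lo j i) <= eps].

Definition coefs (R : realType) (m D : nat) (p : {mpoly R[m]}) : tms R m D :=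
  [ffun a : monom_le m D => p@_(bmnm a)].

(* Main.v *)
Require Import Defs.
From HB Require Import structures.
From mathcomp Require Import all_boot all_order all_algebra all_fingroup.
From mathcomp Require Import reals.
From mathcomp Require boolp classical_sets functions topology normedtype derive complex spectral.
From mathcomp Require Import -(notations) mpoly.
From mathcomp Require Import ring lra zify.

(** Write $m = n - 1$, $w = \varpi^{-T}(y)$ and $G = R - \rho^*$.

    At a flat truncation the algorithm succeeds.  The Curto-Fialkow theorem
    [flat_atomic] provides the atoms, localization puts them into the simplex
    [flat_atoms_in_simplex], and the moments of degree at most $d$ determine the
    tensor [decomposition_of_atoms].  A feasible relaxation has a minimizer, since
    the ball constraint bounds its feasible set [relax_minimizer_exists].  So it is
    enough to find one order $k$ for which every minimizer has a flat truncation
    [eventually_flat].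

    By strong duality [moment_no_gap] a minimizer $z$ satisfies $L_z(G) \le 0$.  The
    ball constraint belongs to the quadratic module of the linear ones [ball_cstrE],
    so $G = \sum_c q_c \sum_p p^2$ where each $q_c$ is one or a facet, that is, a
    barycentric coordinate.  When the order is large, $L_z$ is nonnegative on each
    term; hence it kills each $q_c p$ together with its multiples of bounded degree.
    The polynomials killed in this way by all minimizers of large order form an
    ideal $J$ [eventually_null].  If $J$ has finite codimension, the ranks of the
    moment matrices are bounded independently of the order [mom_rank_le], and being
    nondecreasing they cannot grow at each step [stationary_exists].

    Genericity makes the codimension of $J$ finite.  By the Leibniz rule $J$ contains
    the derivatives of $G$ along each face, multiplied by the facets that do not
    vanish on that face [face_deriv_ideal]: the complex zeros of $J$ are critical
    points of $G$ on the affine spans of the faces.  Finite codimension is expressed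
    by a nonzero univariate polynomial in each coordinate.  For the ideal of critical
    points on one face such polynomials exist when a matrix built from the
    coefficients of degree $2 d_1$ is invertible [univ_face_ideal]; as
    $\deg \rho^* \le d < 2 d_1$, this is a condition on $R$ alone.  The faces are put
    together by induction, multiplying the univariate polynomials
    [univ_ideal_of_faces].

    The exceptional set is then a finite union of zero sets of determinants of
    matrices that depend linearly on $R$ and are invertible at a sum of pure powers.
    Such a zero set is null [det_zero_finite_cover]: along one direction the
    determinant is a characteristic polynomial, so that few translates of the zero
    set meet. *)

Set Implicit Arguments.
Unset Strict Implicit.
Unset Printing Implicit Defensive.
Import Order.TTheory GRing.Theory Num.Theory.
Local Open Scope ring_scope.

(** * Minimization over compact polyhedra *)

Module Compactness.
Import boolp classical_sets functions topology normedtype derive.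
Import numFieldTopology.Exports numFieldNormedType.Exports.
Local Open Scope classical_set_scope.

Lemma sum_continuous (R : realType) (T : topologicalType) (I : Type)
    (r : seq I) (f : I -> T -> R) :
  (forall i, continuous (f i)) -> continuous (fun v => \sum_(i <- r) f i v).
Proof.
move=> cf; elim: r => [|i r IH] v.
  under eq_fun do rewrite big_nil.
  exact: cst_continuous.
under eq_fun do rewrite big_cons.
by apply: continuousD; [exact: cf | exact: IH].
Qed.

Lemma linear_continuous_row (R : realType) (N : nat) (l : 'I_N -> R) :
  continuous (fun v : 'rV[R]_N => \sum_i l i * v 0 i).
Proof.
apply: sum_continuous => i v.
by apply: continuousM; [exact: cst_continuous | exact: coord_continuous].
Qed.

(** Infinitely many inequalities are allowed, as positive semidefiniteness of a
    matrix is a family of linear inequalities in its entries.  The sum of squares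
    in the objective serves to compute distances to linear images. *)
Lemma polyhedron_min_row (R : realType) (N : nat) (T : Type) (c : T -> R)
    (l : T -> 'I_N -> R) (B : R) (J : finType) (a : J -> 'I_N -> R) (b : J -> R)
    (g : 'I_N -> R) (C := fun z : 'rV[R]_N => forall t, c t <= \sum_i l t i * z 0 i)
    (obj := fun z : 'rV[R]_N =>
       \sum_j (\sum_i a j i * z 0 i - b j) ^+ 2 + \sum_i g i * z 0 i) :
  (forall z, C z -> forall i, `|z 0 i| <= B) -> (exists z, C z) ->
  exists z, C z /\ forall z', C z' -> obj z <= obj z'.
Proof.
move=> bC [z0 Cz0].
have cptC : compact [set z | C z].
  apply: bounded_closed_compact.
    exists `|B|; split; first exact: num_real.
    move=> M BM z /= /bC zB; have M0 : 0 <= M := le_trans (normr_ge0 _) (ltW BM).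
    rewrite [leLHS]/Num.norm/= mx_normrE; apply: bigmax_le => // -[i j] _ /=.
    by rewrite (ord1 i) (le_trans (zB j))// (le_trans (ler_norm B)) ?ltW.
  rewrite (_ : [set z | C z] = \bigcap_(t in setT)
      ((fun z : 'rV[R]_N => \sum_i l t i * z 0 i) @^-1` [set x | c t <= x])).
    by apply: closed_bigI => t _; apply: closed_comp;
      [move=> v _; exact: linear_continuous_row | exact: closed_ge].
  apply/seteqP; split=> [z Cz t _ | z Cz t]; first exact: Cz.
  exact: (Cz t).
have cobj : continuous obj.
  move=> v; apply: continuousD; last exact: linear_continuous_row.
  apply: (@sum_continuous R 'rV[R]_N J (index_enum J)
    (fun j z => (\sum_i a j i * z 0 i - b j) ^+ 2)) => j w.
  have cw : {for w, continuous (fun z : 'rV[R]_N => \sum_i a j i * z 0 i - b j)}.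
    by apply: continuousB; [exact: linear_continuous_row | exact: cst_continuous].
  by apply: (@continuousM R 'rV[R]_N _ _ w cw cw).
have C0 : [set z | C z] !=set0 by exists z0.
have [z zC zmin] := compact_EVT_min C0 cptC (continuous_subspaceT cobj).
by exists z; split=> [|z' Cz']; [exact: set_mem zC | apply: zmin; exact: mem_set].
Qed.

Lemma polyhedron_min (R : realType) (I : finType) (T : Type) (c : T -> R)
    (l : T -> I -> R) (B : R) (J : finType) (a : J -> I -> R) (b : J -> R)
    (g : I -> R) (C := fun z : {ffun I -> R} => forall t, c t <= \sum_i l t i * z i)
    (obj := fun z : {ffun I -> R} =>
       \sum_j (\sum_i a j i * z i - b j) ^+ 2 + \sum_i g i * z i) :
  (forall z, C z -> forall i, `|z i| <= B) -> (exists z, C z) ->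
  exists z, C z /\ forall z', C z' -> obj z <= obj z'.
Proof.
move=> bC [z0 Cz0].
have sumE (h : I -> R) (w : 'I_#|I| -> R) :
    \sum_(i < #|I|) h (enum_val i) * w i = \sum_i h i * w (enum_rank i).
  rewrite [RHS](reindex_onto enum_val enum_rank) /=; last by move=> i _; rewrite enum_rankK.
  by apply: eq_big => i; rewrite ?enum_valK ?eqxx.
have sumE' (h : I -> R) (z : {ffun I -> R}) :
    \sum_(i < #|I|) h (enum_val i) * (\row_(i < #|I|) z (enum_val i)) 0 i = \sum_i h i * z i.
  apply: etrans (sumE h (fun i => (\row_(i < #|I|) z (enum_val i)) 0 i)) _.
  by apply: eq_bigr => i _; rewrite mxE enum_rankK.
have sumE2 (h : I -> R) (z : 'rV[R]_#|I|) :
    \sum_(i < #|I|) h (enum_val i) * z 0 i = \sum_i h i * [ffun i => z 0 (enum_rank i)] i.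
  by apply: etrans (sumE h (fun i => z 0 i)) _; apply: eq_bigr => i _; rewrite ffunE.
have [||z [Cz zmin]] := @polyhedron_min_row R #|I| T c
  (fun t i => l t (enum_val i)) B J (fun j i => a j (enum_val i)) b
  (fun i => g (enum_val i)).
- move=> z Cz i.
  have /bC/(_ (enum_val i)) : C [ffun i => z 0 (enum_rank i)].
    by move=> t; rewrite -(sumE2 (l t)); exact: Cz.
  by rewrite ffunE enum_valK.
- by exists (\row_(i < #|I|) z0 (enum_val i)) => t; rewrite (sumE' (l t)).
exists [ffun i => z 0 (enum_rank i)]; split=> [t|z' Cz'].
  by rewrite -(sumE2 (l t)); exact: Cz.
have objE (w : 'rV[R]_#|I|) :
    \sum_j (\sum_i a j (enum_val i) * w 0 i - b j) ^+ 2
      + \sum_i g (enum_val i) * w 0 i = obj [ffun i => w 0 (enum_rank i)].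
  rewrite /obj (sumE2 g); congr (_ + _).
  by apply: eq_bigr => j _; rewrite (sumE2 (a j)).
have -> : obj z' = obj [ffun i => (\row_(i < #|I|) z' (enum_val i)) 0 (enum_rank i)].
  by congr obj; apply/ffunP => i; rewrite ffunE mxE enum_rankK.
by rewrite -!objE; apply: zmin => t; rewrite (sumE' (l t)); exact: Cz'.
Qed.

End Compactness.

(** * Diagonalization of real symmetric matrices *)

Module RealSpectral.
Import complex spectral sesquilinear.

(** A real symmetric matrix is hermitian, so unitarily similar over the complex
    numbers to a diagonal matrix with real entries; its minimal polynomial
    then divides a product of distinct real linear factors. *)
Lemma symmetric_diagonalizable (R : rcfType) (n : nat) (A : 'M[R]_n) :
  A^T = A -> diagonalizable A.
Proof.
case: n A => [|n] A symA; first by rewrite [A]flatmx0; exact: diagonalizable0.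
pose f : {rmorphism R -> complex R} := real_complex R.
pose Ac := map_mx f A.
have Ac_real : Ac \is a mxOver Num.real.
  by apply/mxOverP => i j; rewrite mxE; apply/complex_realP; exists (A i j).
have Ac_sym : Ac \is symmetricmx.
  by apply/is_hermitianmxP; rewrite expr0 scale1r; apply/matrixP => i j;
     rewrite !mxE /= -[in LHS]symA mxE.
have Ac_herm := realsym_hermsym Ac_sym Ac_real.
have := hermitian_spectral_diag_real Ac_herm.
have /orthomx_spectralP := hermitian_normalmx Ac_herm.
have := spectral_unit Ac.
set P := spectralmx Ac; set sp := spectral_diag Ac => Pu AcE /mxOverP sp_real.
have [c cE] : exists c : 'I_n.+1 -> R, forall i, sp 0 i = f (c i).
  apply: (@fin_all_exists _ _ (fun i x => sp 0 i = f x)) => i; have /complex_realP[x xE] := sp_real 0 i.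
  by exists x.
apply/diagonalizableP; exists (undup [seq c i | i <- enum 'I_n.+1]); first exact: undup_uniq.
set p := \prod_(x <- _) _.
apply: mxminpoly_min; apply: (@map_mx_inj _ _ f).
rewrite map_mx0 map_horner_mx -/Ac AcE horner_mx_uconjC// horner_mx_diag.
suff -> : map_mx (horner (map_poly f p)) sp = 0.
  by rewrite raddf0 mulmx0 mul0mx.
apply/rowP => i; rewrite !mxE cE horner_map /=.
suff -> : p.[c i] = 0 by rewrite rmorph0.
apply/eqP; rewrite -/(root p (c i)) root_prod_XsubC mem_undup.
by apply: map_f; rewrite mem_enum.
Qed.

End RealSpectral.

From mathcomp Require Import mpoly.

(** * Polynomials, truncated moment sequences and the moment cone *)

Section Degree.
Variables (R : realType) (m : nat).
Implicit Types (p q : {mpoly R[m]}) (D : nat).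

Lemma deg_leP D p : deg_le D p <-> forall a : 'X_{1..m}, (D < mdeg a)%N -> p@_a = 0.
Proof.
split=> [dp a Da | dp].
  by apply/memN_msupp_eq0/msize_mdeg_ge/(leq_trans dp).
rewrite /deg_le msizeE; apply/bigmax_leqP_seq => a.
rewrite mcoeff_msupp => pa _; rewrite ltnS leqNgt; apply/negP => /dp pa0.
by rewrite pa0 eqxx in pa.
Qed.

Lemma deg_leW D D' p : (D <= D')%N -> deg_le D p -> deg_le D' p.
Proof. by rewrite /deg_le => DD' /leq_trans; apply; rewrite ltnS. Qed.

Lemma deg_le0 D : deg_le D (0 : {mpoly R[m]}).
Proof. by rewrite /deg_le msize0. Qed.

Lemma deg_le1 D : deg_le D (1 : {mpoly R[m]}).
Proof. by rewrite /deg_le msize1. Qed.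

Lemma deg_leD D p q : deg_le D p -> deg_le D q -> deg_le D (p + q).
Proof.
by move=> /deg_leP dp /deg_leP dq; apply/deg_leP => a Da;
   rewrite mcoeffD dp ?dq ?addr0.
Qed.

Lemma deg_leZ D c p : deg_le D p -> deg_le D (c *: p).
Proof. by move=> /deg_leP dp; apply/deg_leP => a Da; rewrite mcoeffZ dp ?mulr0. Qed.

Lemma deg_leN D p : deg_le D p -> deg_le D (- p).
Proof. by rewrite -scaleN1r; exact: deg_leZ. Qed.

Lemma deg_leB D p q : deg_le D p -> deg_le D q -> deg_le D (p - q).
Proof. by move=> dp dq; apply: deg_leD => //; exact: deg_leN. Qed.

Lemma deg_le_sum D (I : Type) (r : seq I) (P : pred I) (f : I -> {mpoly R[m]}) :
  (forall i, P i -> deg_le D (f i)) -> deg_le D (\sum_(i <- r | P i) f i).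
Proof. by move=> df; elim/big_ind: _ => //; [exact: deg_le0 | exact: deg_leD]. Qed.

Lemma deg_leM D D' p q : deg_le D p -> deg_le D' q -> deg_le (D + D') (p * q).
Proof.
move=> dp dq; have [->|p0] := eqVneq p 0; first by rewrite mul0r; exact: deg_le0.
have [->|q0] := eqVneq q 0; first by rewrite mulr0; exact: deg_le0.
rewrite /deg_le msizeM//.
have := leq_add dp dq; rewrite addSn addnS.
by case: (msize p + msize q)%N.
Qed.

Lemma deg_leXn D p e : deg_le D p -> deg_le (e * D) (p ^+ e).
Proof.
move=> dp; elim: e => [|e IH]; first by rewrite expr0; exact: deg_le1.
by rewrite exprS mulSn; exact: deg_leM.
Qed.

Lemma deg_le_sqr D p : deg_le D p -> deg_le (2 * D) (p ^+ 2).
Proof. exact: deg_leXn. Qed.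

Lemma deg_le_mon D (a : 'X_{1..m}) : (mdeg a <= D)%N -> deg_le D 'X_[R, a].
Proof. by rewrite /deg_le msizeX ltnS. Qed.

Lemma deg_le_var D (i : 'I_m) : (0 < D)%N -> deg_le D ('X_i : {mpoly R[m]}).
Proof. by move=> D0; apply: deg_le_mon; rewrite mdeg1. Qed.

Lemma deg_le_simplex_cstr : deg_le 1 (simplex_cstr R m).
Proof.
apply: deg_leB; first exact: deg_le1.
by apply: deg_le_sum => i _; exact: deg_le_var.
Qed.

Lemma deg_le_ball_cstr : deg_le 2 (ball_cstr R m).
Proof.
apply: deg_leB; first exact: deg_le1.
by apply: deg_le_sum => i _; apply: (@deg_leXn 1 _ 2); exact: deg_le_var.
Qed.

Lemma mpoly_monom_sum D p : deg_le D p ->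
  p = \sum_(a : monom_le m D) p@_(bmnm a) *: 'X_[bmnm a].
Proof. exact: mpolywE. Qed.

Lemma poly_of_coefs_deg_le D (c : monom_le m D -> R) :
  deg_le D (\sum_(a : monom_le m D) c a *: 'X_[bmnm a]).
Proof.
apply: deg_le_sum => a _; apply/deg_leZ/deg_le_mon.
by rewrite -ltnS; exact: bmdeg.
Qed.

Lemma mcoeff_poly_of_coefs D (c : monom_le m D -> R) (b : monom_le m D) :
  (\sum_(a : monom_le m D) c a *: 'X_[bmnm a])@_(bmnm b) = c b.
Proof.
rewrite raddf_sum /= (bigD1 b)//= mcoeffZ mcoeffX eqxx mulr1 big1 ?addr0// => a ab.
rewrite mcoeffZ mcoeffX; case: eqP => [/val_inj ba|]; last by rewrite mulr0.
by rewrite ba eqxx in ab.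
Qed.

End Degree.

Lemma meval_sum (R : realType) (m : nat) (v : 'I_m -> R) (I : Type) (r : seq I)
    (P : pred I) (f : I -> {mpoly R[m]}) :
  (\sum_(i <- r | P i) f i).@[v] = \sum_(i <- r | P i) (f i).@[v].
Proof. by apply: (big_morph (meval v)) => [p q|]; rewrite ?mevalD ?meval0. Qed.

Section Pairing.
Variables (R : realType) (m D : nat).
Implicit Types (p q : {mpoly R[m]}) (z : tms R m D).

Lemma pairingD p q z : pairing (p + q) z = pairing p z + pairing q z.
Proof.
by rewrite /pairing -big_split; apply: eq_bigr => b _; rewrite mcoeffD mulrDl.
Qed.

Lemma pairing0 z : pairing 0 z = 0.
Proof. by rewrite /pairing big1 // => b _; rewrite mcoeff0 mul0r. Qed.

Lemma pairingZ c p z : pairing (c *: p) z = c * pairing p z.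
Proof.
by rewrite /pairing mulr_sumr; apply: eq_bigr => b _; rewrite mcoeffZ mulrA.
Qed.

Lemma pairingN p z : pairing (- p) z = - pairing p z.
Proof. by rewrite -scaleN1r pairingZ mulN1r. Qed.

Lemma pairingB p q z : pairing (p - q) z = pairing p z - pairing q z.
Proof. by rewrite pairingD pairingN. Qed.

Lemma pairing_sum (I : Type) (r : seq I) (P : pred I) (f : I -> {mpoly R[m]}) z :
  pairing (\sum_(i <- r | P i) f i) z = \sum_(i <- r | P i) pairing (f i) z.
Proof. by apply: (big_morph (fun p => pairing p z)) => [p q|]; rewrite ?pairingD ?pairing0. Qed.

Definition tms_comb (I : Type) (r : seq I) (c : I -> R) (z : I -> tms R m D) :
    tms R m D :=
  [ffun a => \sum_(i <- r) c i * z i a].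

Lemma pairing_comb (I : Type) (r : seq I) (c : I -> R) (z : I -> tms R m D) p :
  pairing p (tms_comb r c z) = \sum_(i <- r) c i * pairing p (z i).
Proof.
rewrite /pairing; under eq_bigr do rewrite ffunE mulr_sumr.
rewrite exchange_big; apply: eq_bigr => i _; rewrite mulr_sumr.
by apply: eq_bigr => a _; rewrite mulrCA.
Qed.

Lemma pairing_mon z (a : monom_le m D) : pairing 'X_[bmnm a] z = z a.
Proof.
rewrite /pairing (bigD1 a)//= mcoeffX eqxx mul1r big1 ?addr0// => b ba.
rewrite mcoeffX; case: eqP => [/val_inj ab|]; last by rewrite mul0r.
by rewrite ab eqxx in ba.
Qed.

(** Dirac masses, as truncated moment sequences. *)
Definition point_moments (u : 'rV[R]_m) : tms R m D :=
  [ffun a : monom_le m D => ('X_[bmnm a] : {mpoly R[m]}).@[u 0]].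

Lemma pairing_point p u : deg_le D p -> pairing p (point_moments u) = p.@[u 0].
Proof.
move=> dp; rewrite [p in RHS](mpoly_monom_sum dp) meval_sum.
by apply: eq_bigr => a _; rewrite mevalZ ffunE.
Qed.

End Pairing.

Lemma pairing_trunc (R : realType) (m D D' : nat) (p : {mpoly R[m]}) (z : tms R m D) :
  deg_le D' p -> pairing p (trunc D' z) = pairing p z.
Proof.
move=> dp; rewrite [p in LHS](mpoly_monom_sum dp) [p in RHS](mpoly_monom_sum dp).
rewrite !pairing_sum; apply: eq_bigr => a _; rewrite !pairingZ; congr (_ * _).
rewrite pairing_mon ffunE; case: insubP => [b _ /= <-|].
  by rewrite pairing_mon.
rewrite -leqNgt => Da; rewrite /= /pairing big1// => b _.
rewrite mcoeffX; case: eqP => [ab|]; last by rewrite mul0r.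
by have := bmdeg b; rewrite -ab ltnNge Da.
Qed.

Lemma trunc_point (R : realType) (m D D' : nat) (u : 'rV[R]_m) :
  (D' <= D)%N -> trunc D' (point_moments D u) = point_moments D' u.
Proof.
move=> DD'; apply/ffunP => a; rewrite -!pairing_mon.
have da : deg_le D' 'X_[R, bmnm a] by apply: deg_le_mon; rewrite -ltnS bmdeg.
by rewrite pairing_trunc// !pairing_point//; exact: deg_leW da.
Qed.

Lemma trunc_comb (R : realType) (m D D' : nat) (I : Type) (r : seq I)
    (c : I -> R) (z : I -> tms R m D) :
  trunc D' (tms_comb r c z) = tms_comb r c (fun i => trunc D' (z i)).
Proof.
apply/ffunP => a; rewrite -!pairing_mon.
have da : deg_le D' 'X_[R, bmnm a] by apply: deg_le_mon; rewrite -ltnS bmdeg.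
rewrite pairing_trunc// !pairing_comb; apply: eq_bigr => i _.
by rewrite pairing_trunc.
Qed.

Section MomentCone.
Variables (R : realType) (m : nat).
Implicit Types (p q a : {mpoly R[m]}).

Definition is_cstr q : Prop :=
  [\/ q = 1, exists i, q = 'X_i, q = simplex_cstr R m | q = ball_cstr R m].

Lemma deg_le_half_deg q : deg_le (2 * half_deg q) q.
Proof.
by rewrite /deg_le /half_deg; have := leq_uphalf_double (msize q).-1 (uphalf (msize q).-1); lia.
Qed.

Lemma half_deg1 : half_deg (1 : {mpoly R[m]}) = 0%N.
Proof. by rewrite /half_deg msize1. Qed.

Lemma half_deg_cstr q : is_cstr q -> (half_deg q <= 1)%N.
Proof.
have hd : deg_le 2 q -> (half_deg q <= 1)%N.
  by rewrite /deg_le /half_deg => dq; rewrite leq_uphalf_double; lia.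
move=> [->|[i ->]|qE|qE]; first by rewrite half_deg1.
- by rewrite /half_deg msizeX mdeg1.
- by apply: hd; rewrite qE; apply: deg_leW (deg_le_simplex_cstr R m).
- by apply: hd; rewrite qE; apply: deg_le_ball_cstr.
Qed.

Lemma psd_locP (k : nat) q (z : tms R m (2 * k)) :
  psd (loc_mx q z) <->
  forall a, deg_le (k - half_deg q) a -> 0 <= pairing (q * a ^+ 2) z.
Proof.
split=> [[_ pos] a da|pos]; first by rewrite loc_mxP.
split=> [|u]; first exact: loc_mx_sym.
pose c (a : monom_le m (k - half_deg q)) := u (enum_rank a) 0.
have := pos _ (poly_of_coefs_deg_le c).
rewrite loc_mxP; last exact: poly_of_coefs_deg_le.
set v := coef_vec _ _; suff -> : v = u by [].
by apply/matrixP => i j; rewrite mxE mcoeff_poly_of_coefs /c enum_valK (ord1 j).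
Qed.

Lemma moment_coneP (k : nat) (z : tms R m (2 * k)) :
  moment_cone z <->
  forall q a, is_cstr q -> deg_le (k - half_deg q) a -> 0 <= pairing (q * a ^+ 2) z.
Proof.
split=> [[p1 pX pS pB] q a [->|[i ->]|->|->]|pos].
- by move/psd_locP: p1; apply.
- by have /psd_locP := pX i; apply.
- by move/psd_locP: pS; apply.
- by move/psd_locP: pB; apply.
split=> [|i||]; apply/psd_locP => a; apply: pos.
- exact: Or41.
- by apply: Or42; exists i.
- exact: Or43.
- exact: Or44.
Qed.

Lemma moment_cstr_ge0 (k : nat) (z : tms R m (2 * k)) q a :
  moment_cone z -> is_cstr q -> deg_le k.-1 a -> 0 <= pairing (q * a ^+ 2) z.
Proof.
move=> /moment_coneP pos cq da; apply: pos => //.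
by apply: deg_leW da; have := half_deg_cstr cq; lia.
Qed.

Lemma moment_sqr_ge0 (k : nat) (z : tms R m (2 * k)) a :
  moment_cone z -> deg_le k a -> 0 <= pairing (a ^+ 2) z.
Proof.
move=> /moment_coneP pos da; rewrite -[a ^+ 2]mul1r; apply: pos; first exact: Or41.
by rewrite half_deg1 subn0.
Qed.

Lemma deg_le_cstr_sqr (k : nat) q a : (0 < k)%N -> is_cstr q ->
  deg_le (k - half_deg q) a -> deg_le (2 * k) (q * a ^+ 2).
Proof.
move=> k0 cq da.
apply: (@deg_leW _ _ (2 * half_deg q + 2 * (k - half_deg q))).
  by have := half_deg_cstr cq; lia.
by apply: deg_leM; [exact: deg_le_half_deg | exact: deg_le_sqr].
Qed.

Lemma simplex_cstr_eval (u : 'rV[R]_m) : (simplex_cstr R m).@[u 0] = 1 - \sum_i u 0 i.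
Proof.
rewrite /simplex_cstr mevalB meval1 meval_sum.
by under eq_bigr do rewrite mevalXU.
Qed.

Lemma cstr_eval_ge0 q (u : 'rV[R]_m) : is_cstr q -> in_simplex u -> 0 <= q.@[u 0].
Proof.
move=> cq [u0 u1]; case: cq => [->|[i ->]|->|->].
- by rewrite meval1.
- by rewrite mevalXU.
- by rewrite simplex_cstr_eval.
rewrite /ball_cstr mevalB meval1 meval_sum (le_trans u1)// lerB//.
apply: ler_sum => i _; rewrite rmorphXn /= mevalXU expr2 ler_piMr//.
move: u1; rewrite subr_ge0; apply: le_trans.
by rewrite (bigD1 i)//= lerDl sumr_ge0.
Qed.

Lemma point_moment_cone (k : nat) (u : 'rV[R]_m) : (0 < k)%N -> in_simplex u ->
  moment_cone (point_moments (2 * k) u).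
Proof.
move=> k0 su; apply/moment_coneP => q a cq da.
rewrite pairing_point; last exact: deg_le_cstr_sqr.
by rewrite mevalM rmorphXn /= mulr_ge0 ?sqr_ge0 ?cstr_eval_ge0.
Qed.

Lemma moment_cone_comb (k : nat) (I : Type) (r : seq I) (c : I -> R)
    (z : I -> tms R m (2 * k)) :
  (forall i, 0 <= c i) -> (forall i, moment_cone (z i)) ->
  moment_cone (tms_comb r c z).
Proof.
move=> c0 cz; apply/moment_coneP => q a cq da.
rewrite pairing_comb sumr_ge0// => i _; rewrite mulr_ge0//.
by have /moment_coneP := cz i; apply.
Qed.

End MomentCone.

(** * Boundedness of the moment cone *)

Section MomentBound.
Variables (R : realType) (m k : nat) (z : tms R m (2 * k)).
Hypothesis cz : moment_cone z.

Lemma mnm_split (c : 'X_{1..m}) (s : nat) : (s <= mdeg c)%N ->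
  exists a b : 'X_{1..m}, [/\ c = (a + b)%MM, mdeg a = s & mdeg b = (mdeg c - s)%N].
Proof.
elim: s => [_|s IH sc].
  by exists 0%MM, c; rewrite add0m mdeg0 subn0.
have [a [b [cab da db]]] := IH (ltnW sc).
have /existsP[i bi] : [exists i, b i != 0%N].
  apply: contraTT sc; rewrite negb_exists => /forallP b0.
  have bE : b = 0%MM by apply/mnmP => i; rewrite mnm0E; apply/eqP; have := b0 i; rewrite negbK.
  by move: db; rewrite bE mdeg0 -leqNgt => /esym/eqP.
exists (a + U_(i))%MM, (b - U_(i))%MM.
have bE : (b - U_(i) + U_(i) = b)%MM by rewrite submK// lep1mP.
have : mdeg b = (mdeg (b - U_(i))%MM).+1 by rewrite -[in LHS]bE mdegD mdeg1 addn1.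
rewrite mdegD mdeg1 da addn1 db => e; split=> //; last by move: e sc; lia.
by rewrite -addmA (addmC U_(i)%MM) bE.
Qed.

(** Induction on the degree: with $a = x^b$ the ball constraint reads
    $\sum_j L((x_j x^b)^2) \le L((x^b)^2)$, a sum of nonnegative terms. *)
Lemma moment_even_le (a : 'X_{1..m}) : (mdeg a <= k)%N ->
  pairing ('X_[a] ^+ 2) z <= pairing 1 z.
Proof.
have [n] := ubnP (mdeg a); elim: n a => // n IH a /[1!ltnS] an ak.
have [a0|a0] := posnP (mdeg a).
  by move/eqP: a0; rewrite mdeg_eq0 => /eqP ->; rewrite mpolyX0 expr1n.
have [b [u [aE db du]]] := @mnm_split a (mdeg a).-1 (leq_pred _).
have /mdeg1P[i /eqP uE] : mdeg u == 1%N by rewrite du; move: a0; clear; lia.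
have bk : (mdeg b < k)%N by rewrite db prednK.
apply: le_trans (IH b _ (ltnW bk)); last by rewrite db prednK.
have dXb : deg_le k.-1 'X_[R, b] by apply: deg_le_mon; rewrite -ltnS prednK ?(leq_trans _ bk).
have := moment_cstr_ge0 cz (Or44 _ _ _ erefl) dXb.
rewrite /ball_cstr mulrBl mul1r pairingB subr_ge0; apply: le_trans.
rewrite mulr_suml pairing_sum (bigD1 i)//= aE uE mpolyXD mulrC exprMn lerDl.
apply: sumr_ge0 => j _; rewrite -exprMn; apply: moment_sqr_ge0 cz _.
rewrite -[k](prednK (leq_ltn_trans (leq0n _) bk)) -add1n.
by apply: deg_leM dXb; exact: deg_le_var.
Qed.

(** The monomial is a product $x^b x^c$ with $b$ and $c$ of degree at most [k],
    and $\pm 2 L(x^b x^c) \le L(x^{2b}) + L(x^{2c})$. *)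
Lemma pairing_moment_le (a : 'X_{1..m}) : (mdeg a <= 2 * k)%N ->
  `|pairing 'X_[a] z| <= pairing 1 z.
Proof.
move=> ak; have [b [c [aE db dc]]] := @mnm_split a (minn k (mdeg a)) (geq_minr _ _).
have {}dc : (mdeg c <= k)%N by rewrite dc; lia.
have {}db : (mdeg b <= k)%N by rewrite db geq_minl.
rewrite {}aE.
have hb := moment_even_le db; have hc := moment_even_le dc.
have sq (s : R) : s ^+ 2 = 1 ->
    0 <= pairing ('X_[b] ^+ 2) z + pairing ('X_[c] ^+ 2) z
         + (2 * s) * pairing 'X_[b + c] z.
  move=> s1; have : deg_le k ('X_[R, b] + s *: 'X_[c]).
    by apply: deg_leD; [|apply: deg_leZ]; exact: deg_le_mon.
  move=> /(moment_sqr_ge0 cz); rewrite sqrrD exprZn s1 scale1r -scalerAr -mpolyXD.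
  by rewrite mulr2n !pairingD !pairingZ; congr (_ <= _); ring.
have := sq 1 (expr1n _ _); have := sq (-1) (etrans (sqrrN _) (expr1n _ _)).
by rewrite ler_norml; lra.
Qed.

Lemma moment_le (a : monom_le m (2 * k)) : `|z a| <= pairing 1 z.
Proof. by rewrite -pairing_mon pairing_moment_le// -ltnS bmdeg. Qed.

End MomentBound.

(** * Solvability of the relaxations and strong duality *)

Section Relaxation.
Variables (R : realType) (m d k : nat).
Hypothesis k0 : (0 < k)%N.
Implicit Types (z : tms R m (2 * k)) (w : tms R m d) (F p q : {mpoly R[m]}).

(** The polynomials on which a functional has to be nonnegative for its moment
    sequence to lie in the moment cone: the cone is cut out by linear
    inequalities, infinitely many of them. *)
Definition cone_poly p : Prop :=
  exists q a, [/\ is_cstr q, deg_le (k - half_deg q) a & p = q * a ^+ 2].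

Lemma moment_cone_polys z :
  moment_cone z <-> forall p, cone_poly p -> 0 <= pairing p z.
Proof.
split=> [/moment_coneP pos p [q [a [cq da ->]]]|pos]; first exact: pos.
by apply/moment_coneP => q a cq da; apply: pos; exists q, a.
Qed.

Lemma trunc_eqP (D : nat) (z : tms R m D) w :
  trunc d z = w <-> forall a : monom_le m d, pairing 'X_[bmnm a] z = w a.
Proof.
have da (a : monom_le m d) : deg_le d 'X_[R, bmnm a].
  by apply: deg_le_mon; rewrite -ltnS bmdeg.
split=> [<- a|zw]; first by rewrite -(pairing_trunc _ (da a)) pairing_mon.
by apply/ffunP => a; rewrite -zw -(pairing_trunc _ (da a)) pairing_mon.
Qed.

Lemma pairing1_trunc (D : nat) (z : tms R m D) w :
  trunc d z = w -> pairing 1 z = pairing 1 w.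
Proof. by move=> <-; rewrite pairing_trunc//; exact: deg_le1. Qed.

(** The feasible set is closed, and bounded because the prescribed moments include
    the mass. *)
Lemma relax_minimizer_exists F w :
  (exists z, relax_feasible w z) -> exists z, relax_minimizer F w z.
Proof.
move=> feas.
pose T := ({p | cone_poly p} + monom_le m d * bool)%type.
pose p_ (t : T) : {mpoly R[m]} := match t with
  | inl p => sval p | inr (a, b) => (-1) ^+ b *: 'X_[bmnm a] end.
pose c (t : T) : R := match t with inl _ => 0 | inr (a, b) => (-1) ^+ b * w a end.
have CP z : (forall t, c t <= pairing (p_ t) z) <-> relax_feasible w z.
  split=> [Cz|[/trunc_eqP zw /moment_cone_polys cz] [[p cp]|[a b]]] /=; last first.
  - by rewrite pairingZ zw.
  - exact: cz.
  split; last first.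
    by apply/moment_cone_polys => p cp; exact: (Cz (inl (exist _ p cp))).
  apply/trunc_eqP => a; apply/eqP; rewrite eq_le.
  have := Cz (inr (a, true)); have := Cz (inr (a, false)).
  by rewrite /= !pairingZ expr0 expr1 !mul1r !mulN1r lerN2 => -> ->.
have bound z : (forall t, c t <= pairing (p_ t) z) ->
    forall a, `|z a| <= pairing 1 w.
  by move=> /CP[zw cz] a; rewrite -(pairing1_trunc zw); exact: moment_le.
have ne : exists z, forall t, c t <= pairing (p_ t) z.
  by have [z /CP] := feas; exists z.
have [z [Cz zmin]] := @Compactness.polyhedron_min R _ T c
  (fun t i => (p_ t)@_(bmnm i)) _ void (fun _ _ => 0) (fun _ => 0)
  (fun i => F@_(bmnm i)) bound ne.
exists z; split; first exact/CP.
have v0 (f : void -> R) : \sum_j f j = 0 by rewrite big1// => -[].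
by move=> z' /CP /zmin; rewrite !v0 !add0r.
Qed.

(** First-order optimality in a least-squares problem: a negative inner product of
    the residual with an admissible direction lets a small step decrease the sum of
    squares. *)
Lemma residual_ge0 (J : finType) (r t : J -> R) (e0 : R) : 0 < e0 ->
  (forall e, 0 < e <= e0 -> \sum_j r j ^+ 2 <= \sum_j (r j + e * t j) ^+ 2) ->
  0 <= \sum_j r j * t j.
Proof.
move=> e00 opt; set s := \sum_j _; rewrite leNgt; apply/negP => s0.
pose q := \sum_j t j ^+ 2; have q0 : 0 <= q by apply: sumr_ge0 => j _; exact: sqr_ge0.
have {opt} opt e : 0 < e <= e0 -> 0 <= 2 * e * s + e ^+ 2 * q.
  move=> /opt; rewrite -subr_ge0; congr (_ <= _).
  rewrite /s /q !mulr_sumr -sumrB -big_split /=.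
  by apply: eq_bigr => j _; ring.
pose e := Num.min e0 (- s / (1 + q)).
have e_gt0 : 0 < e.
  by rewrite lt_min e00 divr_gt0 ?oppr_gt0// ltr_pwDl.
have /opt : 0 < e <= e0 by rewrite e_gt0 ge_min lexx.
have eq_s : e * q <= - s.
  apply: (@le_trans _ _ (e * (1 + q))); first by rewrite ler_pM2l// lerDr.
  by rewrite -ler_pdivlMr ?ltr_pwDl// ge_min lexx orbT.
rewrite expr2; nra.
Qed.

Variables (D : nat) (F rho : {mpoly R[m]}) (w : tms R m d).
Variables (r : nat) (lam : 'I_r -> R) (u : 'I_r -> 'rV[R]_m).
Hypotheses (dk : (d <= 2 * k)%N) (Dk : (D <= 2 * k)%N) (dD : (d <= D)%N).
Hypothesis dF : deg_le D F.
Hypothesis lam0 : forall i, 0 <= lam i.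
Hypothesis su : forall i, in_simplex (u i).
Hypothesis wE : w = tms_comb (index_enum _) lam (fun i => point_moments d (u i)).
Hypothesis max_rho : dual_maximizer D F w rho.

Lemma atoms_relax_feasible :
  relax_feasible w (tms_comb (index_enum _) lam (fun i => point_moments (2 * k) (u i))).
Proof.
split; last by apply: moment_cone_comb => // i; exact: point_moment_cone.
by rewrite trunc_comb wE; apply/ffunP => a; rewrite !ffunE; apply: eq_bigr => i _;
   rewrite trunc_point.
Qed.

(** Strong duality, with attainment in the relaxation.  Minimize the distance from
    $(w, v)$ to the image of the moment cone under $z \mapsto (z|_d, L_z(F))$.  If
    it is positive, the residual $(\rho', \tau)$ separates $(w, v)$ from the image:
    $\tau F + \rho' \ge 0$ on the simplex and $\tau v + L_w(\rho') < 0$.  When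
    $\tau > 0$ the polynomial $-\rho'/\tau$ beats the maximizer; when $\tau \le 0$ the
    integral of $\tau F + \rho'$ against the given measure is at most
    $\tau v + L_w(\rho')$. *)
Lemma moment_no_gap : exists z, relax_feasible w z /\ pairing F z = pairing rho w.
Proof.
set v := pairing rho w.
have [[[dFrho rho_le] drho] rho_max] := max_rho.
pose J := option (monom_le m d).
pose t_ (j : J) : {mpoly R[m]} := if j is Some a then 'X_[bmnm a] else F.
pose b (j : J) : R := if j is Some a then w a else v.
pose N2 := \sum_j b j ^+ 2.
have N20 : 0 <= N2 by apply: sumr_ge0 => j _; exact: sqr_ge0.
(* The mass is capped strictly above what a nearest point can have, so that the
   cap is inactive at the minimizer. *)
pose B := `|pairing 1 w| + N2 + 2.
have w_le := ler_norm (pairing 1 w); have w_ge := normr_ge0 (pairing 1 w).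
pose T := ({p | cone_poly p} + unit)%type.
pose p_ (t : T) : {mpoly R[m]} := if t is inl p then sval p else -1.
pose c (t : T) : R := if t is inl _ then 0 else - B.
have CP z : (forall t, c t <= pairing (p_ t) z) <->
    moment_cone z /\ pairing 1 z <= B.
  split=> [Cz|[/moment_cone_polys cz zB] [[p cp]|[]]] /=.
  - split; first by apply/moment_cone_polys => p cp; exact: (Cz (inl (exist _ p cp))).
    by have := Cz (inr tt); rewrite /= pairingN lerN2.
  - exact: cz.
  - by rewrite pairingN lerN2.
have bound z : (forall t, c t <= pairing (p_ t) z) -> forall a, `|z a| <= B.
  by move=> /CP[cz zB] a; apply: le_trans zB; exact: moment_le.
pose zz : tms R m (2 * k) := tms_comb [::] (fun _ : unit => 0) (fun=> [ffun=> 0]).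
have pz0 p : pairing p zz = 0 by rewrite pairing_comb big_nil.
have zz_cone : moment_cone zz by apply/moment_cone_polys => p _; rewrite pz0.
have ne : exists z, forall t, c t <= pairing (p_ t) z.
  exists zz; apply/CP; split=> //.
  by rewrite pz0 /B; lra.
have [z [/CP[cz zB] zmin]] := @Compactness.polyhedron_min R _ T c
  (fun t i => (p_ t)@_(bmnm i)) _ J (fun j i => (t_ j)@_(bmnm i)) b
  (fun i => 0) bound ne.
pose res (j : J) := pairing (t_ j) z - b j.
have {}zmin z' : moment_cone z' -> pairing 1 z' <= B ->
    \sum_j res j ^+ 2 <= \sum_j (pairing (t_ j) z' - b j) ^+ 2.
  move=> cz' z'B; have /zmin : forall t, c t <= pairing (p_ t) z' by apply/CP.
  by rewrite [X in _ + X <= _]big1 ?[X in _ <= _ + X]big1 ?addr0//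
     => i _; rewrite mul0r.
pose s := \sum_j res j ^+ 2.
have s_le : s <= N2.
  apply: le_trans (zmin zz zz_cone _) _; first by rewrite pz0 /B; lra.
  by apply: ler_sum => j _; rewrite pz0 sub0r sqrrN.
have z_ge0 (z' : tms R m (2 * k)) : moment_cone z' -> 0 <= pairing 1 z'.
  move=> cz'; have := @moment_sqr_ge0 _ _ _ _ 1 cz'.
  by rewrite expr1n; apply; exact: deg_le1.
have z_lt : pairing 1 z + 1 <= B.
  pose o : monom_le m d := @bm0 m d.
  have : (pairing 1 z - pairing 1 w) ^+ 2 <= s.
    rewrite /s (bigD1 (Some o))//= /res /= -pairing_mon mpolyX0 lerDl.
    by apply: sumr_ge0 => j _; exact: sqr_ge0.
  by rewrite /B; nra.
have opt_ge0 z' : moment_cone z' -> 0 <= \sum_j res j * pairing (t_ j) z'.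
  move=> cz'; apply: (@residual_ge0 _ _ _ (1 + pairing 1 z')^-1).
    by rewrite invr_gt0 ltr_pwDl// z_ge0.
  move=> e /andP[e0 e1].
  pose zc := tms_comb [:: true; false] (fun x => if x then 1 else e)
                      (fun x => if x then z else z').
  have zcE p : pairing p zc = pairing p z + e * pairing p z'.
    by rewrite pairing_comb !big_cons big_nil addr0 mul1r.
  apply: le_trans (zmin zc _ _) _.
  - by apply: moment_cone_comb => -[]; rewrite ?ler01 ?ltW.
  - rewrite zcE; apply: le_trans z_lt; rewrite lerD2l.
    move: e1; rewrite -[_^-1]mul1r ler_pdivlMr ?ltr_pwDl ?z_ge0//.
    by have := z_ge0 _ cz'; nra.
  - by apply: ler_sum => j _; rewrite zcE /res addrAC.
(* The cone allows scaling down, so the residual is orthogonal to the nearest point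
   itself. *)
have opt_z : \sum_j res j * pairing (t_ j) z <= 0.
  rewrite -oppr_ge0 -sumrN; under eq_bigr do rewrite -mulrN.
  apply: (@residual_ge0 _ _ _ 1) => // e /andP[e0 e1].
  pose zc := tms_comb [:: tt] (fun x => 1 - e) (fun x => z).
  have zcE p : pairing p zc = (1 - e) * pairing p z.
    by rewrite pairing_comb !big_cons big_nil addr0.
  apply: le_trans (zmin zc _ _) _.
  - by apply: moment_cone_comb => // _; rewrite subr_ge0.
  - by rewrite zcE; apply: le_trans zB; have := z_ge0 _ cz; nra.
  - by apply: ler_sum => j _; rewrite zcE /res mulrBl mul1r mulrN (addrAC (pairing _ z)).
have [s0|s_neq0] := eqVneq s 0.
  have res0 j : pairing (t_ j) z = b j.
    apply/eqP; rewrite -subr_eq0 -sqrf_eq0; apply/eqP.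
    have /psumr_eq0P := s0; apply=> // i _; exact: sqr_ge0.
  exists z; split; last exact: (res0 None).
  by split=> //; apply/trunc_eqP => a; exact: (res0 (Some a)).
exfalso.
have s_gt0 : 0 < s by rewrite lt0r s_neq0 sumr_ge0// => j _; exact: sqr_ge0.
have b_lt0 : \sum_j res j * b j < 0.
  have -> : \sum_j res j * b j = \sum_j res j * pairing (t_ j) z - s.
    by rewrite -sumrB; apply: eq_bigr => j _; rewrite /res; ring.
  by rewrite subr_lt0 (le_lt_trans opt_z).
pose rho' : {mpoly R[m]} := \sum_(a : monom_le m d) res (Some a) *: 'X_[bmnm a].
pose tau := res None.
have drho' : deg_le d rho' := poly_of_coefs_deg_le _.
have sumJ (f : J -> R) : \sum_j f j = f None + \sum_a f (Some a).
  rewrite (bigD1 None)//=; congr (_ + _).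
  rewrite (reindex_omap Some id) /=; last by case.
  by apply: eq_bigl => a; rewrite eqxx.
have pair_rho' D' (z' : tms R m D') :
    pairing rho' z' = \sum_a res (Some a) * pairing 'X_[bmnm a] z'.
  by rewrite pairing_sum; apply: eq_bigr => a _; rewrite pairingZ.
have resE z' : \sum_j res j * pairing (t_ j) z' = tau * pairing F z' + pairing rho' z'.
  by rewrite sumJ pair_rho'.
have bE : \sum_j res j * b j = tau * v + pairing rho' w.
  rewrite sumJ pair_rho'; congr (_ + _).
  by apply: eq_bigr => a _; rewrite pairing_mon.
rewrite bE in b_lt0.
have ev_ge0 x : in_simplex x -> 0 <= tau * F.@[x 0] + rho'.@[x 0].
  move=> sx; have := opt_ge0 _ (point_moment_cone k0 sx).
  by rewrite resE !pairing_point//; [exact: deg_leW drho'|exact: deg_leW dF].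
have pair_w p : deg_le d p -> pairing p w = \sum_i lam i * p.@[u i 0].
  by move=> dp; rewrite wE pairing_comb; apply: eq_bigr => i _; rewrite pairing_point.
have rho_w := pair_w _ drho; have rho'_w := pair_w _ drho'.
have [tau0|tau0|tau0] := ltrgt0P tau.
- have feas : dual_feasible d D F (- tau^-1 *: rho').
    split; last exact: deg_leZ.
    split=> [|x sx].
      by apply: deg_leB => //; apply: deg_leZ; exact: deg_leW drho'.
    rewrite scaleNr opprK mevalD mevalZ.
    by rewrite -(pmulr_rge0 _ tau0) mulrDr mulVKf ?gt_eqF//; exact: ev_ge0.
  have := rho_max _ feas; rewrite pairingZ -/v => h.
  have : tau * (- tau^-1 * pairing rho' w) <= tau * v by rewrite ler_pM2l.
  by rewrite mulrA mulrN mulfV ?gt_eqF// mulN1r; lra.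
- have : 0 <= \sum_i lam i * (tau * F.@[u i 0] + rho'.@[u i 0]).
    by apply: sumr_ge0 => i _; rewrite mulr_ge0 ?ev_ge0.
  have : tau * (\sum_i lam i * F.@[u i 0]) <= tau * v.
    rewrite ler_nM2l// /v rho_w; apply: ler_sum => i _; apply: ler_wpM2l => //.
    by have := rho_le _ (su i); rewrite mevalB subr_ge0.
  have -> : \sum_i lam i * (tau * F.@[u i 0] + rho'.@[u i 0])
      = tau * (\sum_i lam i * F.@[u i 0]) + pairing rho' w.
    rewrite rho'_w mulr_sumr -big_split; apply: eq_bigr => i _ /=; ring.
  lra.
- move: b_lt0; rewrite tau0 mul0r add0r rho'_w ltNge sumr_ge0// => i _.
  by rewrite mulr_ge0//; have := ev_ge0 _ (su i); rewrite tau0 mul0r add0r.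
Qed.

End Relaxation.

(** * The quadratic module of the facets, and its null polynomials *)

Section LinearConstraints.
Variables (R : realType) (m : nat).
Implicit Types (p q G : {mpoly R[m]}).

(** Barycentric coordinates: [facet None] is $1 - e^T x$, so that the facets sum
    to one. *)
Definition facet (o : option 'I_m) : {mpoly R[m]} :=
  if o is Some i then 'X_i else simplex_cstr R m.

(** The multipliers that remain once the ball constraint is eliminated, [None]
    standing for the sums of squares without multiplier. *)
Definition facet1 (c : option (option 'I_m)) : {mpoly R[m]} :=
  if c is Some o then facet o else 1.

Lemma big_option (V : nmodType) (I : finType) (f : option I -> V) :
  \sum_o f o = f None + \sum_i f (Some i).
Proof.
rewrite (bigD1 None)//=; congr (_ + _).
rewrite (reindex_omap Some id) /=; last by case.
by apply: eq_bigl => a; rewrite eqxx.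
Qed.

Lemma sum_facet : \sum_o facet o = 1.
Proof. by rewrite big_option /= /simplex_cstr subrK. Qed.

Lemma facet1_cstr c : is_cstr (facet1 c).
Proof.
by case: c => [[i|]|]; [apply: Or42; exists i | exact: Or43 | exact: Or41].
Qed.

Lemma sosD p q : sos p -> sos q -> sos (p + q).
Proof. by move=> [s ->] [t ->]; exists (s ++ t); rewrite big_cat. Qed.

Lemma sos_sqrM p q : sos q -> sos (p ^+ 2 * q).
Proof.
move=> [s ->]; exists [seq p * x | x <- s]; rewrite big_map mulr_sumr.
by apply: eq_bigr => x _; rewrite exprMn.
Qed.

Lemma sos0 : sos (0 : {mpoly R[m]}).
Proof. by exists [::]; rewrite big_nil. Qed.

Lemma sos_sum (I : Type) (r : seq I) (P : pred I) (f : I -> {mpoly R[m]}) :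
  (forall i, P i -> sos (f i)) -> sos (\sum_(i <- r | P i) f i).
Proof. by move=> sf; elim/big_ind: _ => //; [exact: sos0 | exact: sosD]. Qed.

(** As the facets sum to one, $x_i - x_i^2$ is $x_i(1-x_i)^2 + (1-x_i)x_i^2$ with
    $1 - x_i$ the sum of the other facets. *)
Lemma ball_cstrE : ball_cstr R m = simplex_cstr R m +
  \sum_i ('X_i * (1 - 'X_i) ^+ 2
          + (simplex_cstr R m + \sum_(j | j != i) 'X_j) * 'X_i ^+ 2).
Proof.
have -> : \sum_(i < m) ('X_i * (1 - 'X_i) ^+ 2
    + (simplex_cstr R m + \sum_(j | j != i) 'X_j) * 'X_i ^+ 2)
    = \sum_(i < m) ('X_i - 'X_i ^+ 2 : {mpoly R[m]}).
  apply: eq_bigr => i _.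
  have -> : simplex_cstr R m + \sum_(j | j != i) 'X_j = 1 - 'X_i.
    by rewrite /simplex_cstr (bigD1 i)//=; ring.
  ring.
by rewrite sumrB /simplex_cstr /ball_cstr; ring.
Qed.

(** The multiplier of the ball constraint is distributed over the others along
    [ball_cstrE], whose coefficients are squares. *)
Lemma quad_module_facets G : quad_module G ->
  exists s : option (option 'I_m) -> seq {mpoly R[m]},
    G = \sum_c facet1 c * \sum_(p <- s c) p ^+ 2.
Proof.
move=> [s0 [s [s1 [s2 [[Ss0 Ss Ss1 Ss2] GE]]]]].
pose S (c : option (option 'I_m)) : {mpoly R[m]} := match c with
  | None => s0
  | Some None => s1 + (s2 + \sum_i 'X_i ^+ 2 * s2)
  | Some (Some i) => s i + ((1 - 'X_i) ^+ 2 * s2 + \sum_(j | j != i) 'X_j ^+ 2 * s2)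
  end.
have SS c : sos (S c).
  case: c => [[i|]|] //=.
    apply: sosD => //; apply: sosD; first exact: sos_sqrM.
    by apply: sos_sum => j _; exact: sos_sqrM.
  apply: sosD => //; apply: sosD => //.
  by apply: sos_sum => i _; exact: sos_sqrM.
have {SS} [t tE] : exists t : option (option 'I_m) -> seq {mpoly R[m]},
    forall c, S c = \sum_(p <- t c) p ^+ 2.
  have [t tE] := @fin_all_exists _ _ (fun c x => S c = \sum_(p <- x) p ^+ 2) SS.
  by exists t.
exists t; under eq_bigr do rewrite -tE.
rewrite !big_option /= mul1r GE ball_cstrE.
set q0 := simplex_cstr R m.
pose U : {mpoly R[m]} := \sum_(i < m) 'X_i * (1 - 'X_i) ^+ 2.
pose W : {mpoly R[m]} := \sum_(i < m) 'X_i ^+ 2.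
pose V : {mpoly R[m]} := \sum_(i < m) 'X_i * \sum_(j | j != i) 'X_j ^+ 2.
have -> : \sum_(i < m) ('X_i * (1 - 'X_i) ^+ 2
    + (q0 + \sum_(j | j != i) 'X_j) * 'X_i ^+ 2) = U + (q0 * W + V).
  rewrite big_split; congr (_ + _); rewrite mulr_sumr -[X in _ + X]/V.
  under eq_bigr do rewrite mulrDl; rewrite big_split; congr (_ + _).
  rewrite /V; under eq_bigr do rewrite mulr_suml.
  under [RHS]eq_bigr do rewrite mulr_sumr.
  by rewrite (exchange_big_dep xpredT)//=; apply: eq_bigr => i _;
     apply: eq_bigl => j; rewrite eq_sym.
have -> : \sum_(i < m) 'X_i ^+ 2 * s2 = W * s2 by rewrite mulr_suml.
have -> : \sum_i 'X_i * (s i + ((1 - 'X_i) ^+ 2 * s2 + \sum_(j | j != i) 'X_j ^+ 2 * s2))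
    = \sum_i 'X_i * s i + (U + V) * s2.
  rewrite /U /V -big_split mulr_suml -big_split; apply: eq_bigr => i _ /=.
  by rewrite -mulr_suml; ring.
by ring.
Qed.

End LinearConstraints.

Section NullSpace.
Variables (R : realType) (m k : nat) (z : tms R m (2 * k)).
Hypothesis cz : moment_cone z.
Implicit Types (p q h : {mpoly R[m]}).

(** Cauchy-Schwarz for the form $(f, g) \mapsto L(q f g)$. *)
Lemma cstr_null q p h : is_cstr q -> deg_le k.-1 p -> deg_le k.-1 h ->
  pairing (q * p ^+ 2) z = 0 -> pairing (q * p * h) z = 0.
Proof.
move=> cq dp dh p0.
have pos t : 0 <= 2 * t * pairing (q * p * h) z + t ^+ 2 * pairing (q * h ^+ 2) z.
  have := moment_cstr_ge0 cz cq (deg_leD dp (deg_leZ t dh)).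
  have -> : q * (p + t *: h) ^+ 2 =
      q * p ^+ 2 + (2 * t) *: (q * p * h) + t ^+ 2 *: (q * h ^+ 2).
    by rewrite (expr2 t) -!mul_mpolyC !mpolyCM mpolyC_nat; ring.
  by rewrite !pairingD !pairingZ p0 add0r.
set a := pairing (q * p * h) z in pos *.
set b := pairing _ z in pos.
have b0 : 0 <= b by exact: moment_cstr_ge0.
apply/eqP; rewrite -sqrf_eq0 eq_le sqr_ge0 andbT.
have := pos (- a / (1 + b)).
have b1 : 0 < 1 + b by lra.
move=> h1; have : 0 <= (1 + b) ^+ 2 * (2 * (- a / (1 + b)) * a + (- a / (1 + b)) ^+ 2 * b).
  by apply: mulr_ge0 => //; apply: sqr_ge0.
have -> : (1 + b) ^+ 2 * (2 * (- a / (1 + b)) * a + (- a / (1 + b)) ^+ 2 * b)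
  = - a ^+ 2 * (2 + b).
  by field; rewrite gt_eqF.
have := sqr_ge0 a; nra.
Qed.

End NullSpace.

Definition mpoly_ideal (R : realType) (m : nat) (J : {mpoly R[m]} -> Prop) : Prop :=
  [/\ J 0, forall f g, J f -> J g -> J (f + g) & forall f g, J f -> J (f * g)].

(** Polynomials annihilated by all the moment functionals $z \in Z_k$ of high
    order $k$, in the sense that $L_z(fh) = 0$ as soon as the degree of $h$ is
    at most $k$ minus a constant. *)
Definition eventually_null (R : realType) (m : nat)
    (Z : forall k, tms R m (2 * k) -> Prop) (f : {mpoly R[m]}) : Prop :=
  exists B : nat, forall k (z : tms R m (2 * k)) (h : {mpoly R[m]}),
    Z k z -> (msize h + B <= k)%N -> pairing (f * h) z = 0.

Lemma eventually_null_ideal (R : realType) (m : nat)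
    (Z : forall k, tms R m (2 * k) -> Prop) : mpoly_ideal (eventually_null Z).
Proof.
split=> [|f g [B1 n1] [B2 n2]|f g [B n]].
- by exists 0%N => k z h _ _; rewrite mul0r pairing0.
- exists (maxn B1 B2) => k z h Zz hk; rewrite mulrDl pairingD n1 ?n2 ?addr0//.
    by apply: leq_trans hk; rewrite leq_add2l leq_maxr.
  by apply: leq_trans hk; rewrite leq_add2l leq_maxl.
exists (msize g + B)%N => k z h Zz hk; rewrite -mulrA; apply: n => //.
apply: leq_trans hk; rewrite addnA leq_add2r addnC.
have [->|g0] := eqVneq g 0; first by rewrite mul0r msize0.
have [->|h0] := eqVneq h 0; first by rewrite mulr0 msize0.
by rewrite msizeM// leq_pred.
Qed.

(** A functional that is nonnegative on the quadratic module and kills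
    $G = \sum_c q_c \sum_p p^2$ kills each term, and then each multiple of
    $q_c p$. *)
Lemma facets_eventually_null (R : realType) (m : nat) (G : {mpoly R[m]})
    (s : option (option 'I_m) -> seq {mpoly R[m]})
    (Z : forall k, tms R m (2 * k) -> Prop) :
  G = \sum_c facet1 R c * \sum_(p <- s c) p ^+ 2 ->
  (forall k z, Z k z -> moment_cone z) ->
  (exists B : nat, forall k (z : tms R m (2 * k)), (B <= k)%N -> Z k z -> pairing G z <= 0) ->
  forall c p, p \in s c -> eventually_null Z (facet1 R c * p).
Proof.
move=> GE coneZ [B0 G0] c p pc.
pose N := \max_c \max_(p <- s c) msize p.
have pN c' p' : p' \in s c' -> (msize p' <= N)%N.
  move=> pc'; apply: leq_trans (leq_bigmax c').
  by rewrite (big_rem p')//= leq_maxl.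
exists (maxn B0 N).+2 => k z h Zz hk.
have B0k : (B0 <= k)%N by lia.
have cz := coneZ _ _ Zz.
have dk f : (msize f <= N)%N -> deg_le k.-1 f by rewrite /deg_le => fN; lia.
have dp p' c' : p' \in s c' -> deg_le k.-1 p' by move=> /pN /dk.
have ge0 c' p' : p' \in s c' -> 0 <= pairing (facet1 R c' * p' ^+ 2) z.
  by move=> pc'; apply: moment_cstr_ge0 => //; [exact: facet1_cstr | exact: dp pc'].
apply: cstr_null => //; [exact: facet1_cstr | exact: dp pc | |].
  by rewrite /deg_le; lia.
have sumG : pairing G z = \sum_c \sum_(p <- s c) pairing (facet1 R c * p ^+ 2) z.
  rewrite GE pairing_sum; apply: eq_bigr => c' _.
  by rewrite mulr_sumr pairing_sum.
have G_eq0 : \sum_c \sum_(p <- s c) pairing (facet1 R c * p ^+ 2) z = 0.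
  apply/eqP; rewrite eq_le -sumG G0//= sumG.
  by apply: sumr_ge0 => c' _; rewrite big_seq sumr_ge0// => p' pc'; exact: ge0 pc'.
have c_eq0 : \sum_(p <- s c) pairing (facet1 R c * p ^+ 2) z = 0.
  move/psumr_eq0P: G_eq0; apply=> // c' _.
  by rewrite big_seq sumr_ge0// => p' pc'; exact: ge0 pc'.
apply/eqP; rewrite eq_le ge0// andbT -[leRHS]c_eq0 (big_rem p)//= lerDl.
by rewrite big_seq sumr_ge0// => p' /mem_rem pc'; exact: ge0 pc'.
Qed.

(** * Faces of the simplex and critical ideals *)

Section Ideal.
Variables (R : realType) (m : nat) (J : {mpoly R[m]} -> Prop).
Hypothesis idealJ : mpoly_ideal J.
Implicit Types (f g : {mpoly R[m]}).

Lemma ideal0 : J 0.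
Proof. by case: idealJ. Qed.

Lemma ideal_sum (I : Type) (r : seq I) (P : pred I) (h : I -> {mpoly R[m]}) :
  (forall i, P i -> J (h i)) -> J (\sum_(i <- r | P i) h i).
Proof. by have [J0 JD _] := idealJ; move=> Jh; elim/big_ind: _. Qed.

Lemma ideal_sum_seq (I : eqType) (r : seq I) (h : I -> {mpoly R[m]}) :
  (forall i, i \in r -> J (h i)) -> J (\sum_(i <- r) h i).
Proof. by move=> Jh; rewrite big_seq; exact: ideal_sum. Qed.

Lemma idealMl f g : J g -> J (f * g).
Proof. by have [_ _ JM] := idealJ; rewrite mulrC; exact: JM. Qed.

Lemma idealMr f g : J f -> J (f * g).
Proof. by have [_ _ JM] := idealJ; exact: JM. Qed.

Lemma idealD f g : J f -> J g -> J (f + g).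
Proof. by have [_ JD _] := idealJ; exact: JD. Qed.

Lemma ideal_prod_congr (I : finType) (P : pred I) (f g : I -> {mpoly R[m]}) :
  (forall i, P i -> J (f i - g i)) ->
  J (\prod_(i | P i) f i - \prod_(i | P i) g i).
Proof.
move=> Jfg; apply: (big_ind2 (fun x y => J (x - y))) => [|f1 g1 f2 g2 J1 J2|//].
  by rewrite subrr; exact: ideal0.
have -> : f1 * f2 - g1 * g2 = f1 * (f2 - g2) + g2 * (f1 - g1) by ring.
by apply: idealD; exact: idealMl.
Qed.

End Ideal.

Section Faces.
Variables (R : realType) (m : nat).
Implicit Types (f g G : {mpoly R[m]}) (S : {set option 'I_m}).

(** The derivative in the direction along which [facet (Some i)] increases,
    [facet lo] decreases and the other facets are constant. *)
Definition face_deriv (lo : option 'I_m) (i : 'I_m) G : {mpoly R[m]} :=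
  G^`M(i) - (if lo is Some l then G^`M(l) else 0).

Lemma face_derivD lo i f g : face_deriv lo i (f + g) = face_deriv lo i f + face_deriv lo i g.
Proof. by rewrite /face_deriv; case: lo => [l|]; rewrite !mderivD; ring. Qed.

Lemma face_deriv0 lo i : face_deriv lo i 0 = 0.
Proof. by rewrite /face_deriv; case: lo => [l|]; rewrite !mderiv0 subr0. Qed.

Lemma face_derivZ lo i c f : face_deriv lo i (c *: f) = c *: face_deriv lo i f.
Proof.
by rewrite /face_deriv scalerBr mderivZ; case: lo => [l|]; rewrite ?mderivZ ?scaler0.
Qed.

Lemma face_deriv_sum lo i (I : Type) (r : seq I) (P : pred I) (h : I -> {mpoly R[m]}) :
  face_deriv lo i (\sum_(j <- r | P j) h j) = \sum_(j <- r | P j) face_deriv lo i (h j).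
Proof.
by apply: (big_morph (face_deriv lo i)) => [f g|]; rewrite ?face_derivD ?face_deriv0.
Qed.

Lemma face_derivM lo i f g :
  face_deriv lo i (f * g) = face_deriv lo i f * g + f * face_deriv lo i g.
Proof. by rewrite /face_deriv; case: lo => [l|]; rewrite !mderivM; ring. Qed.

Lemma mderiv_var (i j : 'I_m) : ('X_j : {mpoly R[m]})^`M(i) = (j == i)%:R.
Proof.
rewrite mderivX mnm1E; case: eqP => [->|_]; last by rewrite scale0r.
rewrite scale1r (_ : (U_(i) - U_(i))%MM = 0%MM) ?mpolyX0//.
by apply/mnmP => l; rewrite mnmBE subnn mnm0E.
Qed.

Lemma mderiv_simplex_cstr (i : 'I_m) : (simplex_cstr R m)^`M(i) = -1.
Proof.
have sumE : (\sum_(j < m) 'X_j : {mpoly R[m]})^`M(i) = 1.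
  rewrite (big_morph (mderiv i) (mderivD i) (mderiv0 _ i)).
  rewrite (bigD1 i)//= mderiv_var eqxx big1 ?addr0// => j /negbTE ji.
  by rewrite mderiv_var ji.
by rewrite /simplex_cstr mderivB sumE -{1}mpolyC1 mderivC sub0r.
Qed.

Lemma face_deriv_facet lo i S o : lo \notin S -> Some i \notin S -> o \in S ->
  face_deriv lo i (facet R o) = 0.
Proof.
move=> loS iS oS; rewrite /face_deriv; case: o oS => [j|] oS /=.
  rewrite mderiv_var; have /negbTE -> : j != i.
    by apply: contraNneq iS => <-.
  case: lo loS => [l|_]; rewrite ?subr0// mderiv_var => loS.
  by have /negbTE -> : j != l; [apply: contraNneq loS => <- | rewrite subr0].
case: lo loS => [l _|]; last by rewrite oS.
by rewrite !mderiv_simplex_cstr subrr.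
Qed.

(** The ideal of the facets in [S] and of the derivatives of [G] along the face
    where they vanish: its zeros are the critical points of [G] on the affine
    span of that face. *)
Definition face_ideal S lo G f : Prop :=
  exists (a : option 'I_m -> {mpoly R[m]}) (b : 'I_m -> {mpoly R[m]}),
    f = \sum_(o in S) a o * facet R o
        + \sum_(i | (Some i \notin S) && (Some i != lo)) b i * face_deriv lo i G.

Definition univ (i : 'I_m) (r : {poly R}) : {mpoly R[m]} :=
  (map_poly (@mpolyC m R) r).['X_i].

Lemma univM i (r s : {poly R}) : univ i (r * s) = univ i r * univ i s.
Proof. by rewrite /univ rmorphM hornerM. Qed.

Lemma univ1 i : univ i 1 = 1.
Proof. by rewrite /univ rmorph1 hornerE. Qed.

Lemma univ_prod i (I : Type) (t : seq I) (P : pred I) (r : I -> {poly R}) :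
  univ i (\prod_(j <- t | P j) r j) = \prod_(j <- t | P j) univ i (r j).
Proof. by apply: (big_morph (univ i)) => [r1 r2|]; rewrite ?univM ?univ1. Qed.

Variable J : {mpoly R[m]} -> Prop.
Hypothesis idealJ : mpoly_ideal J.

Definition ideal_with S f : Prop :=
  exists a : option 'I_m -> {mpoly R[m]}, J (f - \sum_(o in S) a o * facet R o).

Lemma ideal_with_ideal S : mpoly_ideal (ideal_with S).
Proof.
split=> [|f g [a Ja] [b Jb]|f g [a Ja]].
- exists (fun=> 0); rewrite sub0r big1 ?oppr0; first by case: idealJ.
  by move=> o _; rewrite mul0r.
- exists (fun o => a o + b o).
  under eq_bigr do rewrite mulrDl.
  by rewrite big_split /= opprD addrACA; exact: (idealD idealJ).
exists (fun o => g * a o).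
under eq_bigr do rewrite -mulrA.
by rewrite -mulr_sumr mulrC -mulrBr; exact: (idealMl idealJ).
Qed.

Lemma ideal_with_sub S f : J f -> ideal_with S f.
Proof. by move=> Jf; exists (fun=> 0); rewrite big1 ?subr0// => o _; rewrite mul0r. Qed.

Lemma ideal_with_facet S o : o \in S -> ideal_with S (facet R o).
Proof.
move=> oS; exists (fun o' => (o' == o)%:R); rewrite (bigD1 o)//= eqxx mul1r big1.
  by rewrite addr0 subrr; case: idealJ.
by move=> o' /andP[_ /negbTE ->]; rewrite mul0r.
Qed.

Variables (G : {mpoly R[m]}) (s : option (option 'I_m) -> seq {mpoly R[m]}).
Hypothesis GE : G = \sum_c facet1 R c * \sum_(p <- s c) p ^+ 2.
Hypothesis Js : forall c p, p \in s c -> J (facet1 R c * p).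

(** Leibniz: $D(q p^2) = 2 (q p) Dp + (Dq) p^2$, and the last term vanishes when
    [q] is constant along the face, and is a multiple of $q p$ after
    multiplication by the product of the other facets. *)
Lemma face_deriv_ideal S lo i : lo \notin S -> Some i \notin S ->
  J ((\prod_(o | o \notin S) facet R o) * face_deriv lo i G).
Proof.
move=> loS iS; rewrite GE face_deriv_sum mulr_sumr; apply: (ideal_sum idealJ) => c _.
rewrite mulr_sumr face_deriv_sum mulr_sumr; apply: (ideal_sum_seq idealJ) => p pc.
have Jp := Js pc; set C := \prod_(o | _) _.
have -> : C * face_deriv lo i (facet1 R c * p ^+ 2)
    = C * face_deriv lo i (facet1 R c) * p ^+ 2
      + facet1 R c * p * (2 * C * face_deriv lo i p).
  by rewrite expr2 !face_derivM; ring.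
apply: (idealD idealJ); last exact: (idealMr idealJ).
case: c pc Jp => [o|] pc Jp /=; last first.
  rewrite /face_deriv; have d1 l : (1 : {mpoly R[m]})^`M(l) = 0 by rewrite -mpolyC1 mderivC.
  rewrite d1; case: (lo) => [l|]; rewrite ?d1 subr0 mulr0 mul0r; by case: idealJ.
have [oS|oS] := boolP (o \in S).
  rewrite (face_deriv_facet loS iS oS) mulr0 mul0r; by case: idealJ.
rewrite /C (bigD1 o)//=; set C' := \prod_(o' | _) _.
rewrite [X in J X](_ : _ = facet R o * p * (C' * face_deriv lo i (facet R o) * p)).
  exact: (idealMr idealJ).
by ring.
Qed.

(** By descending induction on [S], from $1 = \sum q_o$ when [S] contains all the
    facets: with $q_S = \prod_{o \notin S} q_o$, the product of the polynomials
    found for the [o |: S] lies in $(J, S, q_S)$, and $q_S$ maps [face_ideal] into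
    $(J, S)$. *)
Lemma univ_ideal_of_faces (i : 'I_m) :
  (forall S, S != setT -> exists2 lo, lo \notin S &
     exists2 r : {poly R}, r != 0 & face_ideal S lo G (univ i r)) ->
  exists2 r : {poly R}, r != 0 & J (univ i r).
Proof.
move=> faces.
suff /(_ set0)[r r0 [a]] : forall S, exists2 r : {poly R}, r != 0 & ideal_with S (univ i r).
  by rewrite big_set0 subr0; exists r.
move=> S; have [n] := ubnP #|~: S|; elim: n S => // n IH S Sn.
have [_ KD _] := ideal_with_ideal S.
have [_ _ KM] := ideal_with_ideal S.
have [ST|ST] := eqVneq S setT.
  exists 1; first exact: oner_neq0.
  rewrite univ1 -(sum_facet R m) ST; exists (fun=> 1).
  rewrite [X in J (_ - X)](eq_bigl xpredT) => [|o]; last by rewrite in_setT.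
  by under eq_bigr do rewrite mul1r; rewrite subrr; case: idealJ.
have [lo loS [r r0 [a [b rE]]]] := faces S ST.
have {IH} [t tP] : exists t : option 'I_m -> {poly R}, forall o, o \notin S ->
    t o != 0 /\ ideal_with (o |: S) (univ i (t o)).
  apply: (@fin_all_exists _ _ (fun o to => o \notin S ->
    to != 0 /\ ideal_with (o |: S) (univ i to))) => o; have [oS|oS] := boolP (o \in S); first by exists 0.
  have [|t t0 Kt] := IH (o |: S); last by exists t.
  rewrite -ltnS (leq_trans _ Sn)// ltnS; apply: proper_card.
  rewrite properEneq setCS subsetU1 andbT; apply: contraNneq oS => /setC_inj <-.
  exact: setU11.
have {tP} [h hP] : exists h : option 'I_m -> {mpoly R[m]}, forall o, o \notin S ->
    t o != 0 /\ ideal_with S (univ i (t o) - h o * facet R o).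
  apply: (@fin_all_exists _ _ (fun o ho => o \notin S ->
    t o != 0 /\ ideal_with S (univ i (t o) - ho * facet R o))) => o; have [oS|oS] := boolP (o \in S); first by exists 0.
  have [t0 [c Jc]] := tP o oS; exists (c o) => _; split=> //; exists c.
  by move: Jc; rewrite big_setU1// opprD addrA.
exists (r * \prod_(o | o \notin S) t o).
  by rewrite mulf_neq0//; apply/prodf_neq0 => o /hP[].
have idS := ideal_with_ideal S.
rewrite univM univ_prod; set C := \prod_(o | o \notin S) facet R o.
have KC : ideal_with S (univ i r * C).
  rewrite rE mulrDl; apply: (idealD idS); rewrite mulr_suml; apply: (ideal_sum idS).
    by move=> o oS; rewrite mulrAC; apply/(idealMl idS)/ideal_with_facet.
  move=> l /andP[lS _]; rewrite -mulrA [_ * C]mulrC.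
  by apply/(idealMl idS)/ideal_with_sub/face_deriv_ideal.
rewrite -[\prod_(o | _) _](subrK (\prod_(o | o \notin S) (h o * facet R o))) mulrDr.
apply: (idealD idS).
  by apply/(idealMl idS)/(ideal_prod_congr idS) => o /hP[].
by rewrite big_split mulrCA; exact: (idealMl idS).
Qed.

End Faces.

(** * Nondegenerate polynomials *)

Section Generic.
Variables (R : realType) (m D : nat) (S : {set option 'I_m}) (lo : option 'I_m) (N : nat).
Hypothesis D_ge2 : (2 <= D)%N.
Implicit Types (F G p : {mpoly R[m]}) (a b : 'X_{1..m}).

(** A linear form in the coefficients of degree [D], needed to make constant
    generators linear in [F]. *)
Definition pure_sum F : R := \sum_i F@_(U_(i) *+ D)%MM.

Definition face_exp (i : 'I_m) : nat :=
  if (Some i \in S) || (Some i == lo) then 1%N else D.-1.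

(** Generators of the face ideal, indexed by the coordinates.  The facets carry
    the factor [pure_sum F] so that every generator is linear in [F]. *)
Definition face_gen F (i : 'I_m) : {mpoly R[m]} :=
  if Some i == lo then - (pure_sum F *: simplex_cstr R m)
  else if Some i \in S then pure_sum F *: 'X_i
  else face_deriv lo i F.

(** Replaces the factor $x_i^{e_i}$ of a monomial by the generator of index [i],
    which has degree at most $e_i$. *)
Definition face_subst F a : {mpoly R[m]} :=
  if [pick i | face_exp i <= a i]%N is Some i
  then 'X_[a - U_(i) *+ face_exp i] * face_gen F i
  else pure_sum F *: 'X_[a].

Definition hpart (p : {mpoly R[m]}) (s : nat) : 'rV[R]_#|{: monom_le m N}| :=
  \row_j (if mdeg (bmnm (enum_val j)) == s then p@_(bmnm (enum_val j)) else 0).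

(** The substitution [face_subst] on leading forms: a matrix that is linear in [F]
    and block diagonal with respect to the degree. *)
Definition face_mx F : 'M[R]_#|{: monom_le m N}| :=
  \matrix_i hpart (face_subst F (bmnm (enum_val i))) (mdeg (bmnm (enum_val i))).

Lemma hpartD p q s : hpart (p + q) s = hpart p s + hpart q s.
Proof. by apply/rowP => j; rewrite !mxE mcoeffD; case: ifP; rewrite ?addr0. Qed.

Lemma hpart0 s : hpart 0 s = 0.
Proof. by apply/rowP => j; rewrite !mxE mcoeff0 if_same. Qed.

Lemma hpartZ c p s : hpart (c *: p) s = c *: hpart p s.
Proof. by apply/rowP => j; rewrite !mxE mcoeffZ; case: ifP; rewrite ?mulr0. Qed.

Lemma hpartN p s : hpart (- p) s = - hpart p s.
Proof. by rewrite -scaleN1r hpartZ scaleN1r. Qed.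

Lemma hpart_sum (I : Type) (r : seq I) (P : pred I) (f : I -> {mpoly R[m]}) s :
  hpart (\sum_(i <- r | P i) f i) s = \sum_(i <- r | P i) hpart (f i) s.
Proof.
by apply: (big_morph (fun p => hpart p s)) => [p q|]; rewrite ?hpartD ?hpart0.
Qed.

Lemma hpart_lower p s : deg_le s.-1 p -> (0 < s)%N -> hpart p s = 0.
Proof.
move=> /deg_leP dp s0; apply/rowP => j; rewrite !mxE; case: eqP => // e.
by rewrite dp// e prednK.
Qed.

Lemma hpart_mon (b : monom_le m N) :
  hpart 'X_[bmnm b] (mdeg (bmnm b)) = delta_mx 0 (enum_rank b).
Proof.
apply/rowP => j; rewrite !mxE eqxx /= mcoeffX.
rewrite -(can_eq enum_valK) enum_rankK.
have -> : (bmnm b == bmnm (enum_val j)) = (enum_val j == b) by rewrite eq_sym.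
by case: (eqVneq (enum_val j) b) => [->|_]; rewrite ?eqxx// if_same.
Qed.

Lemma pure_sum_comb (I : Type) (r : seq I) (c : I -> R) (f : I -> {mpoly R[m]}) :
  pure_sum (\sum_(i <- r) c i *: f i) = \sum_(i <- r) c i * pure_sum (f i).
Proof.
rewrite /pure_sum; under [RHS]eq_bigr do rewrite mulr_sumr.
rewrite exchange_big; apply: eq_bigr => i _; rewrite raddf_sum /=.
by apply: eq_bigr => j _; rewrite mcoeffZ.
Qed.

Lemma face_gen_comb (I : Type) (r : seq I) (c : I -> R) (f : I -> {mpoly R[m]}) i :
  face_gen (\sum_(j <- r) c j *: f j) i = \sum_(j <- r) c j *: face_gen (f j) i.
Proof.
rewrite /face_gen; case: eqP => [_|_].
  rewrite pure_sum_comb scaler_suml -sumrN; apply: eq_bigr => j _.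
  by rewrite scalerN scalerA.
case: ifP => [_|_].
  by rewrite pure_sum_comb scaler_suml; apply: eq_bigr => j _; rewrite scalerA.
by rewrite face_deriv_sum; apply: eq_bigr => j _; rewrite face_derivZ.
Qed.

Lemma face_mx_comb (I : Type) (r : seq I) (c : I -> R) (f : I -> {mpoly R[m]}) :
  face_mx (\sum_(j <- r) c j *: f j) = \sum_(j <- r) c j *: face_mx (f j).
Proof.
apply/row_matrixP => i; rewrite rowK linear_sum /=.
have rowZ (x : R) (M : 'M[R]_#|{: monom_le m N}|) : row i (x *: M) = x *: row i M.
  by apply/rowP => j; rewrite !mxE.
under [RHS]eq_bigr do rewrite rowZ rowK.
rewrite /face_subst; case: pickP => [l _|_].
  rewrite face_gen_comb mulr_sumr hpart_sum; apply: eq_bigr => j _.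
  by rewrite -scalerAr hpartZ.
rewrite pure_sum_comb scaler_suml hpart_sum; apply: eq_bigr => j _.
by rewrite -scalerA hpartZ.
Qed.

Lemma deg_le_mderiv e (i : 'I_m) p : deg_le e p -> deg_le e.-1 p^`M(i).
Proof.
move=> /deg_leP dp; apply/deg_leP => a ea; rewrite mcoeff_mderiv dp ?mul0rn//.
by rewrite mdegD mdeg1; lia.
Qed.

Lemma deg_le_face_deriv e (i : 'I_m) p : deg_le e p -> deg_le e.-1 (face_deriv lo i p).
Proof.
move=> dp; apply: deg_leB; first exact: deg_le_mderiv.
by case: lo => [l|]; [exact: deg_le_mderiv | exact: deg_le0].
Qed.

Lemma deg_le_face_gen F (i : 'I_m) : deg_le D F -> deg_le (face_exp i) (face_gen F i).
Proof.
move=> dF; rewrite /face_exp /face_gen orbC; case: eqP => [_|_] /=.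
  by apply: deg_leN; apply: deg_leZ; exact: deg_le_simplex_cstr.
case: ifP => _; first by apply: deg_leZ; exact: deg_le_var.
exact: deg_le_face_deriv.
Qed.

Lemma mdeg_subst a (i : 'I_m) : (face_exp i <= a i)%N ->
  mdeg a = (mdeg (a - U_(i) *+ face_exp i)%MM + face_exp i)%N.
Proof.
move=> ia; have le : (U_(i) *+ face_exp i <= a)%MM.
  apply/mnm_lepP => j; rewrite mulmnE mnm1E; case: eqP => [<-|_]; last by rewrite mul0n.
  by rewrite mul1n.
by rewrite -{1}(submK le) mdegD mdegMn mdeg1 mul1n.
Qed.

Lemma deg_le_face_subst F a : deg_le D F -> deg_le (mdeg a) (face_subst F a).
Proof.
move=> dF; rewrite /face_subst; case: pickP => [i ia|_].
  rewrite (mdeg_subst ia); apply: deg_leM; [exact: deg_le_mon | exact: deg_le_face_gen].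
by apply: deg_leZ; exact: deg_le_mon.
Qed.

(** The reason why invertibility of [face_mx] at $R - \rho$ is a condition on $R$. *)
Lemma face_mxB F p : deg_le D.-1 p -> face_mx (F - p) = face_mx F.
Proof.
move=> dp; have p0 : pure_sum p = 0.
  rewrite /pure_sum big1// => i _; move/deg_leP: dp => -> //.
  by rewrite mdegMn mdeg1; lia.
have -> : F - p = \sum_(b <- [:: true; false]) (if b then 1 else -1) *: (if b then F else p).
  by rewrite !big_cons big_nil addr0 scale1r scaleN1r.
rewrite face_mx_comb !big_cons big_nil addr0 scale1r scaleN1r.
suff -> : face_mx p = 0 by rewrite subr0.
apply/row_matrixP => r; rewrite rowK row0 /face_subst.
case: pickP => [i ia|_]; last by rewrite p0 scale0r hpart0.
rewrite /face_gen p0 scale0r oppr0 scale0r.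
case: eqP => [_|/eqP ilo]; first by rewrite mulr0 hpart0.
case: ifP => [_|/negbT iS]; first by rewrite mulr0 hpart0.
have eE : face_exp i = D.-1 by rewrite /face_exp (negbTE iS) (negbTE ilo).
have := mdeg_subst ia; rewrite eE => dE.
apply: hpart_lower; last by rewrite dE; lia.
apply: (@deg_leW _ _ (mdeg (bmnm (enum_val r) - U_(i) *+ D.-1)%MM + D.-2)).
  by rewrite {}dE; move: (mdeg _) D_ge2 => x; clear; lia.
by apply: deg_leM; [exact: deg_le_mon | exact: deg_le_face_deriv].
Qed.

Section Direction.
Variable P : {mpoly R[m]}.
Hypothesis P_pure : pure_sum P != 0.
Hypothesis P_deriv : forall i, Some i \notin S -> Some i != lo ->
  face_deriv lo i P = D%:R *: 'X_[U_(i) *+ D.-1].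

(** Every generator is a nonzero multiple of $x_i^{e_i}$, except for the one of
    index [lo], whose leading form is a multiple of $\sum x_j$: the monomials are
    reached by induction on the degree in the variable [lo]. *)
Lemma face_mx_unit : face_mx P \in unitmx.
Proof.
rewrite -row_full_unit -sub1mx; apply/row_subP => r; rewrite row1.
rewrite -[r]enum_valK; move: (enum_val r) => b {r}.
pose lodeg (b : 'X_{1..m}) := if lo is Some l then b l else 0%N.
have [n] := ubnP (lodeg b); elim: n b => // n IH b bn.
have rowE : row (enum_rank b) (face_mx P) = hpart (face_subst P b) (mdeg (bmnm b)).
  by rewrite rowK enum_rankK.
have rowS : (hpart (face_subst P b) (mdeg (bmnm b)) <= face_mx P)%MS.
  by rewrite -rowE row_sub.
have monS (c : R) (v : 'rV[R]_#|{: monom_le m N}|) : c != 0 ->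
    (c *: v <= face_mx P)%MS -> (v <= face_mx P)%MS.
  by move=> c0; rewrite (eqmx_scale _ c0).
move: rowS; rewrite /face_subst; case: pickP => [i ib|_]; last first.
  by rewrite hpartZ hpart_mon; exact: monS.
have le : (U_(i) *+ face_exp i <= bmnm b)%MM.
  apply/mnm_lepP => j; rewrite mulmnE mnm1E; case: eqP => [<-|_]; last by rewrite mul0n.
  by rewrite mul1n.
rewrite /face_gen; case: eqP => [ilo|/eqP ilo]; last first.
  case: ifP => [iS|/negbT iS].
    have e1 : face_exp i = 1%N by rewrite /face_exp iS.
    have bE : (bmnm b - U_(i) *+ face_exp i + U_(i))%MM = bmnm b.
      by move: (submK le); rewrite e1 mulm1n.
    by rewrite -scalerAr -mpolyXD hpartZ bE hpart_mon; exact: monS.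
  have eE : face_exp i = D.-1 by rewrite /face_exp (negbTE iS) (negbTE ilo).
  rewrite P_deriv// -eE -scalerAr -mpolyXD hpartZ submK// hpart_mon.
  by apply: monS; rewrite pnatr_eq0; lia.
have e1 : face_exp i = 1%N by rewrite /face_exp ilo eqxx orbT.
move: le; rewrite e1 mulm1n => le.
pose b_ j : 'X_{1..m} := (bmnm b - U_(i) + U_(j))%MM.
have b_deg j : mdeg (b_ j) = mdeg (bmnm b).
  by rewrite /b_ mdegD mdeg1 -[in RHS](submK le) mdegD mdeg1.
have b_lt j : (mdeg (b_ j) < N.+1)%N by rewrite b_deg; exact: bmdeg.
have -> : 'X_[bmnm b - U_(i)] * - (pure_sum P *: simplex_cstr R m)
    = pure_sum P *: (\sum_j 'X_[b_ j] - 'X_[bmnm b - U_(i)]).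
  rewrite /b_; under eq_bigr do rewrite mpolyXD.
  by rewrite -mulr_sumr /simplex_cstr -scalerN -scalerAr; congr (_ *: _); ring.
have low : hpart 'X_[bmnm b - U_(i)] (mdeg (bmnm b)) = 0.
  have db : mdeg (bmnm b) = (mdeg (bmnm b - U_(i))%MM).+1.
    by rewrite -[in LHS](submK le) mdegD mdeg1 addn1.
  by apply: hpart_lower; rewrite db//; exact: deg_le_mon.
rewrite hpartZ hpartD hpartN low subr0 hpart_sum => h.
pose H j := hpart 'X_[R, b_ j] (mdeg (bmnm b)).
have HS : ((\sum_j H j)%R <= face_mx P)%MS.
  exact: monS P_pure h.
have HE j : H j = delta_mx 0 (enum_rank (BMultinom (b_lt j))).
  by rewrite -(hpart_mon (BMultinom (b_lt j))) /H /= b_deg.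
have biE : BMultinom (b_lt i) = b by apply: val_inj; rewrite /= /b_ submK.
have HiE : H i = \sum_j H j - \sum_(j | j != i) H j by rewrite (bigD1 i)//= addrK.
rewrite -biE -HE HiE; apply: addmx_sub => //; rewrite -scaleN1r; apply: scalemx_sub.
apply: summx_sub => j ji; rewrite HE; apply: IH.
rewrite /lodeg -ilo /= /b_ mnmDE mnmBE !mnm1E eqxx (negbTE ji) addn0.
move: bn le; rewrite /lodeg -ilo lep1mP; case: (bmnm b i) => // x.
by rewrite subn1 ltnS.
Qed.


End Direction.
Section PurePowers.
Hypothesis m_gt0 : (0 < m)%N.

(** The coordinate [lo] is left out, so that $P$ has no derivative along it,
    unless it is the only one. *)
Definition pure_index (i : 'I_m) : bool := (Some i != lo) || (m == 1%N).
Definition pure_powers : {mpoly R[m]} := \sum_(i | pure_index i) 'X_[U_(i) *+ D].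

Lemma mcoeff_pure_powers a :
  pure_powers@_a = (\sum_(i | pure_index i) (U_(i) *+ D == a)%MM)%:R.
Proof.
rewrite /pure_powers raddf_sum natr_sum /=; apply: eq_bigr => i _.
by rewrite mcoeffX.
Qed.

Lemma eq_pure_mon (i j : 'I_m) : (U_(i) *+ D == U_(j) *+ D)%MM = (i == j).
Proof.
apply/eqP/eqP => [/(congr1 (fun a : 'X_{1..m} => a i))|->//].
rewrite !mulmnE !mnm1E eqxx; case: eqP => // _.
by rewrite mul1n mul0n => D0; move: D_ge2; rewrite D0.
Qed.

Lemma pure_sum_pure_powers : pure_sum pure_powers != 0.
Proof.
have -> : pure_sum pure_powers = (\sum_(i | pure_index i) 1)%:R.
  rewrite /pure_sum natr_sum /=; under eq_bigr do rewrite mcoeff_pure_powers.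
  rewrite [RHS]big_mkcond; apply: eq_bigr => j _.
  under eq_bigr do rewrite eq_pure_mon.
  case: ifP => jQ.
    rewrite (bigD1 j)//= eqxx big1 ?addn0// => i /andP[_ /negbTE ij].
    by rewrite ij.
  by rewrite big1// => i iQ; case: eqP => // ij; rewrite ij jQ in iQ.
rewrite pnatr_eq0 sum1_card -lt0n; apply/card_gt0P.
have [i iE|all_lo] := pickP (fun i : 'I_m => Some i != lo).
  by exists i; rewrite unfold_in /pure_index /= iE.
exists (Ordinal m_gt0); rewrite unfold_in /pure_index; apply/orP; right.
have /negbFE/eqP e0 := all_lo (Ordinal m_gt0).
case: (ltngtP m 1) => // [|m1]; first by rewrite ltnNge m_gt0.
by have /negbFE/eqP := all_lo (Ordinal m1); rewrite -e0 => -[].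
Qed.

Lemma mderiv_pure_mon (i j : 'I_m) : ('X_[U_(j) *+ D] : {mpoly R[m]})^`M(i) =
  if j == i then D%:R *: 'X_[U_(i) *+ D.-1] else 0.
Proof.
rewrite mderivX mulmnE mnm1E; case: eqP => [->|_]; last by rewrite scale0r.
rewrite mul1n; congr (_ *: 'X_[_]); apply/mnmP => l.
by rewrite mnmBE !mulmnE mnm1E; case: eqP => _; lia.
Qed.

Lemma face_deriv_pure_powers i : Some i != lo ->
  face_deriv lo i pure_powers = D%:R *: 'X_[U_(i) *+ D.-1].
Proof.
move=> ilo; have dE l : pure_powers^`M(l) =
    if pure_index l then D%:R *: 'X_[U_(l) *+ D.-1] else 0.
  rewrite /pure_powers (big_morph (mderiv l) (mderivD l) (mderiv0 _ l)).
  under eq_bigr do rewrite mderiv_pure_mon.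
  case: ifP => lQ; last by rewrite big1// => j jQ; case: eqP => // jl; rewrite jl lQ in jQ.
  by rewrite (bigD1 l)//= eqxx big1 ?addr0// => j /andP[_ /negbTE ->].
rewrite /face_deriv dE {1}/pure_index ilo /=; case loE: lo => [l|]; last by rewrite subr0.
rewrite dE; case: ifP => [|_]; last by rewrite subr0.
rewrite /pure_index loE eqxx /= => /eqP m1; rewrite loE in ilo.
have il' : i = l.
  have x0 (x : 'I_m) : val x = 0%N by case: x => x /= xm; move: xm m1; clear; lia.
  by apply: val_inj; rewrite !x0.
by rewrite il' eqxx in ilo.
Qed.

Lemma face_mx_pure_powers : face_mx pure_powers \in unitmx.
Proof.
apply: face_mx_unit; first exact: pure_sum_pure_powers.
by move=> i _; exact: face_deriv_pure_powers.
Qed.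

End PurePowers.

Section Reduction.
Variable G : {mpoly R[m]}.
Hypothesis dG : deg_le D G.
Hypothesis G_unit : face_mx G \in unitmx.
Hypothesis loS : lo \notin S.
Hypothesis lo_top : lo = None \/ None \in S.

Lemma face_ideal_ideal : mpoly_ideal (face_ideal S lo G).
Proof.
split=> [|f g [a [b ->]] [a' [b' ->]]|f g [a [b ->]]].
- exists (fun=> 0), (fun=> 0).
  by rewrite !big1 ?addr0// => i _; rewrite mul0r.
- exists (fun o => a o + a' o), (fun i => b i + b' i).
  under [X in _ = X + _]eq_bigr do rewrite mulrDl.
  under [X in _ = _ + X]eq_bigr do rewrite mulrDl.
  by rewrite !big_split /= addrACA.
exists (fun o => a o * g), (fun i => b i * g).
by rewrite mulrDl !mulr_suml; congr (_ + _); apply: eq_bigr => i _; rewrite mulrAC.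
Qed.

Lemma face_ideal_facet o : o \in S -> face_ideal S lo G (facet R o).
Proof.
move=> oS; exists (fun o' => (o' == o)%:R), (fun=> 0).
rewrite [X in _ + X]big1 ?addr0; last by move=> i _; rewrite mul0r.
rewrite (bigD1 o)//= eqxx mul1r big1 ?addr0//.
by move=> o' /andP[_ /negbTE ->]; rewrite mul0r.
Qed.

Lemma face_ideal_deriv i : Some i \notin S -> Some i != lo ->
  face_ideal S lo G (face_deriv lo i G).
Proof.
move=> iS ilo; exists (fun=> 0), (fun i' => (i' == i)%:R).
rewrite big1 ?add0r; last by move=> o _; rewrite mul0r.
rewrite (bigD1 i) ?iS//= eqxx mul1r big1 ?addr0//.
by move=> o' /andP[_ /negbTE ->]; rewrite mul0r.
Qed.

Lemma face_ideal_gen i : face_ideal S lo G (face_gen G i).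
Proof.
rewrite /face_gen; case: eqP => [ilo|/eqP ilo].
  rewrite -scalerN -mul_mpolyC -mulN1r; do 2! apply: (idealMl face_ideal_ideal).
  apply: (@face_ideal_facet None).
  by case: lo_top => // lo0; rewrite lo0 in ilo.
case: ifP => [iS|/negbT iS]; last exact: face_ideal_deriv.
rewrite -mul_mpolyC; apply: (idealMl face_ideal_ideal).
exact: (@face_ideal_facet (Some i)).
Qed.

(** The bound $mD$ does not depend on the degree of [p], which makes the quotient by
    the face ideal finite-dimensional. *)
Definition face_reducible p : Prop :=
  exists2 v, deg_le (m * D) v & face_ideal S lo G (p - v).

Lemma face_reducible_ideal p : face_ideal S lo G p -> face_reducible p.
Proof. by exists 0; [exact: deg_le0 | rewrite subr0]. Qed.

Lemma face_reducibleD p q : face_reducible p -> face_reducible q -> face_reducible (p + q).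
Proof.
move=> [v dv Iv] [v' dv' Iv']; exists (v + v'); first exact: deg_leD.
by rewrite opprD addrACA; exact: (idealD face_ideal_ideal).
Qed.

Lemma face_reducibleZ c p : face_reducible p -> face_reducible (c *: p).
Proof.
move=> [v dv Iv]; exists (c *: v); first exact: deg_leZ.
by rewrite -scalerBr -mul_mpolyC; exact: (idealMl face_ideal_ideal).
Qed.

Lemma face_reducible_subst a : face_reducible (face_subst G a).
Proof.
rewrite /face_subst; case: pickP => [i _|normal].
  exact/face_reducible_ideal/(idealMl face_ideal_ideal)/face_ideal_gen.
exists (pure_sum G *: 'X_[a]); last by rewrite subrr; case: face_ideal_ideal.
apply/deg_leZ/deg_le_mon; rewrite mdegE -[X in (_ <= X * _)%N]card_ord -sum_nat_const.
apply: leq_sum => i _; have := normal i; rewrite /= /face_exp leqNgt => /negbFE.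
by move: D_ge2; case: ifP => _; lia.
Qed.

(** Induction on the degree.  As [face_mx] is invertible, a combination of
    substituted monomials has the same leading form as [p]; a substituted monomial
    is in the face ideal, unless all its exponents are smaller than the $e_i$. *)
Lemma face_reducible_le p : deg_le N p -> face_reducible p.
Proof.
suff red s : (s <= N)%N -> forall p, deg_le s p -> face_reducible p by exact: red.
elim: s {p} => [|s IH] sN p dp.
  exists p; last by rewrite subrr; case: face_ideal_ideal.
  exact: deg_leW dp.
pose c := hpart p s.+1 *m invmx (face_mx G).
have cE : c *m face_mx G = hpart p s.+1 by rewrite mulmxKV.
pose q := \sum_(a : monom_le m N | mdeg (bmnm a) == s.+1)
  c 0 (enum_rank a) *: face_subst G (bmnm a).
have qR : face_reducible q.
  rewrite /q; elim/big_ind: _ => [|//|a _].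
  - by apply: face_reducible_ideal; case: face_ideal_ideal.
  - exact: face_reducibleD.
  - exact/face_reducibleZ/face_reducible_subst.
rewrite -(subrKC q p); apply: face_reducibleD => //; apply: IH; first exact: ltnW.
have dq : deg_le s.+1 q.
  apply: deg_le_sum => a /eqP aE; apply: deg_leZ; rewrite -aE.
  exact: deg_le_face_subst.
apply/deg_leP => b sb; rewrite mcoeffB.
have [bs|bs] := ltnP s.+1 (mdeg b).
  by move/deg_leP: dp => ->//; move/deg_leP: dq => ->//; rewrite subr0.
have bE : mdeg b = s.+1 by apply/eqP; rewrite eqn_leq bs.
have bN : (mdeg b < N.+1)%N by rewrite ltnS bE.
have := congr1 (fun v : 'rV_ _ => v 0 (enum_rank (BMultinom bN))) cE.
rewrite !mxE enum_rankK /= bE eqxx => <-.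
have -> : q@_b = \sum_(a : monom_le m N | mdeg (bmnm a) == s.+1)
    c 0 (enum_rank a) * (face_subst G (bmnm a))@_b.
  by rewrite /q raddf_sum /=; apply: eq_bigr => a _; rewrite mcoeffZ.
rewrite [X in X - _](reindex_onto enum_rank enum_val) => [|j _]; last by rewrite enum_valK.
rewrite [X in X - _](eq_bigl xpredT) => [|a]; last by rewrite enum_rankK eqxx.
rewrite [X in _ - X]big_mkcond -sumrB big1// => a _.
rewrite !mxE !enum_rankK /= bE eq_sym.
by case: ifP; rewrite ?mulr0 subrr.
Qed.

End Reduction.
End Generic.

Section UnivariateInFaceIdeal.
Variables (R : realType) (m D : nat) (S : {set option 'I_m}) (lo : option 'I_m).
Variable G : {mpoly R[m]}.

Lemma univ_comb (i : 'I_m) (C : nat) (u : 'I_C -> R) :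
  univ i (\sum_s u s *: 'X^s) = \sum_s u s *: 'X_i ^+ s.
Proof.
rewrite /univ rmorph_sum horner_sum; apply: eq_bigr => s _.
by rewrite -mul_polyC rmorphM /= map_polyC map_polyXn hornerM hornerC hornerXn mul_mpolyC.
Qed.

(** More powers of a coordinate than there are monomials of degree at most
    $mD$: two distinct combinations reduce to the same polynomial. *)
Lemma univ_face_ideal (N := #|{: monom_le m (m * D)}|) (i : 'I_m) :
  (2 <= D)%N -> deg_le D G -> face_mx D S lo N G \in unitmx -> lo \notin S ->
  lo = None \/ None \in S ->
  exists2 r : {poly R}, r != 0 & face_ideal S lo G (univ i r).
Proof.
move=> D2 dG uG loS lo_top.
have idI := face_ideal_ideal S lo G.
have [v vP] : exists v : 'I_N.+1 -> {mpoly R[m]}, forall s,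
    deg_le (m * D) (v s) /\ face_ideal S lo G ('X_i ^+ s - v s).
  apply: (@fin_all_exists _ _ (fun (s : 'I_N.+1) vs => deg_le (m * D) vs
    /\ face_ideal S lo G ('X_i ^+ s - vs))) => s.
  have [|vs] := @face_reducible_le R m D S lo N D2 G dG uG loS lo_top ('X_i ^+ s).
    apply: (@deg_leW _ _ (s * 1)); first by rewrite muln1 -ltnS.
    by apply: deg_leXn; exact: deg_le_var.
  by exists vs.
pose V : 'M[R]_(N.+1, N) := \matrix_(s, j) (v s)@_(bmnm (enum_val j)).
have /rowV0Pn[u /sub_kermxP uV u0] : kermx V != 0.
  by rewrite -mxrank_eq0 mxrank_ker subn_eq0 -ltnNge ltnS rank_leq_col.
exists (\sum_s u 0 s *: 'X^s).
  apply: contraNneq u0 => r0; apply/eqP/rowP => s; rewrite mxE.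
  have := congr1 (fun p : {poly R} => p`_s) r0; rewrite coef0 coef_sum.
  rewrite (bigD1 s)//= coefZ coefXn eqxx mulr1 big1 ?addr0// => t ts.
  by rewrite coefZ coefXn eq_sym (inj_eq val_inj) (negbTE ts) mulr0.
rewrite univ_comb.
have uv0 : \sum_s u 0 s *: v s = 0.
  apply/mpolyP => b; rewrite mcoeff0.
  have dsum : deg_le (m * D) (\sum_s u 0 s *: v s).
    by apply: deg_le_sum => s _; apply: deg_leZ; case: (vP s).
  have [bD|bD] := ltnP (m * D) (mdeg b); first by move/deg_leP: dsum => ->.
  have := congr1 (fun w : 'rV_N => w 0 (enum_rank (BMultinom (bD : mdeg b < (m * D).+1)%N))) uV.
  rewrite !mxE => <-; rewrite raddf_sum /=; apply: eq_bigr => s _.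
  by rewrite mcoeffZ mxE enum_rankK.
have -> : \sum_s u 0 s *: 'X_i ^+ s = \sum_s u 0 s *: ('X_i ^+ s - v s).
  by under [RHS]eq_bigr do rewrite scalerBr; rewrite sumrB uv0 subr0.
apply: (ideal_sum idI) => s _; rewrite -mul_mpolyC.
by apply: (idealMl idI); case: (vP s).
Qed.

End UnivariateInFaceIdeal.

(** * Null sets and leading coefficients *)

Section NullSets.
Variables (R : realType) (I : finType).
Implicit Types (x y : {ffun I -> R}).

Definition box_volume (b : {ffun I -> R} * {ffun I -> R}) : R := \prod_i (b.2 i - b.1 i).

Definition finite_cover (N : {ffun I -> R} -> Prop) (eps : R)
    (s : seq ({ffun I -> R} * {ffun I -> R})) : Prop :=
  [/\ forall b, b \in s -> forall i, b.1 i <= b.2 i,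
      forall x, N x -> exists2 b, b \in s & forall i, b.1 i <= x i <= b.2 i
    & \sum_(b <- s) box_volume b <= eps].

Lemma sum_half_powers (n : nat) : \sum_(k < n) (2^-1 : R) ^+ k.+1 <= 1.
Proof.
suff -> : \sum_(k < n) (2^-1 : R) ^+ k.+1 = 1 - 2^-1 ^+ n.
  by rewrite gerBl exprn_ge0// invr_ge0.
elim: n => [|n IH]; first by rewrite big_ord0 expr0 subrr.
by rewrite big_ord_recr /= IH !exprS; field.
Qed.

(** The covers of the pieces, of volumes $\varepsilon 2^{-b-1}$, are concatenated. *)
Lemma null_of_finite_covers (N : {ffun I -> R} -> Prop)
    (N_ : nat -> {ffun I -> R} -> Prop) : (0 < #|I|)%N ->
  (forall x, N x -> exists b, N_ b x) ->
  (forall b eps, 0 < eps -> exists s, finite_cover (N_ b) eps s) ->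
  lebesgue_null N.
Proof.
move=> I0 NN_ cov eps eps0.
have half_gt0 b : 0 < eps * 2^-1 ^+ b.+1 by rewrite mulr_gt0// exprn_gt0 ?invr_gt0.
have [s sP] : exists s, forall b, finite_cover (N_ b) (eps * 2^-1 ^+ b.+1) (s b).
  exists (fun b => sval (boolp.cid (cov b _ (half_gt0 b)))) => b.
  exact: (svalP (boolp.cid (cov b _ (half_gt0 b)))).
(* A degenerate box is added to each cover, so that [T n] has at least [n] boxes
   and the box of index [j] can be read off [T j.+1]. *)
pose z0 : {ffun I -> R} * {ffun I -> R} := ([ffun=> 0], [ffun=> 0]).
pose T n := flatten [seq z0 :: s b | b <- iota 0 n].
have TS n : T n.+1 = T n ++ (z0 :: s n).
  by rewrite /T -addn1 iotaD map_cat flatten_cat /= cats0.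
have sizeT n : (n <= size (T n))%N.
  elim: n => // n IH; rewrite TS size_cat /=; lia.
have nthT n n' j : (j < n)%N -> (n <= n')%N -> nth z0 (T n') j = nth z0 (T n) j.
  move=> jn; elim: n' => [|n' IH]; first by rewrite leqn0 => /eqP n0; rewrite n0 in jn.
  rewrite leq_eqVlt => /predU1P[->//|]; rewrite ltnS => nn'.
  by rewrite TS nth_cat ifT ?IH// (leq_trans jn)// (leq_trans nn').
have vol0 : box_volume z0 = 0.
  rewrite /box_volume /z0 /=; move/card_gt0P: I0 => [i _].
  by rewrite (bigD1 i)//= !ffunE subrr mul0r.
have T_le n b : b \in T n -> forall i, b.1 i <= b.2 i.
  move=> /flatten_mapP[k _]; rewrite inE => /predU1P[-> i|bk]; first by rewrite !ffunE.
  by have [+ _ _] := sP k; apply.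
have T_vol n : \sum_(b <- T n) box_volume b <= eps.
  apply: (@le_trans _ _ (\sum_(k < n) eps * 2^-1 ^+ k.+1)); last first.
    by rewrite -mulr_sumr -[leRHS]mulr1 ler_pM2l// sum_half_powers.
  elim: n => [|n IH]; first by rewrite /T big_nil big_ord0.
  rewrite TS big_cat /= big_cons vol0 add0r big_ord_recr /=; apply: lerD => //.
  by case: (sP n).
have vol_ge0 n b : b \in T n -> 0 <= box_volume b.
  by move=> /T_le bi; apply: prodr_ge0 => i _; rewrite subr_ge0.
pose bx j := nth z0 (T j.+1) j.
have bxT j : bx j \in T j.+1 by apply/mem_nth/sizeT.
exists (fun j => (bx j).1), (fun j => (bx j).2); split=> [j i|x Nx|J].
- exact: T_le (bxT j) i.
- have [b Nb] := NN_ x Nx; have [_ /(_ x Nb)[c cs xc] _] := sP b.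
  have cT : c \in T b.+1 by rewrite TS mem_cat inE cs !orbT.
  exists (index c (T b.+1)).
  suff -> : bx (index c (T b.+1)) = c by [].
  rewrite /bx; have iT : (index c (T b.+1) < size (T b.+1))%N by rewrite index_mem.
  have [bi|ib] := leqP b.+1 (index c (T b.+1)).+1; last first.
    by rewrite -(nthT _ b.+1 _ (ltnSn _) (ltnW ib)) nth_index.
  suff -> : forall n', (b.+1 <= n')%N -> nth z0 (T n') (index c (T b.+1)) = c => //.
  elim=> // n' IH; rewrite leq_eqVlt => /predU1P[<-|]; first by rewrite nth_index.
  rewrite ltnS => bn'; rewrite (TS n') nth_cat ifT; first exact: IH.
  have : forall n', (b.+1 <= n')%N -> (size (T b.+1) <= size (T n'))%N.
    elim=> // p IHp; rewrite leq_eqVlt => /predU1P[<-//|].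
    by rewrite ltnS => bp; rewrite (TS p) size_cat (leq_trans (IHp bp))// leq_addr.
  by move=> /(_ n' bn'); exact: leq_trans.
apply: le_trans (T_vol J); rewrite (big_nth z0) big_mkord.
rewrite (eq_bigr (fun j : 'I_J => box_volume (nth z0 (T J) j))); last first.
  by move=> j _; rewrite (@nthT j.+1 J j (ltnSn _) (ltn_ord j)).
rewrite -!(big_mkord xpredT (fun j => box_volume (nth z0 (T J) j))).
rewrite (big_cat_nat_idem _ (leq0n J) (sizeT J))//=; last by rewrite addr0.
rewrite lerDl big_nat_cond sumr_ge0// => j /andP[/andP[_ jT] _].
by apply: (vol_ge0 J); exact: mem_nth.
Qed.

Definition locally_lipschitz (f : {ffun I -> R} -> R) : Prop :=
  forall B : R, exists2 C : R, 0 <= C & forall x y e,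
    (forall i, `|x i| <= B) -> (forall i, `|y i| <= B) ->
    (forall i, `|x i - y i| <= e) -> 0 <= e -> `|f x - f y| <= C * e.

Lemma locally_lipschitz_cst c : locally_lipschitz (fun=> c).
Proof. by move=> B; exists 0 => // x y e _ _ _ _; rewrite subrr normr0 mul0r. Qed.

Lemma locally_lipschitz_coord i : locally_lipschitz (fun x => x i).
Proof. by move=> B; exists 1 => // x y e _ _ xy _; rewrite mul1r. Qed.

Lemma locally_lipschitzD f g : locally_lipschitz f -> locally_lipschitz g ->
  locally_lipschitz (fun x => f x + g x).
Proof.
move=> lf lg B; have [C C0 fC] := lf B; have [C' C'0 gC'] := lg B.
exists (C + C'); first exact: addr_ge0.
move=> x y e xB yB xy e0; rewrite opprD addrACA mulrDl.
by apply: le_trans (ler_normD _ _) _; apply: lerD; [exact: fC | exact: gC'].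
Qed.

Lemma locally_lipschitz_bounded f : locally_lipschitz f ->
  forall B : R, exists2 K : R, 0 <= K & forall x, (forall i, `|x i| <= B) -> `|f x| <= K.
Proof.
move=> lf B; have [C C0 fC] := lf `|B|.
exists (`|f [ffun=> 0]| + C * `|B|); first by rewrite addr_ge0 ?mulr_ge0.
move=> x xB; rewrite -(subrKC (f [ffun=> 0]) (f x)).
have xB' i : `|x i| <= `|B| by apply: le_trans (xB i) (ler_norm _).
apply: le_trans (ler_normD _ _) _; rewrite lerD2l; apply: fC => // i.
  by rewrite ffunE normr0.
by rewrite ffunE subr0.
Qed.

Lemma locally_lipschitzM f g : locally_lipschitz f -> locally_lipschitz g ->
  locally_lipschitz (fun x => f x * g x).
Proof.
move=> lf lg B; have [C C0 fC] := lf B; have [C' C'0 gC'] := lg B.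
have [K K0 fK] := locally_lipschitz_bounded lf B.
have [K' K'0 gK'] := locally_lipschitz_bounded lg B.
exists (K * C' + C * K'); first by rewrite addr_ge0 ?mulr_ge0.
move=> x y e xB yB xy e0.
have -> : f x * g x - f y * g y = f x * (g x - g y) + (f x - f y) * g y by ring.
apply: le_trans (ler_normD _ _) _; rewrite [leRHS]mulrDl; apply: lerD; rewrite normrM.
  by rewrite -mulrA; apply: ler_pM => //; [exact: fK | exact: gC'].
by rewrite mulrAC; apply: ler_pM => //; [exact: fC | exact: gK'].
Qed.

Lemma locally_lipschitz_ext f g : f =1 g -> locally_lipschitz f -> locally_lipschitz g.
Proof.
move=> fg lf B; have [C C0 fC] := lf B; exists C => // x y e xB yB xy e0.
by rewrite -!fg; exact: fC.
Qed.

Lemma locally_lipschitz_sum (T : Type) (r : seq T) (P : pred T)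
    (f : T -> {ffun I -> R} -> R) : (forall t, locally_lipschitz (f t)) ->
  locally_lipschitz (fun x => \sum_(t <- r | P t) f t x).
Proof.
move=> lf; elim: r => [|t r IH].
  by apply: locally_lipschitz_ext (locally_lipschitz_cst 0) => x; rewrite big_nil.
case Pt: (P t); last by apply: locally_lipschitz_ext IH => x; rewrite big_cons Pt.
apply: locally_lipschitz_ext (locally_lipschitzD (lf t) IH) => x.
by rewrite big_cons Pt.
Qed.

Lemma locally_lipschitz_prod (T : Type) (r : seq T) (P : pred T)
    (f : T -> {ffun I -> R} -> R) : (forall t, locally_lipschitz (f t)) ->
  locally_lipschitz (fun x => \prod_(t <- r | P t) f t x).
Proof.
move=> lf; elim: r => [|t r IH].
  by apply: locally_lipschitz_ext (locally_lipschitz_cst 1) => x; rewrite big_nil.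
case Pt: (P t); last by apply: locally_lipschitz_ext IH => x; rewrite big_cons Pt.
apply: locally_lipschitz_ext (locally_lipschitzM (lf t) IH) => x.
by rewrite big_cons Pt.
Qed.

End NullSets.

Section LeadingCoefficient.
Variable R : realFieldType.

(** The leading coefficient is a divided difference. *)
Lemma lead_coef_interpolation (n : nat) (p : {poly R}) (t : 'I_n.+1 -> R) :
  (size p <= n.+1)%N -> injective t ->
  p`_n = \sum_i p.[t i] / \prod_(j | j != i) (t i - t j).
Proof.
move=> sp tI.
pose L i : {poly R} := \prod_(j | j != i) ('X - (t j)%:P).
have sL i : size (L i) = n.+1.
  rewrite /L -big_filter size_prod_XsubC; congr _.+1.
  by rewrite size_filter -sum1_count (sum1_card (predC1 i)) cardC1 card_ord.
have Lmonic i : (L i)`_n = 1.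
  have /monicP : L i \is monic by apply: monic_prod => j _; exact: monicXsubC.
  by rewrite lead_coefE sL.
have LE i x : (L i).[x] = \prod_(j | j != i) (x - t j).
  by rewrite horner_prod; apply: eq_bigr => j _; rewrite !hornerE.
have Lz i k : k != i -> (L k).[t i] = 0.
  by move=> ki; rewrite LE (bigD1 i) 1?eq_sym//= subrr mul0r.
have L0 i : \prod_(j | j != i) (t i - t j) != 0.
  apply/prodf_neq0 => j ji; rewrite subr_eq0.
  by apply: contraNneq ji => /tI ->.
pose q := \sum_i (p.[t i] / \prod_(j | j != i) (t i - t j)) *: L i.
suff -> : p = q.
  rewrite {1}/q coef_sum; apply: eq_bigr => i _; rewrite coefZ Lmonic mulr1.
  suff -> : q.[t i] = p.[t i] by [].
  rewrite /q horner_sum (bigD1 i)//= hornerZ LE divfK// big1 ?addr0// => k ki.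
  by rewrite hornerZ Lz// mulr0.
apply/eqP; rewrite -subr_eq0; apply/eqP.
apply: (@roots_geq_poly_eq0 _ _ (codom t)).
- apply/allP => _ /codomP[i ->]; rewrite /root hornerD hornerN subr_eq0 eq_sym.
  apply/eqP; rewrite /q horner_sum (bigD1 i)//= hornerZ LE divfK// big1 ?addr0// => k ki.
  by rewrite hornerZ Lz// mulr0.
- by rewrite map_inj_uniq ?enum_uniq.
rewrite size_codom card_ord (leq_trans (size_polyD _ _))// size_polyN geq_max sp /=.
rewrite (leq_trans (size_sum _ _ _))//; apply/bigmax_leqP => i _.
by rewrite (leq_trans (size_scale_leq _ _))// sL.
Qed.

(** Each of the terms of the divided difference is at most $h / g^n$. *)
Lemma lead_coef_le (n : nat) (p : {poly R}) (t : 'I_n.+1 -> R) (g h : R) :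
  (size p <= n.+1)%N -> 0 < g -> (forall i j, i != j -> g <= `|t i - t j|) ->
  (forall i, `|p.[t i]| <= h) -> `|p`_n| * g ^+ n <= h *+ n.+1.
Proof.
move=> sp g0 tg ph.
have tI : injective t.
  move=> i j ij; apply/eqP; apply/negPn/negP => /tg; rewrite ij subrr normr0.
  by rewrite leNgt g0.
rewrite (lead_coef_interpolation sp tI) -ler_pdivlMr ?exprn_gt0//.
apply: le_trans (ler_norm_sum _ _ _) _.
have -> : h *+ n.+1 / g ^+ n = \sum_(i < n.+1) h / g ^+ n.
  by rewrite sumr_const card_ord mulrnAl.
apply: ler_sum => i _; rewrite normrM normfV; apply: ler_pM; rewrite ?invr_ge0//.
have gn : g ^+ n = \prod_(j | j != i) g.
  by rewrite (prodr_const (predC1 i)) cardC1 card_ord.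
have pr : g ^+ n <= `|\prod_(j | j != i) (t i - t j)|.
  rewrite normr_prod gn; apply: ler_prod => j ji; rewrite (ltW g0) tg//.
  by rewrite eq_sym.
by rewrite lef_pV2 ?posrE ?exprn_gt0// (lt_le_trans _ pr)// exprn_gt0.
Qed.

End LeadingCoefficient.

(** * Zero sets of determinants *)

Section DetNull.
Variables (R : realType) (I : finType) (n : nat) (Phi : I -> 'M[R]_n) (v : I -> nat).

Definition lin_mx_comb (x : I -> R) : 'M[R]_n := \sum_i x i *: Phi i.
Let Mv := lin_mx_comb (fun i => (v i)%:R).
Hypothesis Mv_unit : Mv \in unitmx.
Let f (x : {ffun I -> R}) : R := \det (lin_mx_comb x).

(** Along the direction [v] the determinant is, up to the factor $\det M_v$, a
    characteristic polynomial. *)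
Lemma det_line (x : {ffun I -> R}) : exists p : {poly R},
  [/\ (size p <= n.+1)%N, p`_n = \det Mv
    & forall t, p.[t] = f [ffun i => x i + t * (v i)%:R]].
Proof.
pose A := - (invmx Mv *m lin_mx_comb x).
have szp : size (char_poly A) = n.+1 by exact: size_char_poly.
exists (\det Mv *: char_poly A); split.
- by rewrite (leq_trans (size_scale_leq _ _))// szp.
- rewrite coefZ; have /monicP := char_poly_monic A.
  by rewrite lead_coefE szp => ->; rewrite mulr1.
move=> t; rewrite hornerZ.
have -> : (char_poly A).[t] = \det (t%:M - A).
  rewrite -horner_evalE -det_map_mx /char_poly_mx map_mxB map_scalar_mx /=.
  rewrite horner_evalE hornerX; congr (\det (_ - _)).
  by apply/matrixP => i j; rewrite !mxE horner_evalE hornerC.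
rewrite -det_mulmx mulmxBr /A mulmxN opprK mulKVmx//; congr (\det _).
rewrite mul_mx_scalar /Mv /lin_mx_comb scaler_sumr -big_split; apply: eq_bigr => i _ /=.
by rewrite ffunE scalerA -scalerDl addrC.
Qed.

Lemma lipschitz_det : locally_lipschitz f.
Proof.
apply: locally_lipschitz_sum => s; apply: locally_lipschitzM.
  exact: locally_lipschitz_cst.
apply: locally_lipschitz_prod => i.
apply: (@locally_lipschitz_ext _ _ (fun x => \sum_j x j * Phi j i (s i))).
  by move=> x; rewrite /lin_mx_comb summxE; apply: eq_bigr => j _; rewrite mxE.
apply: locally_lipschitz_sum => j; apply: locally_lipschitzM.
  exact: locally_lipschitz_coord.
exact: locally_lipschitz_cst.
Qed.

(** Cut a cube into cells of side $1/M$ with $M = JQ$, and translate the cells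
    meeting the zero set by $(j/J)v$ for $j < J$.  No cell is covered more than
    [n] times: $n + 1$ nearly vanishing values of the polynomial of [det_line] at
    points $1/J$ apart would make its leading coefficient too small.  So the cells
    meeting the zero set have a total volume of order $n/J$. *)
Lemma det_zero_finite_cover (B : nat) (eps : R) : 0 < eps ->
  exists s, finite_cover (fun x => f x = 0 /\ forall i, `|x i| <= B%:R) eps s.
Proof.
move=> eps0.
pose V := (\max_i v i)%N.
have vV i : (v i <= V)%N by exact: leq_bigmax.
have [C C0 fC] := lipschitz_det (B%:R : R).
pose c := `|\det Mv|.
have c0 : 0 < c by rewrite normr_gt0 -unitfE -unitmxE.
pose L := (2 * B + V).+1.
(* [J] makes the final bound at most [eps]; [Q] makes the cells so small, compared
   with the distance 1/J of the translates, that [few] holds. *)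
pose J := (Num.truncn (n%:R * L%:R ^+ #|I| / eps)).+1.
have J0 : 0 < (J%:R : R) by rewrite ltr0n.
have Jeps : n%:R * L%:R ^+ #|I| / J%:R <= eps.
  by rewrite ler_pdivrMr// -ler_pdivrMl// mulrC ltW// truncnS_gt.
pose Q := (Num.truncn ((C *+ n.+1) * J%:R ^+ n / c)).+1.
have Q0 : 0 < (Q%:R : R) by rewrite ltr0n.
have Qc : (C *+ n.+1) * J%:R ^+ n < c * Q%:R.
  by rewrite -ltr_pdivrMl// mulrC truncnS_gt.
pose M := (J * Q)%N.
have M0 : 0 < (M%:R : R) by rewrite ltr0n muln_gt0.
pose K := (L * M)%N.
pose corner (k : {ffun I -> 'I_K}) : {ffun I -> R} := [ffun i => (k i)%:R / M%:R - B%:R].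
pose upper (k : {ffun I -> 'I_K}) : {ffun I -> R} := [ffun i => corner k i + M%:R^-1].
pose in_cell k x := forall i, corner k i <= x i <= upper k i.
pose badP (k : {ffun I -> 'I_K}) := (forall i, (k i <= 2 * B * M)%N) /\
  exists x, [/\ f x = 0, forall i, `|x i| <= B%:R & in_cell k x].
pose Bad := [set k | boolp.asbool (badP k)].
have BadP k : k \in Bad -> badP k by rewrite inE => /boolp.asboolP.
have shift_lt (j : 'I_J) (k : {ffun I -> 'I_K}) i :
    (minn (k i) (2 * B * M) + j * Q * v i < K)%N.
  have : (j * Q * v i <= M * V)%N by rewrite leq_mul ?vV// leq_mul// ltnW.
  have : (0 < M)%N by rewrite muln_gt0.
  have := geq_minr (k i) (2 * B * M); rewrite /K /L; nia.
pose shift (j : 'I_J) k : {ffun I -> 'I_K} := [ffun i => Ordinal (shift_lt j k i)].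
have shiftE j k i : k \in Bad -> (shift j k i : nat) = (k i + j * Q * v i)%N.
  by move=> /BadP[kB _]; rewrite ffunE /=; move/minn_idPl: (kB i) => ->.
have shift_inj j : {in Bad &, injective (shift j)}.
  move=> k k' kB kB' kk; apply/ffunP => i; apply: val_inj.
  have := congr1 (fun e : {ffun I -> 'I_K} => (e i : nat)) kk.
  by rewrite !shiftE//; move/addIn.
have few e : (#|[set j | e \in shift j @: Bad]| <= n)%N.
  rewrite leqNgt; apply/negP => many.
  pose jj (l : 'I_n.+1) : 'I_J := enum_val (widen_ord many l).
  have jj_inj l l' : l != l' -> jj l != jj l'.
    by apply: contra => /eqP /enum_val_inj /(congr1 val) /= ll; apply/eqP/val_inj.
  have jjB l : exists2 k, k \in Bad & e = shift (jj l) k.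
    by have := enum_valP (widen_ord many l); rewrite inE => /imsetP.
  have [p [sp pn pE]] := det_line (corner e).
  have small l : `|p.[- ((jj l)%:R / J%:R)]| <= C / M%:R.
    have [k kB eE] := jjB l; have [kle [x [fx xB xk]]] := BadP _ kB.
    rewrite pE.
    have -> : [ffun i => corner e i + - ((jj l)%:R / J%:R) * (v i)%:R] = corner k.
      apply/ffunP => i; rewrite !ffunE eE shiftE// natrD /M !natrM.
      by field; rewrite !gt_eqF.
    rewrite -[f (corner k)]subr0 -fx; apply: fC => // [i|i|]; last by rewrite invr_ge0 ltW.
      rewrite ler_norml; apply/andP; split.
        by rewrite ffunE lerDr divr_ge0// ltW.
      by have := xB i; rewrite ler_norml => /andP[_]; apply: le_trans; case/andP: (xk i).
    rewrite distrC ger0_norm; last by rewrite subr_ge0; case/andP: (xk i).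
    by rewrite lerBlDl; have /andP[_] := xk i; rewrite [upper k i]ffunE.
  have gap l l' : l != l' ->
      J%:R^-1 <= `|- ((jj l)%:R / J%:R) - - ((jj l')%:R / J%:R)| :> R.
    move=> /jj_inj ll; rewrite opprK addrC -mulrBl normrM normfV (ger0_norm (ltW J0)).
    rewrite -[leLHS]mul1r ler_pM2r ?invr_gt0//.
    have [lt|lt|/val_inj eq] := ltngtP (jj l) (jj l'); last by rewrite eq eqxx in ll.
      by rewrite -natrB 1?ltnW// normr_nat ler1n subn_gt0.
    by rewrite distrC -natrB 1?ltnW// normr_nat ler1n subn_gt0.
  have := lead_coef_le sp _ gap small; rewrite invr_gt0 => /(_ J0).
  rewrite pn -/c leNgt => /negP; apply.
  rewrite exprVn ltr_pdivlMr ?exprn_gt0// -mulrnAl mulrAC ltr_pdivrMr//.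
  apply: lt_le_trans Qc _; rewrite ler_pM2l// ler_nat /M.
  by rewrite leq_pmull.
exists [seq (corner k, upper k) | k <- enum Bad]; split.
- by move=> _ /mapP[k _ ->] i; rewrite /= [in leRHS]ffunE lerDl invr_ge0 ltW.
- move=> x [fx xB].
  have xM i : 0 <= (x i + B%:R) * M%:R.
    apply: mulr_ge0; last exact: ltW.
    by have := xB i; rewrite ler_norml => /andP[]; lra.
  have xk i : (Num.truncn ((x i + B%:R) * M%:R) <= 2 * B * M)%N.
    rewrite -(@ler_nat R); apply: (@le_trans _ _ ((x i + B%:R) * M%:R)); first by rewrite truncn_le.
    rewrite natrM ler_pM2r// natrM; have := xB i; rewrite ler_norml => /andP[]; lra.
  have xK i : (Num.truncn ((x i + B%:R) * M%:R) < K)%N.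
    apply: leq_ltn_trans (xk i) _; rewrite /K /L ltn_pmul2r; first by lia.
    by rewrite muln_gt0.
  pose k : {ffun I -> 'I_K} := [ffun i => Ordinal (xK i)].
  have xcell : in_cell k x.
    move=> i; rewrite !ffunE /=; have /andP[] := truncn_itv (xM i).
    set tr := Num.truncn _ => t1 t2; apply/andP; split.
      by rewrite lerBlDr ler_pdivrMr.
    by rewrite addrAC -[X in _ + X - _]mul1r -mulrDl lerBrDr ler_pdivlMr// natr1 ltW.
  exists (corner k, upper k) => //; apply/mapP; exists k => //; rewrite mem_enum inE.
  apply/boolp.asboolP; split=> [i|]; first by rewrite ffunE; exact: xk.
  by exists x.
rewrite big_map (eq_bigr (fun=> M%:R^-1 ^+ #|I|)) => [|k _]; last first.
  rewrite /box_volume -prodr_const; apply: eq_bigr => i _ /=.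
  by rewrite ffunE addrAC subrr add0r.
rewrite big_const_seq count_predT -cardE iter_addr_0.
have count : (J * #|Bad| <= n * K ^ #|I|)%N.
  have -> : (J * #|Bad| = \sum_(j < J) \sum_(e | e \in shift j @: Bad) 1)%N.
    rewrite -[X in (X * _)%N](card_ord J) -sum_nat_const; apply: eq_bigr => j _.
    by rewrite sum1_card card_in_imset.
  rewrite (exchange_big_dep xpredT)//=.
  apply: (@leq_trans (\sum_(e : {ffun I -> 'I_K}) n)); last first.
    by rewrite sum_nat_const card_ffun card_ord mulnC.
  apply: leq_sum => e _; apply: leq_trans (few e).
  by rewrite sum1_card; apply: eq_leq; apply: eq_card => j; rewrite inE.
have countR : J%:R * #|Bad|%:R <= n%:R * (L%:R * M%:R) ^+ #|I| :> R.
  by rewrite -!natrM -natrX -natrM ler_nat.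
apply: le_trans Jeps.
rewrite exprVn -(mulr_natl _ #|Bad|) ler_pdivrMr ?exprn_gt0// mulrAC ler_pdivlMr//.
by rewrite mulrC -mulrA -exprMn.
Qed.

End DetNull.

(** * Ranks of moment matrices *)

Section HankelRank.
Variables (R : realType) (m D : nat) (z : tms R m D).

Definition hankel (t : nat) : 'M[R]_#|{: monom_le m t}| :=
  \matrix_(i, j) pairing ('X_[bmnm (enum_val i)] * 'X_[bmnm (enum_val j)]) z.

Lemma deg_le_mon2 t (a b : monom_le m t) : deg_le (2 * t) ('X_[bmnm a] * 'X_[bmnm b] : {mpoly R[m]}).
Proof.
by rewrite mul2n -addnn; apply: deg_leM; apply: deg_le_mon; rewrite -ltnS bmdeg.
Qed.

Lemma mom_rankE t : mom_rank t z = \rank (hankel t).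
Proof.
rewrite /mom_rank /mom_mx /loc_mx half_deg1 subn0; congr (\rank _).
apply/matrixP => i j; rewrite !mxE mul1r pairing_trunc//.
exact: deg_le_mon2.
Qed.

Definition hankel_row (t : nat) (a : 'X_{1..m}) : 'rV[R]_#|{: monom_le m t}| :=
  \row_j pairing ('X_[a] * 'X_[bmnm (enum_val j)]) z.

Lemma mom_rank_mono s t : (s <= t)%N -> (mom_rank s z <= mom_rank t z)%N.
Proof.
move=> st; rewrite !mom_rankE.
have lt_t (a : monom_le m s) : (mdeg (bmnm a) < t.+1)%N.
  by apply: leq_trans (bmdeg a) _; rewrite ltnS.
pose g (i : 'I_#|{: monom_le m s}|) := enum_rank (BMultinom (lt_t (enum_val i))).
have -> : hankel s = rowsub g (colsub g (hankel t)).
  by apply/matrixP => i j; rewrite !mxE /g !enum_rankK.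
apply: leq_trans (mxrankS (rowsub_sub g _)) _.
rewrite -mxrank_tr trmx_mxsub; apply: leq_trans (mxrankS (rowsub_sub g _)) _.
by rewrite mxrank_tr.
Qed.

Lemma univ_coefs (i : 'I_m) (r : {poly R}) :
  univ i r = \sum_(s < size r) r`_s *: 'X_[U_(i) *+ s].
Proof.
rewrite -[r in LHS]coefK poly_def univ_comb.
by apply: eq_bigr => s _; rewrite mpolyXn.
Qed.

(** A monomial of degree above the sum of the degrees of the univariate polynomials
    is divisible by one of their leading monomials, so its row is a combination of
    rows of lower degree.  The bound does not depend on [T]. *)
Lemma mom_rank_le (T : nat) (r : 'I_m -> {poly R}) :
  (forall i, r i != 0) ->
  (forall i h, deg_le (2 * T) h -> pairing (univ i (r i) * h) z = 0) ->
  (mom_rank T z <= #|{: monom_le m (\sum_i (size (r i)).-1)}|)%N.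
Proof.
move=> r0 rz; set E := (\sum_i _)%N; rewrite mom_rankE.
pose W := \matrix_(i < #|{: monom_le m E}|) hankel_row T (bmnm (enum_val i)).
suff rowW (a : 'X_{1..m}) : (mdeg a <= T)%N -> (hankel_row T a <= W)%MS.
  apply: leq_trans (rank_leq_row W); apply: mxrankS; apply/row_subP => i.
  have -> : row i (hankel T) = hankel_row T (bmnm (enum_val i)).
    by apply/rowP => j; rewrite !mxE.
  by apply: rowW; rewrite -ltnS bmdeg.
have [n] := ubnP (mdeg a); elim: n a => // n IH a an aT.
have [aE|Ea] := leqP (mdeg a) E.
  have aE' : (mdeg a < E.+1)%N by rewrite ltnS.
  have -> : hankel_row T a = row (enum_rank (BMultinom aE')) W.
    by rewrite rowK enum_rankK.
  exact: row_sub.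
have /existsP[i ei] : [exists i, ((size (r i)).-1 <= a i)%N].
  apply: contraTT Ea; rewrite negb_exists => /forallP ai.
  rewrite -leqNgt mdegE; apply: leq_sum => i _; apply: ltnW.
  by rewrite ltnNge ai.
set e := (size (r i)).-1 in ei.
have se : size (r i) = e.+1 by rewrite /e prednK// lt0n size_poly_eq0 r0.
have lead : (r i)`_e != 0 by rewrite -[e]/(size (r i)).-1 -lead_coefE lead_coef_eq0.
pose b := (a - U_(i) *+ e)%MM.
have le : (U_(i) *+ e <= a)%MM.
  apply/mnm_lepP => j; rewrite mulmnE mnm1E; case: eqP => [<-|_]; last by rewrite mul0n.
  by rewrite mul1n.
have aE : a = (b + U_(i) *+ e)%MM by rewrite submK.
have bT : (mdeg b + e <= T)%N by move: aT; rewrite aE mdegD mdegMn mdeg1 mul1n.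
have rel : \sum_(s < e.+1) (r i)`_s *: hankel_row T (b + U_(i) *+ s)%MM = 0.
  apply/rowP => j; rewrite summxE mxE.
  have dh : deg_le (2 * T) ('X_[b] * 'X_[bmnm (enum_val j)] : {mpoly R[m]}).
    rewrite mul2n -addnn; apply: deg_leM; apply: deg_le_mon.
      by rewrite (leq_trans _ bT)// leq_addr.
    by rewrite -ltnS bmdeg.
  apply: etrans (rz i _ dh).
  rewrite univ_coefs se mulr_suml pairing_sum; apply: eq_bigr => s _.
  by rewrite !mxE -scalerAl pairingZ addmC mpolyXD mulrA.
have := rel; rewrite big_ord_recr /= -aE => /eqP.
rewrite addrC addr_eq0 => /eqP aW.
have : ((r i)`_e *: hankel_row T a <= W)%MS.
  rewrite aW -scaleN1r; apply: scalemx_sub; apply: summx_sub => s _.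
  apply: scalemx_sub; apply: IH.
    apply: (@leq_trans (mdeg a)); last by rewrite -ltnS.
    by rewrite [in X in (_ < X)%N]aE !mdegD !mdegMn mdeg1 !mul1n ltn_add2l.
  by apply: leq_trans bT; rewrite mdegD mdegMn mdeg1 mul1n leq_add2l ltnW.
by rewrite (eqmx_scale _ lead).
Qed.

End HankelRank.

(** A sequence that increases at each of the steps from [t0] to [T] exceeds
    $T - t_0$. *)
Lemma stationary_exists (f : nat -> nat) (t0 T C : nat) :
  (forall t, f t.-1 <= f t)%N -> (f T <= C)%N -> (t0 + C <= T)%N ->
  exists2 t, (t0 <= t <= T)%N & f t = f t.-1.
Proof.
move=> fm fT tT.
case: (boolP [exists t : 'I_T.+1, (t0 <= t)%N && (f t == f t.-1)]) => [/existsP[t]|].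
  by move=> /andP[t0t /eqP ft]; exists t => //; rewrite t0t -ltnS ltn_ord.
rewrite negb_exists => /forallP incr.
suff big s : (t0 + s <= T)%N -> (s < f (t0 + s))%N.
  have := big (T - t0)%N; rewrite subnKC; last by apply: leq_trans tT; rewrite leq_addr.
  move=> /(_ (leqnn _)); lia.
have step t : (t0 <= t <= T)%N -> (f t.-1 < f t)%N.
  move=> /andP[t0t tT']; have tT1 : (t < T.+1)%N by rewrite ltnS.
  have := incr (Ordinal tT1); rewrite t0t /= eq_sym => ne.
  by rewrite ltn_neqAle ne fm.
elim: s => [|s IH] sT.
  rewrite addn0; apply: leq_ltn_trans (leq0n _) (step _ _).
  by rewrite leqnn -[t0]addn0.
have := step (t0 + s.+1)%N; rewrite sT leq_addr => /(_ isT).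
by rewrite addnS /=; apply: leq_ltn_trans; apply: IH; rewrite ltnW// -addnS.
Qed.

(** * Gram factorizations *)

Section Gram.
Variable R : rcfType.

(** Cholesky factorization: eliminate the first row and column, and factor the
    Schur complement. *)
Lemma posdef_gram (n : nat) (S : 'M[R]_n) : S^T = S ->
  (forall u : 'cV[R]_n, u != 0 -> 0 < (u^T *m S *m u) 0 0) ->
  exists K : 'M[R]_n, S = K *m K^T.
Proof.
elim: n S => [|n IH] S symS posS; first by exists 0; rewrite [S]flatmx0 [RHS]flatmx0.
rewrite -[n.+1]/(1 + n)%N in S symS posS *.
pose a := ulsubmx S 0 0; pose b := dlsubmx S; pose T := drsubmx S.
have SE : S = block_mx a%:M b^T b T.
  by rewrite -[LHS]submxK {1}(mx11_scalar (ulsubmx S)) /b trmx_dlsub symS.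
have symT : T^T = T by rewrite /T trmx_drsub symS.
have quad (x : R) (y : 'cV[R]_n) :
    ((col_mx x%:M y)^T *m S *m col_mx x%:M y) 0 0
    = x ^+ 2 * a + 2 * x * (b^T *m y) 0 0 + (y^T *m T *m y) 0 0.
  have addE (X Y : 'M[R]_1) : (X + Y) 0 0 = X 0 0 + Y 0 0 by rewrite mxE.
  have scaleE c (X : 'M[R]_1) : (c *: X) 0 0 = c * X 0 0 by rewrite mxE.
  have trE (X : 'M[R]_1) : X 0 0 = X^T 0 0 by rewrite mxE.
  rewrite SE tr_col_mx tr_scalar_mx mul_row_block mul_row_col !mulmxDl.
  rewrite !mul_mx_scalar !mul_scalar_mx -!scalemxAl !addE !scaleE.
  have -> : (y^T *m b) 0 0 = (b^T *m y) 0 0 by rewrite trE trmx_mul trmxK.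
  by rewrite [x%:M 0 0]mxE eqxx mulr1n; ring.
have a0 : 0 < a.
  have := posS (col_mx 1%:M 0); rewrite quad mulmx0 mxE !mulmx0 !mxE expr1n mul1r !mulr0 !addr0.
  apply; apply/eqP => /(congr1 (fun u : 'cV_(1 + n) => u (lshift n 0) 0)).
  by rewrite col_mxEu !mxE eqxx => /eqP; rewrite oner_eq0.
pose S' := T - a^-1 *: (b *m b^T).
have symS' : S'^T = S' by rewrite /S' linearB linearZ /= symT trmx_mul trmxK.
have [u u0|K KE] := IH S' symS'.
  pose x := - a^-1 * (b^T *m u) 0 0.
  have /posS : col_mx x%:M u != 0.
    apply: contraNneq u0 => /(congr1 dsubmx); rewrite col_mxKd => ->.
    by rewrite linear0.
  rewrite quad; congr (0 < _).
  have bb : (u^T *m (b *m b^T) *m u) 0 0 = (b^T *m u) 0 0 ^+ 2.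
    rewrite mulmxA -[u^T *m b](trmxK) trmx_mul trmxK -mulmxA.
    by rewrite [X in (X^T *m _) 0 0]mx11_scalar [X in (_ *m X) 0 0]mx11_scalar
       tr_scalar_mx mul_scalar_mx !mxE eqxx !mulr1n expr2.
  rewrite /S' mulmxBr mulmxBl -scalemxAr -scalemxAl.
  rewrite [RHS]mxE [X in _ = _ + X]mxE [X in _ = _ - X]mxE bb /x.
  by field; rewrite gt_eqF.
pose s := Num.sqrt a; have s0 : s != 0 by rewrite gt_eqF// sqrtr_gt0.
have ss : s * s = a by rewrite -expr2 sqr_sqrtr// ltW.
exists (block_mx s%:M 0 (s^-1 *: b) K).
rewrite tr_block_mx mulmx_block !tr_scalar_mx !trmx0 !mulmx0 !mul0mx !addr0 SE.
have trZ : (s^-1 *: b)^T = s^-1 *: b^T by apply/matrixP => i j; rewrite !mxE.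
rewrite trZ; congr block_mx.
- by rewrite -scalar_mxM ss.
- by rewrite mul_scalar_mx scalerA mulfV// scale1r.
- by rewrite mul_mx_scalar scalerA mulfV// scale1r.
by rewrite -KE /S' -scalemxAl -scalemxAr scalerA -invfM ss subrKC.
Qed.

(** Cauchy-Schwarz: an isotropic vector of a positive semidefinite form is in
    its kernel. *)
Lemma psd_null (N : nat) (M : 'M[R]_N) (u : 'cV[R]_N) : M^T = M ->
  (forall u : 'cV[R]_N, 0 <= (u^T *m M *m u) 0 0) ->
  (u^T *m M *m u) 0 0 = 0 -> M *m u = 0.
Proof.
move=> symM pos u0; pose w := M *m u.
have addE (X Y : 'M[R]_1) : (X + Y) 0 0 = X 0 0 + Y 0 0 by rewrite mxE.
have scaleE c (X : 'M[R]_1) : (c *: X) 0 0 = c * X 0 0 by rewrite mxE.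
have trE (X : 'M[R]_1) : X 0 0 = X^T 0 0 by rewrite mxE.
pose q := (w^T *m w) 0 0; pose e := (w^T *m M *m w) 0 0.
have q_sum : q = \sum_i w i 0 ^+ 2.
  by rewrite /q mxE; apply: eq_bigr => i _; rewrite mxE expr2.
have quad t : 0 <= t ^+ 2 * e + 2 * t * q.
  have trD : (t *: w + u)^T = t *: w^T + u^T by apply/matrixP => i j; rewrite !mxE.
  have := pos (t *: w + u); congr (_ <= _).
  rewrite trD !mulmxDl !mulmxDr -!scalemxAl -!scalemxAr !addE !scaleE u0.
  have -> : (w^T *m M *m u) 0 0 = q by rewrite -mulmxA.
  have -> : (u^T *m M *m w) 0 0 = q by rewrite trE (trmx_mul (u^T *m M) w) (trmx_mul u^T M) trmxK symM.
  by rewrite -/e; ring.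
have q0 : q = 0.
  have q_ge0 : 0 <= q by rewrite q_sum sumr_ge0// => i _; exact: sqr_ge0.
  have e_ge0 : 0 <= e := pos w.
  apply/eqP; rewrite eq_le q_ge0 andbT leNgt; apply/negP => q_gt0.
  have := quad (- q / (1 + e)); have e1 : 0 < 1 + e by lra.
  have -> : (- q / (1 + e)) ^+ 2 * e + 2 * (- q / (1 + e)) * q
      = - (q ^+ 2 * (2 + e) / (1 + e) ^+ 2) by field; rewrite gt_eqF.
  rewrite oppr_ge0 leNgt => /negP; apply.
  by rewrite divr_gt0 ?exprn_gt0// mulr_gt0 ?exprn_gt0//; lra.
apply/matrixP => i j; rewrite (ord1 j) [RHS]mxE -/w; apply/eqP.
rewrite -sqrf_eq0; apply/eqP; move: q0; rewrite q_sum => /psumr_eq0P; apply => // k _.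
exact: sqr_ge0.
Qed.

(** The form descends to the row space, where it is positive definite; hence the
    inner dimension can be the rank. *)
Lemma psd_gram (N : nat) (M : 'M[R]_N) : M^T = M ->
  (forall u : 'cV[R]_N, 0 <= (u^T *m M *m u) 0 0) ->
  exists Phi : 'M[R]_(N, \rank M), M = Phi *m Phi^T.
Proof.
move=> symM pos.
have [E [/row_freeP[Z EZ] CE]] : exists E : 'M_(\rank M, N),
    row_free E /\ col_base M *m E = M.
  by exists (row_base M); rewrite row_base_free mulmx_base.
pose S := Z^T *m M *m Z.
have MZ : M *m Z = col_base M.
  apply: etrans (congr1 (fun X : 'M[R]_N => X *m Z) (esym CE)) _.
  by rewrite -mulmxA EZ mulmx1.
have symS : S^T = S by rewrite /S !trmx_mul trmxK symM mulmxA.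
have MZE : M *m Z *m E = M by rewrite MZ CE.
have EZM : E^T *m Z^T *m M = M.
  apply: etrans (congr1 (fun X : 'M[R]_N => E^T *m Z^T *m X) (esym symM)) _.
  by rewrite -!trmx_mul mulmxA; exact: (etrans (congr1 trmx MZE) symM).
have ME : M = E^T *m S *m E by rewrite /S !mulmxA EZM MZE.
have Su : S \in unitmx.
  rewrite -row_full_unit -col_leq_rank.
  have : (\rank (E^T *m S *m E) <= \rank S)%N.
    by rewrite (leq_trans (mxrankM_maxl _ _))// mxrankM_maxr.
  by rewrite (congr1 mxrank (esym ME)).
have [u u0|K SK] := @posdef_gram _ S symS.
  have Zu : (u^T *m S *m u) 0 0 = ((Z *m u)^T *m M *m (Z *m u)) 0 0.
    by rewrite /S trmx_mul !mulmxA.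
  rewrite lt0r Zu pos andbT; apply: contraNneq u0 => /(psd_null symM pos) MZu.
  have : Z^T *m (M *m (Z *m u)) = 0 by rewrite MZu mulmx0.
  by rewrite !mulmxA -/S => /(congr1 (mulmx (invmx S))); rewrite mulKmx// mulmx0 => ->.
exists (E^T *m K); rewrite trmx_mul trmxK mulmxA -(mulmxA _ K) -SK.
exact: ME.
Qed.

End Gram.

(** * Flat extension *)

Section FlatExtension.
Variables (R : realType) (m D : nat) (z : tms R m D) (t : nat).
Hypothesis t_gt0 : (0 < t)%N.
Hypothesis z_pos : forall p : {mpoly R[m]}, deg_le t p -> 0 <= pairing (p ^+ 2) z.
Hypothesis flat : mom_rank t z = mom_rank t.-1 z.
Implicit Types (a b c : 'X_{1..m}) (p : {mpoly R[m]}).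

Local Notation M := (hankel z t).
Local Notation r := (\rank M).

Lemma hankel_sym s : (hankel z s)^T = hankel z s.
Proof. by apply/matrixP => i j; rewrite !mxE mulrC. Qed.

Lemma hankel_quad s (u : 'cV[R]_#|{: monom_le m s}|)
    (p := \sum_(a : monom_le m s) u (enum_rank a) 0 *: 'X_[R, bmnm a]) :
  (u^T *m hankel z s *m u) 0 0 = pairing (p ^+ 2) z.
Proof.
have sumE (f : 'I_#|{: monom_le m s}| -> R) :
    \sum_i f i = \sum_(a : monom_le m s) f (enum_rank a).
  rewrite (reindex_onto enum_rank enum_val) => [|j _]; last by rewrite enum_valK.
  by apply: eq_bigl => a; rewrite enum_rankK eqxx.
rewrite expr2 /p mulr_suml pairing_sum mxE sumE.
under eq_bigr do rewrite mxE sumE mulr_suml.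
rewrite exchange_big; apply: eq_bigr => a _ /=.
rewrite mulr_sumr pairing_sum; apply: eq_bigr => b _.
rewrite !mxE !enum_rankK -scalerAl -scalerAr !pairingZ.
by rewrite -mulrA [X in _ * X]mulrC.
Qed.

Lemma hankel_pos (u : 'cV[R]_#|{: monom_le m t}|) : 0 <= (u^T *m M *m u) 0 0.
Proof. by rewrite hankel_quad; apply: z_pos; exact: poly_of_coefs_deg_le. Qed.

(** The Hankel matrix is the Gram matrix of vectors [g a] indexed by monomials.  By
    flatness the vectors of degree less than [t] already span. *)
Lemma hankel_gram : exists g : 'X_{1..m} -> 'rV[R]_r,
  (forall a b, (mdeg a <= t)%N -> (mdeg b <= t)%N ->
     pairing 'X_[a + b] z = (g a *m (g b)^T) 0 0) /\
  row_full (\matrix_(j < #|{: monom_le m t.-1}|) g (bmnm (enum_val j))).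
Proof.
have [Phi PhiE] := psd_gram (hankel_sym t) hankel_pos.
pose g a : 'rV[R]_r :=
  if insub a is Some b then row (enum_rank (b : monom_le m t)) Phi else 0.
have gE a (at_ : (mdeg a < t.+1)%N) : g a = row (enum_rank (BMultinom at_)) Phi.
  by rewrite /g insubT.
have g_mul a b : (mdeg a <= t)%N -> (mdeg b <= t)%N ->
     pairing 'X_[a + b] z = (g a *m (g b)^T) 0 0.
  move=> at_ bt; rewrite mpolyXD.
  have := congr1 (fun X : 'M[R]_#|{: monom_le m t}| =>
    X (enum_rank (BMultinom (at_ : mdeg a < t.+1)%N))
      (enum_rank (BMultinom (bt : mdeg b < t.+1)%N))) PhiE.
  rewrite mxE !enum_rankK /= => ->; rewrite !gE !mxE.
  by apply: eq_bigr => j _; rewrite !mxE.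
exists g; split=> //; set Phi' := \matrix_j _.
have tt : (t.-1 <= t)%N := leq_pred t.
have le_t (a : monom_le m t.-1) : (mdeg (bmnm a) <= t)%N.
  by apply: leq_trans tt; rewrite -ltnS bmdeg.
have M'E : hankel z t.-1 = Phi' *m Phi'^T.
  apply/matrixP => i j; rewrite mxE -mpolyXD g_mul//.
  by rewrite !mxE; apply: eq_bigr => l _; rewrite !mxE.
rewrite -col_leq_rank; have := flat; rewrite !mom_rankE => {1}->.
by rewrite M'E mxrankM_maxl.
Qed.

(** Flat extension (Curto and Fialkow).  Since the monomials of degree at
    most [t - 1] span, multiplication by a coordinate acts on the span of the vectors
    [g a]; these operators are symmetric and commute, so they are simultaneously
    diagonalizable.  The joint eigenvalues are the atoms. *)
Lemma flat_atomic : exists (lam : 'I_(mom_rank t z) -> R)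
    (v : 'I_(mom_rank t z) -> 'rV[R]_m),
  atomic_repr lam v (trunc (2 * t) z).
Proof.
rewrite mom_rankE.
have [g [gg full]] := hankel_gram.
set N' := #|{: monom_le m t.-1}| in full; pose ev (j : 'I_N') := bmnm (enum_val j).
pose Phi := \matrix_(j < N') g (ev j); rewrite -/Phi in full.
have ev_lt j : (mdeg (ev j) < t)%N.
  by apply: leq_trans (bmdeg (enum_val j)) _; rewrite prednK.
have [Y YPhi] := row_fullP full.
have cancelR (n : nat) (A B : 'M[R]_(n, r)) : A *m Phi^T = B *m Phi^T -> A = B.
  move=> /(congr1 (mulmx^~ Y^T)); rewrite -!mulmxA -trmx_mul YPhi trmx1.
  by rewrite !mulmx1.
pose Psi (i : 'I_m) := \matrix_(j < N') g (ev j + U_(i))%MM.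
have Psi_sym i : Psi i *m Phi^T = Phi *m (Psi i)^T.
  apply/matrixP => j l; transitivity (pairing 'X_[ev j + U_(i) + ev l] z).
    rewrite gg; last exact: ltnW.
      by rewrite !mxE; apply: eq_bigr => s _; rewrite !mxE.
    by rewrite mdegD mdeg1 addn1.
  rewrite -addmA [(U_(i) + _)%MM]addmC gg; first last.
  - by rewrite mdegD mdeg1 addn1.
  - exact: ltnW.
  by rewrite !mxE; apply: eq_bigr => s _; rewrite !mxE.
pose X i := Y *m Psi i.
have PhiX i : Phi *m X i = Psi i.
  by apply: cancelR; rewrite /X -!mulmxA Psi_sym (mulmxA Y) YPhi mul1mx.
have X_sym i : (X i)^T = X i.
  have YT : Phi^T *m Y^T = 1%:M by rewrite -trmx_mul YPhi trmx1.
  rewrite /X trmx_mul -[LHS]mul1mx -YPhi -mulmxA (mulmxA Phi) -Psi_sym.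
  by rewrite -!mulmxA YT mulmx1.
have X_comm i j : X i *m X j = X j *m X i.
  have PX (i' j' : 'I_m) : Phi *m (X i' *m X j') *m Phi^T = Psi i' *m (Psi j')^T.
    rewrite mulmxA PhiX -mulmxA; congr (_ *m _).
    by rewrite -[X j' in LHS]X_sym -trmx_mul PhiX.
  have : Phi *m (X i *m X j) = Phi *m (X j *m X i).
    apply: cancelR; rewrite !PX.
    apply/matrixP => k l; transitivity (pairing 'X_[ev k + U_(i) + (ev l + U_(j))] z).
      rewrite gg; [|by rewrite mdegD mdeg1 addn1..].
      by rewrite !mxE; apply: eq_bigr => s _; rewrite !mxE.
    have -> : (ev k + U_(i) + (ev l + U_(j)) = ev k + U_(j) + (ev l + U_(i)))%MM.
      by apply/mnmP => x; rewrite !mnmDE; lia.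
    rewrite gg; [|by rewrite mdegD mdeg1 addn1..].
    by rewrite !mxE; apply: eq_bigr => s _; rewrite !mxE.
  by move=> /(congr1 (mulmx Y)); rewrite !mulmxA YPhi !mul1mx.
have [P Pu /allP diagX] : codiagonalizable [seq X i | i <- enum 'I_m].
  apply/codiagonalizableP; split.
    by move=> _ _ /mapP[i _ ->] /mapP[j _ ->]; exact: X_comm.
  by move=> _ /mapP[i _ ->]; exact: RealSpectral.symmetric_diagonalizable.
have [e eE] : exists e : 'I_m -> 'rV[R]_r, forall i, P *m X i = diag_mx (e i) *m P.
  apply: (@fin_all_exists _ _ (fun i ei => P *m X i = diag_mx ei *m P)) => i.
  have /diagX/diagonalizable_forPex[ei eiE] : X i \in [seq X i | i <- enum 'I_m].
    by apply: map_f; rewrite mem_enum.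
  by exists ei; apply/simmxP.
pose u (s : 'I_r) : 'rV[R]_m := \row_i e i 0 s.
pose mon a s := \prod_i u s 0 i ^+ a i.
pose al := g 0%MM *m invmx P; pose be := P *m (g 0%MM)^T.
have gS a i : (mdeg a < t)%N -> g (a + U_(i))%MM = g a *m X i.
  move=> at_; have at' : (mdeg a < t.-1.+1)%N by rewrite prednK.
  have := congr1 (row (enum_rank (BMultinom at'))) (PhiX i).
  by rewrite row_mul !rowK /ev enum_rankK.
have monS a i s : mon (a + U_(i))%MM s = mon a s * e i 0 s.
  rewrite /mon; under eq_bigr do rewrite mnmDE exprD.
  rewrite big_split; congr (_ * _); rewrite (bigD1 i)//= mnm1E eqxx expr1 mxE.
  by rewrite big1 ?mulr1// => j /negbTE ji; rewrite mnm1E eq_sym ji.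
have mon0 s : mon 0%MM s = 1.
  by rewrite /mon big1// => i _; rewrite mnm0E.
have g_eigen a : (mdeg a <= t)%N -> forall s,
    (g a *m invmx P) 0 s = al 0 s * mon a s /\ (P *m (g a)^T) s 0 = be s 0 * mon a s.
  have [n] := ubnP (mdeg a); elim: n a => // n IH a an at_ s.
  have [a0|a0] := posnP (mdeg a).
    by move/eqP: a0; rewrite mdeg_eq0 => /eqP ->; rewrite mon0 !mulr1.
  have [b [c [aE db dc]]] := @mnm_split m a (mdeg a).-1 (leq_pred _).
  have /mdeg1P[i /eqP cE] : mdeg c == 1%N by rewrite dc; move: a0; clear; lia.
  have bt : (mdeg b < t)%N by rewrite db prednK.
  have [|IHg IHg'] := IH b _ (ltnW bt) s; first by rewrite db prednK.
  rewrite aE cE gS// monS; split.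
    have XE : X i *m invmx P = invmx P *m diag_mx (e i).
      by rewrite -[LHS](mulKmx Pu) (mulmxA P) eE mulmxK.
    by rewrite -mulmxA XE mulmxA mul_mx_diag mxE IHg mulrA.
  rewrite trmx_mul X_sym mulmxA eE -mulmxA mul_diag_mx mxE IHg'; ring.
(* In the joint eigenbasis [Phi] and its transpose are weighted Vandermonde matrices
   of full rank; this makes the weights nonzero and the atoms distinct. *)
pose V := Phi *m invmx P; pose V' := P *m Phi^T.
have V_full : row_full V.
  by rewrite -col_leq_rank mxrankMfree ?row_free_unit ?unitmx_inv// col_leq_rank.
have VE j s : V j s = al 0 s * mon (ev j) s.
  have [<- _] := g_eigen (ev j) (ltnW (ev_lt j)) s.
  by rewrite !mxE; apply: eq_bigr => l _; rewrite !mxE.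
have V'E j s : V' s j = be s 0 * mon (ev j) s.
  have [_ <-] := g_eigen (ev j) (ltnW (ev_lt j)) s.
  by rewrite !mxE; apply: eq_bigr => l _; rewrite !mxE.
have [W WV] := row_fullP V_full.
have WV1 s s' : \sum_j W s j * V j s' = (s == s')%:R.
  by have := congr1 (fun A : 'M[R]_r => A s s') WV; rewrite !mxE.
have al_neq0 s : al 0 s != 0.
  apply/eqP => al0; have := WV1 s s; rewrite big1 ?eqxx; last first.
    by move=> j _; rewrite VE al0 mul0r mulr0.
  by move/eqP; rewrite eq_sym oner_eq0.
have be_neq0 s : be s 0 != 0.
  apply/eqP => be0; have V'W : V' *m (Y^T *m invmx P) = 1%:M.
    have PhiY : Phi^T *m Y^T = 1%:M by rewrite -trmx_mul YPhi trmx1.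
    by rewrite mulmxA /V' -[P *m _ *m _]mulmxA PhiY mulmx1 mulmxV.
  have := congr1 (fun A : 'M[R]_r => A s s) V'W; rewrite mxE big1 => [|j _]; last first.
    by rewrite V'E be0 !mul0r.
  by rewrite mxE eqxx => /eqP; rewrite eq_sym oner_eq0.
have momE (c : 'X_{1..m}) : (mdeg c <= 2 * t)%N ->
    pairing 'X_[c] z = \sum_s al 0 s * be s 0 * mon c s.
  move=> ct; have [a [b [cE da db]]] := @mnm_split m c (minn t (mdeg c)) (geq_minr _ _).
  have at_ : (mdeg a <= t)%N by rewrite da geq_minl.
  have bt : (mdeg b <= t)%N by rewrite db; lia.
  rewrite {}cE.
  rewrite gg// -(mulmxKV Pu (g a)) -(mulmxA _ P) mxE; apply: eq_bigr => s _.
  have [-> _] := g_eigen a at_ s; have [_ ->] := g_eigen b bt s.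
  have -> : mon (a + b)%MM s = mon a s * mon b s.
    by rewrite /mon -big_split; apply: eq_bigr => i _; rewrite mnmDE exprD.
  by ring.
have lagrange s : exists p : {mpoly R[m]}, deg_le t.-1 p /\
    forall s', p.@[u s' 0] = (s == s')%:R / al 0 s.
  exists (\sum_(a : monom_le m t.-1) W s (enum_rank a) *: 'X_[bmnm a]).
  split=> [|s']; first exact: poly_of_coefs_deg_le.
  have -> : (s == s')%:R / al 0 s = (s == s')%:R / al 0 s'.
    by case: eqP => [->|]; rewrite ?mul0r.
  rewrite -WV1 mulr_suml meval_sum.
  rewrite [RHS](reindex_onto enum_rank enum_val) => [|j _]; last by rewrite enum_valK.
  rewrite [RHS](eq_bigl xpredT) => [|a]; last by rewrite enum_rankK eqxx.
  apply: eq_bigr => a _; rewrite mevalZ mevalX VE /ev enum_rankK /mon.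
  by field; exact: al_neq0.
have evalE p : deg_le (2 * t) p -> pairing p z = \sum_s al 0 s * be s 0 * p.@[u s 0].
  move=> dp; rewrite [p in LHS](mpoly_monom_sum dp) pairing_sum.
  have -> : \sum_s al 0 s * be s 0 * p.@[u s 0] =
      \sum_s \sum_(a : monom_le m (2 * t)) p@_(bmnm a) * (al 0 s * be s 0 * mon (bmnm a) s).
    apply: eq_bigr => s _; rewrite [p in LHS](mpoly_monom_sum dp) meval_sum mulr_sumr.
    by apply: eq_bigr => a _; rewrite mevalZ mevalX mulrCA.
  rewrite [RHS]exchange_big /=; apply: eq_bigr => a _; rewrite pairingZ momE.
    by rewrite mulr_sumr.
  by rewrite -ltnS bmdeg.
exists (fun s => al 0 s * be s 0), u; split=> [s|s s' uu|a].
- rewrite lt0r mulf_neq0//=; have [p [dp pE]] := lagrange s.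
  have dt : deg_le t p by apply: deg_leW dp; exact: leq_pred.
  have := z_pos dt; rewrite evalE; last exact: deg_le_sqr.
  rewrite (bigD1 s)//= big1 ?addr0 => [|s' s's]; last first.
    by rewrite rmorphXn /= pE eq_sym (negbTE s's) mul0r expr0n mulr0.
  by rewrite rmorphXn /= pE eqxx pmulr_lge0// exprn_even_gt0//= mul1r invr_neq0.
- have [p [_ pE]] := lagrange s.
  have := pE s; rewrite uu pE eqxx; case: eqP => // _ /eqP.
  by rewrite mul0r eq_sym mul1r invr_eq0 (negbTE (al_neq0 s)).
have da : (mdeg (bmnm a) <= 2 * t)%N by rewrite -ltnS bmdeg.
rewrite -pairing_mon pairing_trunc; last exact: deg_le_mon.
by rewrite momE//; apply: eq_bigr => s _; rewrite mevalX.
Qed.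

End FlatExtension.

(** * Atoms, moments and tensors *)

Section AtomsInSimplex.
Variables (R : realType) (m k : nat) (z : tms R m (2 * k)) (t : nat).

(** Flatness makes the evaluations at the atoms independent already in degree
    [t - 1], so each atom is isolated by a polynomial [p] of that degree, and
    testing $q p^2$ gives the sign of the constraint [q] at the atom. *)
Lemma flat_atoms_in_simplex (lam : 'I_(mom_rank t z) -> R)
    (v : 'I_(mom_rank t z) -> 'rV[R]_m) :
  moment_cone z -> (0 < t <= k)%N -> mom_rank t z = mom_rank t.-1 z ->
  atomic_repr lam v (trunc (2 * t) z) -> forall s, in_simplex (v s).
Proof.
move=> cz /andP[t0 tk] flat [lam0 _ zE].
set r := mom_rank t z in lam v lam0 zE *.
have evalE (p : {mpoly R[m]}) : deg_le (2 * t) p ->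
    pairing p z = \sum_s lam s * p.@[v s 0].
  move=> dp; rewrite -(pairing_trunc z dp) /pairing.
  have -> : \sum_s lam s * p.@[v s 0] =
      \sum_s \sum_(a : monom_le m (2 * t)) p@_(bmnm a) * (lam s * 'X_[bmnm a].@[v s 0]).
    apply: eq_bigr => s _; rewrite [p in LHS](mpoly_monom_sum dp) meval_sum mulr_sumr.
    by apply: eq_bigr => a _; rewrite mevalZ mulrCA.
  rewrite [RHS]exchange_big /=; apply: eq_bigr => a _; rewrite zE mulr_sumr.
  by apply: eq_bigr => s _.
pose E : 'M[R]_(r, #|{: monom_le m t.-1}|) :=
  \matrix_(s, j) ('X_[bmnm (enum_val j)] : {mpoly R[m]}).@[v s 0].
have HE : hankel z t.-1 = E^T *m (diag_mx (\row_s lam s) *m E).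
  apply/matrixP => i j; rewrite mul_diag_mx !mxE evalE; last first.
    by apply: deg_leW (deg_le_mon2 _ _ _); rewrite leq_mul2l leq_pred orbT.
  by apply: eq_bigr => s _; rewrite !mxE mevalM; ring.
have E_free : row_free E.
  rewrite -row_leq_rank -[X in (X <= _)%N]/(mom_rank t z) flat mom_rankE HE.
  by rewrite (leq_trans (mxrankM_maxr _ _))// mxrankM_maxr.
have [Z EZ] := row_freeP E_free.
have sign (q : {mpoly R[m]}) s : is_cstr q -> deg_le 2 q -> 0 <= q.@[v s 0].
  move=> cq dq; pose p := \sum_(a : monom_le m t.-1) Z (enum_rank a) s *: 'X_[R, bmnm a].
  have dp : deg_le t.-1 p := poly_of_coefs_deg_le _.
  have pE s' : p.@[v s' 0] = (s' == s)%:R.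
    have := congr1 (fun A : 'M[R]_r => A s' s) EZ; rewrite !mxE => <-.
    rewrite meval_sum.
    rewrite [RHS](reindex_onto enum_rank enum_val) => [|j _]; last by rewrite enum_valK.
    rewrite [RHS](eq_bigl xpredT) => [|a]; last by rewrite enum_rankK eqxx.
    by apply: eq_bigr => a _; rewrite mevalZ mxE enum_rankK mulrC.
  have dp' : deg_le k.-1 p by apply: deg_leW dp; lia.
  have := moment_cstr_ge0 cz cq dp'; rewrite evalE; last first.
    by apply: deg_leW (deg_leM dq (deg_le_sqr dp)); lia.
  rewrite (bigD1 s)//= big1 ?addr0 => [|s' /negbTE s's]; last first.
    by rewrite mevalM rmorphXn /= pE s's expr0n mulr0 mulr0.
  by rewrite mevalM rmorphXn /= pE eqxx expr1n mulr1 pmulr_rge0.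
move=> s; split=> [i|].
  have := sign 'X_i s; rewrite mevalXU; apply; last exact: deg_le_var.
  by apply: Or42; exists i.
rewrite -simplex_cstr_eval; apply: sign; first exact: Or43.
by apply: deg_leW (deg_le_simplex_cstr R m).
Qed.

End AtomsInSimplex.

Section TensorMoments.
Variables (R : realType) (m d : nat).
Local Notation n := m.+1.
Implicit Types (x : 'rV[R]_n) (a : 'X_{1..n}).

Lemma tpow_eval x (i : {ffun 'I_d -> 'I_n}) :
  tpow d x i = ('X_[mon_of_idx i] : {mpoly R[n]}).@[x 0].
Proof.
rewrite ffunE /mon_of_idx (big_morph (@mpolyX n R) (@mpolyXD n R) (@mpolyX0 n R)).
by rewrite rmorph_prod; apply: eq_bigr => j _; rewrite /= mevalXU.
Qed.

Lemma mon_of_idx_surj (e : nat) a : mdeg a = e ->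
  exists i : {ffun 'I_e -> 'I_n}, mon_of_idx i = a.
Proof.
elim: e a => [|e IH] a ae.
  exists [ffun=> ord0]; rewrite /mon_of_idx big_ord0.
  by apply/esym/eqP; rewrite -mdeg_eq0 ae.
have [b [c [aE db dc]]] := @mnm_split n a 1 (ltac:(by rewrite ae)).
have /mdeg1P[l /eqP bE] : mdeg b == 1%N by rewrite db.
have [|i iE] := IH c; first by rewrite dc ae subn1.
exists [ffun j => if unlift ord0 j is Some j' then i j' else l].
rewrite /mon_of_idx big_ord_recl ffunE unlift_none aE bE -iE; congr (_ + _)%MM.
by apply: eq_bigr => j _; rewrite ffunE liftK.
Qed.

Definition comb_tensor (I : finType) (c : I -> R) (x : I -> 'rV[R]_n) : tensor R n d :=
  [ffun i => \sum_s c s * tpow d (x s) i].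

Lemma phi_comb_tensor (I : finType) (c : I -> R) (x : I -> 'rV[R]_n)
    (a : monom_eq n d) :
  phi (comb_tensor c x) a = \sum_s c s * ('X_[bmnm (val a)] : {mpoly R[n]}).@[x s 0].
Proof.
rewrite ffunE; case: pickP => [i /eqP ia|none].
  by rewrite ffunE; apply: eq_bigr => s _; rewrite tpow_eval ia.
have [i iE] := mon_of_idx_surj (eqP (valP a)).
by have := none i; rewrite iE eqxx.
Qed.

Lemma hpairing_comb_tensor (I : finType) (c : I -> R) (x : I -> 'rV[R]_n)
    (p : {mpoly R[n]}) : p \is d.-homog ->
  hpairing p (phi (comb_tensor c x)) = \sum_s c s * p.@[x s 0].
Proof.
move=> hp; have dp : deg_le d p.
  apply/deg_leP => a da; apply: memN_msupp_eq0; apply: contraL da => pa.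
  by rewrite -leqNgt (dhomogP _ _ _ hp _ pa).
rewrite /hpairing; under eq_bigr do rewrite phi_comb_tensor mulr_sumr.
rewrite exchange_big; apply: eq_bigr => s _ /=.
rewrite [p in RHS](mpoly_monom_sum dp) meval_sum mulr_sumr.
rewrite [RHS](bigID (fun a : monom_le n d => mdeg (bmnm a) == d)) /=.
rewrite [X in _ = _ + X]big1 ?addr0 => [|a ad]; last first.
  suff -> : p@_(bmnm a) = 0 by rewrite scale0r meval0 mulr0.
  apply: memN_msupp_eq0; apply: contra ad => pa.
  by rewrite (dhomogP _ _ _ hp _ pa).
rewrite (@reindex_omap _ _ _ _ (monom_eq n d) val insub) /=; last first.
  by move=> a ad; rewrite insubT.
apply: eq_big => [a|a _]; last by rewrite mevalZ mulrCA.
by rewrite valK eqxx andbT (valP a).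
Qed.

Definition bar x : 'rV[R]_m := \row_j x 0 (widen_ord (leqnSn m) j).

Lemma xbar_mon_eval x (a : 'X_{1..m}) :
  (xbar_mon R (n := n) a).@[x 0] = ('X_[a] : {mpoly R[m]}).@[bar x 0].
Proof.
rewrite /xbar_mon mevalX rmorph_prod; apply: eq_bigr => j _ /=.
by rewrite rmorphXn /= mevalXU mxE; congr (x 0 _ ^+ _); apply: val_inj.
Qed.

Lemma xbar_mon_homog (a : 'X_{1..m}) : xbar_mon R (n := n) a \is (mdeg a).-homog.
Proof.
rewrite /xbar_mon; under eq_bigr do rewrite mpolyXn.
rewrite -(big_morph (@mpolyX n R) (@mpolyXD n R) (@mpolyX0 n R)) dhomogX.
rewrite /= mdeg_sum mdegE; apply/eqP; apply: eq_bigr => j _.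
by rewrite mdegMn mdeg1 mul1n.
Qed.

Lemma varpi_invT_comb_tensor (I : finType) (c : I -> R) (x : I -> 'rV[R]_n)
    (a : monom_le m d) :
  varpi_invT (phi (comb_tensor c x)) a = \sum_s c s *
    (('X_[bmnm a] : {mpoly R[m]}).@[bar (x s) 0] * (\sum_i x s 0 i) ^+ (d - mdeg (bmnm a))).
Proof.
have ad : (mdeg (bmnm a) <= d)%N by rewrite -ltnS bmdeg.
rewrite ffunE hpairing_comb_tensor; last first.
  have sumH : (\sum_(i < n) 'X_i : {mpoly R[n]}) \is 1.-homog.
    by apply: rpred_sum => i _; rewrite dhomogX /= mdeg1.
  have := dhomogM (xbar_mon_homog (bmnm a)) (dhomogMn (d - mdeg (bmnm a)) sumH).
  by rewrite mul1n subnKC.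
apply: eq_bigr => s _; rewrite mevalM xbar_mon_eval rmorphXn /= meval_sum.
by congr (_ * (_ * _ ^+ _)); apply: eq_bigr => j _; rewrite mevalXU.
Qed.

Lemma mevalX_addU (a : 'X_{1..m}) (j : 'I_m) (u : 'rV[R]_m) :
  ('X_[a + U_(j)] : {mpoly R[m]}).@[u 0] = ('X_[a] : {mpoly R[m]}).@[u 0] * u 0 j.
Proof. by rewrite mpolyXD mevalM mevalXU. Qed.

(** The moments determine the tensor: as $x_n = e^T x - \sum_{j<n} x_j$, the forms
    $\bar x^\alpha (e^T x)^{d - |\alpha|}$ span the forms of degree [d]. *)
Lemma comb_tensor_inj (I I' : finType) (c : I -> R) (c' : I' -> R)
    (x : I -> 'rV[R]_n) (x' : I' -> 'rV[R]_n) :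
  varpi_invT (phi (comb_tensor c x)) = varpi_invT (phi (comb_tensor c' x')) ->
  comb_tensor c x = comb_tensor c' x'.
Proof.
move=> w.
pose T (J : finType) (e : J -> R) (y : J -> 'rV[R]_n) (a : 'X_{1..m}) b f :=
  \sum_s e s * (('X_[a] : {mpoly R[m]}).@[bar (y s) 0] * y s 0 ord_max ^+ b
                * (\sum_i y s 0 i) ^+ f).
have TS (J : finType) (e : J -> R) (y : J -> 'rV[R]_n) (a : 'X_{1..m}) b f :
    T J e y a b.+1 f = T J e y a b f.+1 - \sum_j T J e y (a + U_(j))%MM b f.
  rewrite /T exchange_big -sumrB; apply: eq_bigr => s _.
  under eq_bigr do rewrite mevalX_addU.
  have -> : \sum_(j < m) e s * (('X_[a] : {mpoly R[m]}).@[bar (y s) 0] * bar (y s) 0 j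
      * y s 0 ord_max ^+ b * (\sum_i y s 0 i) ^+ f)
      = e s * (('X_[a] : {mpoly R[m]}).@[bar (y s) 0] * (\sum_j bar (y s) 0 j)
      * y s 0 ord_max ^+ b * (\sum_i y s 0 i) ^+ f).
    by rewrite mulr_sumr !mulr_suml mulr_sumr.
  have -> : \sum_j bar (y s) 0 j = \sum_i y s 0 i - y s 0 ord_max.
    rewrite big_ord_recr /= addrK; apply: eq_bigr => j _; rewrite mxE.
    by congr (y s 0 _); apply: val_inj.
  by rewrite !exprS; ring.
have eqT b : forall (a : 'X_{1..m}) f, (mdeg a + b + f = d)%N -> T I c x a b f = T I' c' x' a b f.
  elim: b => [|b IH] a f abf; last first.
    rewrite !TS IH; last by rewrite -abf; lia.
    congr (_ - _); apply: eq_bigr => j _; apply: IH.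
    by rewrite -abf mdegD mdeg1; lia.
  have ad : (mdeg a < d.+1)%N by rewrite ltnS -abf addn0 leq_addr.
  have fE : f = (d - mdeg a)%N by rewrite -abf addn0 addKn.
  have := congr1 (fun y : tms R m d => y (BMultinom ad)) w.
  rewrite !varpi_invT_comb_tensor /= -fE.
  have T0 (J : finType) (e : J -> R) (y : J -> 'rV[R]_n) : T J e y a 0%N f =
      \sum_s e s * (('X_[a] : {mpoly R[m]}).@[bar (y s) 0] * (\sum_i y s 0 i) ^+ f).
    by rewrite /T; apply: eq_bigr => s _; rewrite expr0 mulr1.
  by rewrite !T0.
apply/ffunP => i; pose mi : 'X_{1..n} := mon_of_idx i.
pose a : 'X_{1..m} := [multinom mi (widen_ord (leqnSn m) j) | j < m].
have miE (J : finType) (e : J -> R) (y : J -> 'rV[R]_n) :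
    comb_tensor e y i = T J e y a (mi ord_max) 0%N.
  rewrite ffunE; apply: eq_bigr => s _; rewrite tpow_eval expr0 mulr1 !mevalX.
  rewrite big_ord_recr /=; congr (_ * (_ * _)); apply: eq_bigr => j _.
  rewrite mnmE mxE; congr (y s 0 _ ^+ mi _); exact: val_inj.
rewrite !miE; apply: eqT; rewrite addn0.
have <- : mdeg mi = d.
  rewrite /mi /mon_of_idx mdeg_sum.
  by under eq_bigr do rewrite mdeg1; rewrite sum_nat_const card_ord muln1.
rewrite !mdegE big_ord_recr /=; congr (_ + _)%N; apply: eq_bigr => j _.
by rewrite mnmE; congr (mi _); apply: val_inj.
Qed.

(** Normalizing the vectors of a decomposition to have coordinate sum one gives
    a measure on the simplex with the prescribed moments. *)
Lemma completely_positive_atoms (A : tensor R n d) : (0 < d)%N -> completely_positive A ->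
  exists (r : nat) (lam : 'I_r -> R) (u : 'I_r -> 'rV[R]_m),
    [/\ forall i, 0 <= lam i, forall i, in_simplex (u i)
      & varpi_invT (phi A) = tms_comb (index_enum _) lam (fun i => point_moments d (u i))].
Proof.
move=> d0 [r [v [v0 AE]]].
have {}AE : A = comb_tensor (fun _ : 'I_r => 1) v.
  apply/ffunP => i; rewrite AE sum_ffunE ffunE; apply: eq_bigr => s _.
  by rewrite mul1r.
pose sg s := \sum_i v s 0 i.
have sg0 s : 0 <= sg s by apply: sumr_ge0.
have sgE s : \sum_j bar (v s) 0 j = sg s - v s 0 ord_max.
  rewrite /sg big_ord_recr /= addrK; apply: eq_bigr => j _; rewrite mxE.
  by congr (v s 0 _); apply: val_inj.
exists r, (fun s => sg s ^+ d), (fun s => (sg s)^-1 *: bar (v s)); split=> [s|s|].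
- exact: exprn_ge0.
- split=> [j|]; first by rewrite !mxE mulr_ge0 ?invr_ge0.
  under eq_bigr do rewrite mxE; rewrite -mulr_sumr sgE subr_ge0.
  have [->|s0] := eqVneq (sg s) 0; first by rewrite invr0 mul0r ler01.
  have sp : 0 < sg s by rewrite lt0r s0 sg0.
  by rewrite mulrC ler_pdivrMr// mul1r gerBl.
apply/ffunP => a; rewrite AE varpi_invT_comb_tensor ffunE; apply: eq_bigr => s _.
rewrite mul1r ffunE -/(sg s) !mevalX.
have ad : (mdeg (bmnm a) <= d)%N by rewrite -ltnS bmdeg.
have [s0|s0] := eqVneq (sg s) 0.
  rewrite s0 [X in _ = X * _]expr0n gtn_eqF// mul0r.
  have [da|da] := posnP (d - mdeg (bmnm a))%N; last by rewrite expr0n gtn_eqF ?mulr0.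
  have : (0 < mdeg (bmnm a))%N by move: d0 ad da; lia.
  rewrite mdegE lt0n sum_nat_eq0 negb_forall => /existsP[j /= aj].
  rewrite (bigD1 j)//=; suff -> : bar (v s) 0 j = 0.
    by rewrite expr0n (negbTE aj) !mul0r.
  rewrite mxE; have /psumr_eq0P := s0; apply => // i _; exact: v0.
have -> : \prod_i ((sg s)^-1 *: bar (v s)) 0 i ^+ bmnm a i =
    (sg s)^-1 ^+ mdeg (bmnm a) * \prod_i bar (v s) 0 i ^+ bmnm a i.
  rewrite mdegE -prodrXr -big_split; apply: eq_bigr => i _.
  by rewrite mxE exprMn.
rewrite mulrA mulrC; congr (_ * _).
have -> : sg s ^+ d = sg s ^+ (d - mdeg (bmnm a)) * sg s ^+ mdeg (bmnm a).
  by rewrite -exprD subnK.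
by rewrite exprVn -mulrA mulfV ?mulr1// expf_neq0.
Qed.

Lemma sum_lift_point (u : 'rV[R]_m) : \sum_j lift_point (n := n) u 0 j = 1.
Proof.
rewrite big_ord_recr /= !mxE insubF /= ?ltnn//.
under eq_bigr => j _ do rewrite mxE /= valK /=.
by rewrite subrKC.
Qed.

Lemma bar_lift_point (u : 'rV[R]_m) : bar (lift_point (n := n) u) = u.
Proof. by apply/rowP => j; rewrite !mxE /= valK. Qed.

Lemma lift_point_ge0 (u : 'rV[R]_m) j : in_simplex u -> 0 <= lift_point (n := n) u 0 j.
Proof. by move=> [u0 u1]; rewrite mxE; case: insubP => [i _ _|_] /=. Qed.

Lemma decomposition_of_atoms (A : tensor R n d) (r : nat) (lam : 'I_r -> R)
    (v : 'I_r -> 'rV[R]_m) : completely_positive A ->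
  varpi_invT (phi A) = tms_comb (index_enum _) lam (fun i => point_moments d (v i)) ->
  forall i, A i = \sum_s lam s * tpow d (lift_point (n := n) (v s)) i.
Proof.
move=> [q [x [x0 AE]]] wE i.
have {}AE : A = comb_tensor (fun _ : 'I_q => 1) x.
  by apply/ffunP => l; rewrite AE sum_ffunE ffunE; apply: eq_bigr => s _; rewrite mul1r.
suff -> : A = comb_tensor lam (fun s => lift_point (n := n) (v s)) by rewrite ffunE.
rewrite AE; apply: comb_tensor_inj; rewrite -AE wE; apply/ffunP => a.
rewrite varpi_invT_comb_tensor ffunE; apply: eq_bigr => s _.
by rewrite sum_lift_point expr1n mulr1 bar_lift_point ffunE.
Qed.

End TensorMoments.

(** * Flatness of the minimizers for generic objectives *)

Section GenericNull.
Variables (R : realType) (m D : nat).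
Hypotheses (m_gt0 : (0 < m)%N) (D_ge2 : (2 <= D)%N).
Let N := #|{: monom_le m (m * D)}|.

Definition face_family (S : {set option 'I_m}) (lo : option 'I_m) (a : monom_le m D) :=
  face_mx (R := R) D S lo N 'X_[bmnm a].

(** The exceptional set.  Only the coefficients of degree [D] matter, so it does not
    change when a polynomial of lower degree is subtracted. *)
Definition degenerate (c : tms R m D) : Prop :=
  exists (S : {set option 'I_m}) (lo : option 'I_m),
    \det (lin_mx_comb (face_family S lo) c) = 0.

Lemma face_family_comb S lo (F : {mpoly R[m]}) : deg_le D F ->
  lin_mx_comb (face_family S lo) (coefs D F) = face_mx D S lo N F.
Proof.
move=> dF; rewrite [in RHS](mpoly_monom_sum dF) face_mx_comb.
by apply: eq_bigr => a _; rewrite ffunE.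
Qed.

Lemma degenerate_null : lebesgue_null degenerate.
Proof.
have card0 : (0 < #|{: monom_le m D}|)%N by apply/card_gt0P; exists (@bm0 m D).
pose N_ (b : nat) (x : tms R m D) :=
  if unpickle b is Some (S', lo, B) then
    \det (lin_mx_comb (face_family S' lo) x) = 0 /\ forall i, `|x i| <= (B : nat)%:R
  else False.
apply: (null_of_finite_covers (N_ := N_)) => // [x [S [lo Sx]]|b eps eps0].
  exists (pickle (S, lo, (Num.truncn (\sum_i `|x i|)).+1)).
  rewrite /N_ pickleK; split=> // i.
  apply: le_trans (ltW (truncnS_gt _)); rewrite (bigD1 i)//= lerDl.
  exact: sumr_ge0.
rewrite /N_; case: unpickle => [[[S lo] B]|]; last first.
  by exists [::]; split=> //; rewrite big_nil ltW.
pose v (a : monom_le m D) : nat :=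
  (\sum_(i | pure_index lo i) (U_(i) *+ D == bmnm a)%MM)%N.
apply: (@det_zero_finite_cover _ _ _ (face_family S lo) v) => //.
have dP : deg_le D (pure_powers R D lo).
  by apply: deg_le_sum => i _; apply: deg_le_mon; rewrite mdegMn mdeg1 mul1n.
have -> : lin_mx_comb (face_family S lo) (fun i => (v i)%:R)
    = face_mx D S lo N (pure_powers R D lo).
  rewrite -(face_family_comb S lo dP); apply: eq_bigr => a _.
  by rewrite ffunE mcoeff_pure_powers.
exact: face_mx_pure_powers.
Qed.

End GenericNull.

Section EventuallyFlat.
Variables (R : realType) (m d : nat) (F rho : {mpoly R[m]}) (w : tms R m d).
Variables (r : nat) (lam : 'I_r -> R) (u : 'I_r -> 'rV[R]_m).
Hypothesis lam0 : forall i, 0 <= lam i.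
Hypothesis su : forall i, in_simplex (u i).
Hypothesis wE : w = tms_comb (index_enum _) lam (fun i => point_moments d (u i)).
Hypothesis dF : deg_le (2 * d1 d) F.
Hypothesis max_rho : dual_maximizer (2 * d1 d) F w rho.

Lemma d1_gt0 : (0 < d1 d)%N.
Proof. by rewrite /d1 uphalf_gt0. Qed.

Lemma d_lt_2d1 : (d < 2 * d1 d)%N.
Proof. by have := leq_uphalf_double d.+1 (d1 d); rewrite /d1 leqnn -mul2n. Qed.

Lemma minimizer_gap k (z : tms R m (2 * k)) : (d1 d <= k)%N ->
  relax_minimizer F w z -> pairing (F - rho) z <= 0.
Proof.
move=> dk [[zw _] zmin].
have k0 : (0 < k)%N := leq_trans d1_gt0 dk.
have d2k : (2 * d1 d <= 2 * k)%N by rewrite leq_mul2l dk orbT.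
have [z' [fz' Fz']] := moment_no_gap k0 (ltnW (leq_trans d_lt_2d1 d2k)) d2k
  (ltnW d_lt_2d1) dF lam0 su wE max_rho.
have [[_ drho] _] := max_rho.
rewrite pairingB subr_le0 -(pairing_trunc z drho) zw -Fz'.
exact: zmin.
Qed.

Hypothesis m_gt0 : (0 < m)%N.
Hypothesis nondeg : ~ degenerate (coefs (2 * d1 d) F).
Hypothesis qm : quad_module (F - rho).

(** The polynomials that all minimizers of high order annihilate form an ideal of
    finite codimension.  This bounds the ranks of the moment matrices by a constant
    [C] independent of the order, and flatness follows as soon as more than [C]
    rank tests are available. *)
Lemma eventually_flat : exists2 k, (d1 d <= k)%N & forall z : tms R m (2 * k),
  relax_minimizer F w z ->
  exists2 t, (d0 d <= t <= k)%N & mom_rank t z = mom_rank t.-1 z.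
Proof.
have [[[dG _] drho] _] := max_rho.
have D2 : (2 <= 2 * d1 d)%N by have := d1_gt0; lia.
have [s GE] := quad_module_facets qm.
pose Z k (z : tms R m (2 * k)) := (d1 d <= k)%N /\ relax_minimizer F w z.
have Js := facets_eventually_null GE (Z := Z)
  (fun k z (Zz : Z k z) => (proj2 (proj1 (proj2 Zz)))).
have {}Js c p : p \in s c -> eventually_null Z (facet1 R c * p).
  by apply: Js; exists 0%N => k z _ [dk]; exact: minimizer_gap.
have idJ := eventually_null_ideal Z.
have face i (S : {set option 'I_m}) : S != setT -> exists2 lo, lo \notin S &
    exists2 q : {poly R}, q != 0 & face_ideal S lo (F - rho) (univ i q).
  move=> ST; have [lo loS lo_top] : exists2 lo, lo \notin S & lo = None \/ None \in S.
    have [nS|nS] := boolP (None \in S); last by exists None => //; left.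
    have /existsP[lo loS] : [exists lo, lo \notin S].
      rewrite -negb_forall; apply: contra ST => /forallP allS.
      by apply/eqP/setP => o; rewrite in_setT allS.
    by exists lo => //; right.
  exists lo => //; apply: (univ_face_ideal i D2 dG _ loS lo_top).
  have drho' : deg_le (2 * d1 d).-1 rho by apply: deg_leW drho; have := d_lt_2d1; lia.
  rewrite (face_mxB S lo _ D2 _ drho') -face_family_comb//.
  rewrite unitmxE unitfE; apply/eqP => det0.
  by apply: nondeg; exists S, lo.
have [q qP] : exists q : 'I_m -> {poly R}, forall i,
    q i != 0 /\ eventually_null Z (univ i (q i)).
  apply: (@fin_all_exists _ _ (fun i qi => qi != 0 /\ eventually_null Z (univ i qi))) => i.
  have [qi qi0 Jqi] := univ_ideal_of_faces idJ GE Js (face i).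
  by exists qi.
have [B BP] : exists B : 'I_m -> nat, forall i k (z : tms R m (2 * k)) h,
    Z k z -> (msize h + B i <= k)%N -> pairing (univ i (q i) * h) z = 0.
  apply: (@fin_all_exists _ _ (fun i Bi => forall k (z : tms R m (2 * k)) h,
    Z k z -> (msize h + Bi <= k)%N -> pairing (univ i (q i) * h) z = 0)) => i.
  by have [_ [Bi BiP]] := qP i; exists Bi.
pose C := #|{: monom_le m (\sum_i (size (q i)).-1)}|.
(* [C] rank increases from [d0 d] on are impossible; the order [k] leaves room for
   products of two monomials of degree [T] with the constants [B i]. *)
pose T := (d0 d + C)%N.
pose k := (d1 d + ((2 * T).+1 + \max_i B i))%N.
exists k; first exact: leq_addr.
move=> z zmin.
have [|||t tT tflat] := @stationary_exists (fun t => mom_rank t z) (d0 d) T C.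
- by move=> t; apply: mom_rank_mono; exact: leq_pred.
- apply: mom_rank_le => [i|i h dh]; first by case: (qP i).
  apply: BP; first by split=> //; exact: leq_addr.
  apply: leq_trans (leq_addl _ _); apply: leq_add; first exact: dh.
  exact: leq_bigmax.
- exact: leqnn.
exists t => //; case/andP: tT => -> /= tT; rewrite (leq_trans tT)//.
by rewrite /k; lia.
Qed.

End EventuallyFlat.

(** * The membership algorithm *)

Section Algorithm.
Variables (R : realType) (m d : nat) (F : {mpoly R[m]}) (w : tms R m d).

Lemma stepE (s s' : state R m) : step F w s s' ->
  match s with
  | Solve k => (exists z : tms R m (2 * k), relax_minimizer F w z /\ s' = Check (d0 d) z) \/
               ((forall z : tms R m (2 * k), ~ relax_feasible w z) /\ s' = OutputNotCP)
  | Check k t z => mom_rank t z <> mom_rank t.-1 z /\ s' = Advance t z \/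
                   mom_rank t z = mom_rank t.-1 z /\ s' = Extract t z
  | Advance k t z => (t < k)%N /\ s' = Check t.+1 z \/ (k <= t)%N /\ s' = Solve k.+1
  | Extract k t z => exists (lam : 'I_(mom_rank t z) -> R) v,
      atomic_repr lam v (trunc (2 * t) z) /\ s' = OutputDecomposition lam v
  | _ => False
  end.
Proof.
case=> [k nf|k z zmin|k t z ne|k t z e|k t z tk|k t z kt|k t z lam v lv].
- by right.
- by left; exists z.
- by left.
- by right.
- by left.
- by right.
- by exists lam, v.
Qed.

Variable post : state R m -> Prop.

(** Descending induction on [t], as the tests run upwards until [k]. *)
Lemma check_terminates (k : nat) (z : tms R m (2 * k)) :
  (forall t, (d0 d <= t <= k)%N -> mom_rank t z = mom_rank t.-1 z ->
     terminates_in (step F w) post (Extract t z)) ->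
  forall t, (d0 d <= t <= k)%N ->
  (exists2 t', (t <= t' <= k)%N & mom_rank t' z = mom_rank t'.-1 z) \/
    terminates_in (step F w) post (Solve k.+1) ->
  terminates_in (step F w) post (Check t z).
Proof.
move=> extract t; have [n] := ubnP (k - t)%N; elim: n t => // n IH t ktn tk next.
have [e|/eqP ne] := eqVneq (mom_rank t z) (mom_rank t.-1 z).
  apply: Running; first by exists (Extract t z); exact: StepFlat.
  by move=> s' /stepE[[]//|[_ ->]]; exact: extract.
have {}next : (exists2 t', (t.+1 <= t' <= k)%N & mom_rank t' z = mom_rank t'.-1 z) \/
    terminates_in (step F w) post (Solve k.+1).
  case: next => [[t' tt' e]|]; last by right.
  left; exists t' => //; case/andP: tt' => tt' ->; rewrite andbT ltn_neqAle tt' andbT.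
  by apply: contra_not_neq ne => ->.
apply: Running; first by exists (Advance t z); exact: StepNotFlat.
move=> s' /stepE[[_ ->]|[e _]]; last by [].
have [tltk|kt] := ltnP t k.
  apply: Running; first by exists (Check t.+1 z); exact: StepIncrT.
  move=> s'' /stepE[[_ ->]|[kt _]]; last by move: tltk; rewrite ltnNge kt.
  apply: IH => //; first by move: ktn tltk; lia.
  by rewrite tltk andbT; case/andP: tk => dt _; exact: ltnW.
apply: Running; first by exists (Solve k.+1); exact: StepIncrK.
move=> s'' /stepE[[tk' _]|[_ ->]]; first by move: kt; rewrite leqNgt tk'.
case: next => // -[t' /andP[tt' t'k] _].
by move: (leq_trans tt' t'k); rewrite ltnNge kt.
Qed.

End Algorithm.

Theorem theorem3p6 (R : realType) (n d : nat) (hn : (2 <= n)%N)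
    (hd : (1 <= d)%N) (A : tensor R n d)
    (symA : symmetric_tensor A) (cpA : completely_positive A) :
  exists N : tms R n.-1 (2 * d1 d) -> Prop, lebesgue_null N /\
  forall F : mvpoly R n.-1, sos_le (2 * d1 d) F -> ~ N (coefs (2 * d1 d) F) ->
  (exists rho : mvpoly R n.-1,
      dual_maximizer (2 * d1 d) F (varpi_invT (phi A)) rho /\
      quad_module (F - rho)) ->
  terminates_in (step F (varpi_invT (phi A))) (outputs_cp_decomposition A)
    (Solve (d1 d)).
Proof.
case: n hn A symA cpA => // m m_gt0 A symA cpA.
rewrite ltnS in m_gt0.
have D2 : (2 <= 2 * d1 d)%N by have := d1_gt0 d; lia.
exists (@degenerate R m (2 * d1 d)); split; first exact: degenerate_null.
move=> F [_ dF] nondeg [rho [max_rho qm]].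
have [r [lam [u [lam0 su wE]]]] := completely_positive_atoms hd cpA.
set w := varpi_invT (phi A) in max_rho wE *.
have [K dK flatK] := eventually_flat lam0 su wE dF max_rho m_gt0 nondeg qm.
have extract k (z : tms R m (2 * k)) t : relax_feasible w z -> (d0 d <= t <= k)%N ->
    mom_rank t z = mom_rank t.-1 z ->
    terminates_in (step F w) (outputs_cp_decomposition A) (Extract t z).
  move=> [zw cz] /andP[dt tk] e.
  have t0 : (0 < t)%N by apply: leq_trans dt; rewrite /d0 uphalf_gt0.
  apply: Running.
    have z_pos p : deg_le t p -> 0 <= pairing (p ^+ 2) z.
      by move=> dp; apply: moment_sqr_ge0 cz _; exact: deg_leW dp.
    have [lam' [v lv]] := flat_atomic t0 z_pos e.
    by exists (OutputDecomposition lam' v); exact: StepExtract.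
  move=> s' /stepE[lam' [v [lv ->]]]; apply: Halted => [s'' /stepE//|].
  have sv := flat_atoms_in_simplex cz (introT andP (conj t0 tk)) e lv.
  have [lam'0 _ zE] := lv; split=> [i|i j|]; first exact: ltW.
    exact: lift_point_ge0.
  apply: decomposition_of_atoms cpA _; apply/ffunP => a.
  have d2t : (d <= 2 * t)%N by rewrite mul2n -leq_uphalf_double.
  have a2t : (mdeg (bmnm a) < (2 * t).+1)%N by apply: leq_trans (bmdeg a) _.
  rewrite -/w -zw -pairing_mon pairing_trunc; last by apply: deg_le_mon; rewrite -ltnS bmdeg.
  rewrite -(pairing_trunc (D' := 2 * t)); last by apply: deg_le_mon.
  rewrite -[bmnm a]/(bmnm (BMultinom a2t)) pairing_mon zE ffunE.
  by apply: eq_bigr => s _; rewrite ffunE.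
(* At order [K] the rank test succeeds at the latest; the earlier orders are handled
   by descending induction. *)
have solve k : (d1 d <= k <= K)%N ->
    terminates_in (step F w) (outputs_cp_decomposition A) (Solve k).
  have [n] := ubnP (K - k)%N; elim: n k => // n IH k Kkn /andP[dk kK].
  have k0 : (0 < k)%N := leq_trans (d1_gt0 d) dk.
  have d2k : (d <= 2 * k)%N.
    by apply: leq_trans (ltnW (d_lt_2d1 d)) _; rewrite leq_mul2l dk orbT.
  have feas : exists z : tms R m (2 * k), relax_feasible w z.
    by eexists; exact: (atoms_relax_feasible k0 d2k lam0 su wE).
  apply: Running.
    have [z zmin] := relax_minimizer_exists F feas.
    by exists (Check (d0 d) z); exact: StepMinimize.
  move=> s' /stepE[[z [zmin ->]]|[nf _]]; last by have [z /nf] := feas.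
  have d0k : (d0 d <= k)%N.
    by apply: leq_trans dk; rewrite /d0 /d1 uphalf_half; lia.
  apply: check_terminates => [t||]; first exact: extract (proj1 zmin).
    by rewrite leqnn.
  have [Kk|kltK] := leqP K k; last first.
    by right; apply: IH; [move: Kkn kltK; lia | rewrite kltK andbT leqW].
  have kE : k = K by apply/eqP; rewrite eqn_leq kK Kk.
  by subst k; left; exact: flatK.
by apply: solve; rewrite leqnn.
Qed.
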